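(* Let $\beta>0$, $k>0$, $A>0$, $B>0$. Let $K:(0,\infty)^2\to[0,\infty)$ be measurable and symmetric with $$K(v_1,v_2)=K(v_2,v_1)\le \begin{cases} k(v_1v_2)^{-\beta}, & (v_1,v_2)\in(0,1)^2,\\ k\,v_2v_1^{-\beta}, & (v_1,v_2)\in(0,1)\times(1,\infty),\\ k(v_1+v_2), & (v_1,v_2)\in(1,\infty)^2.\end{cases}$$ Let $g:[0,\infty)^2\to[0,\infty)$, $(t,v)\mapsto g(t,v)$, be continuous and twice differentiable with respect to $v$, with $g(t,0)=0$ for all $t\ge0$, $|\partial_v g|<A$ and $|\partial_v^2 g|<B$. Let $c_{1,0}$ and $c_{2,0}$ be two non-negative functions in $L^1_{-2\beta,2}(0,\infty)$. If $T>0$ and $c_1$, $c_2$ are two weak solutions on $[0,T]$ to the growth-coagulation equation $$\partial_t c+\partial_v(gc)=Q(c)$$ with respective initial conditions $c_{1,0}$ and $c_{2,0}$ such that $$c_i\in L^\infty\big(0,T;L^1_{-2\beta,2}(0,\infty)\big),\quad i=1,2,$$ then there exists $C(T)>0$ depending only on $k$, $A$, and the $L^\infty(0,T;L^1_{-2\beta,2}(0,\infty))$-norms of $c_1$ and $c_2$ (the exponent $\beta$ and the time $T$ being fixed) such that $$\|c_1(t)-c_2(t)\|_{L^1_{-\beta,1}(0,\infty)}\le C(T)\,\|c_{1,0}-c_{2,0}\|_{L^1_{-\beta,1}(0,\infty)},\quad t\in[0,T].$$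
   Context: For $(m,r)\in\mathbb{R}^2$, $L^1_{m,r}(0,\infty):=L^1\big(0,\infty;(v^m+v^r)\,dv\big)$. The coagulation operator is $$Q(c)(v_1)=\frac12\int_0^{v_1}K(v_1-v_2,v_2)c(v_1-v_2)c(v_2)\,dv_2-\int_0^\infty K(v_1,v_2)c(v_1)c(v_2)\,dv_2.$$ For a weighted space $X=L^1_{m,r}(0,\infty)$, $C([0,T];w\text{-}X)$ is the space of functions from $[0,T]$ to $X$ that are continuous for the weak topology of $X$. Weak solution: for $T>0$, a weak solution on $[0,T]$ with initial condition $c_0$ is a non-negative function $c\in C\big([0,T];w\text{-}L^1_{-\beta,1}(0,\infty)\big)$ such that, for each $t\in[0,T]$ and $\phi\in W^{1,\infty}(0,\infty)$, $$\int_0^\infty c(t,v)\phi(v)\,dv=\int_0^\infty c_0(v)\phi(v)\,dv+\int_0^t\int_0^\infty\phi'(v)g(s,v)c(s,v)\,dv\,ds+\frac12\int_0^t\int_0^\infty\int_0^\infty\tilde\phi(v_1,v_2)K(v_1,v_2)c(s,v_2)c(s,v_1)\,dv_1dv_2ds,$$ where $\tilde\phi(v_1,v_2):=\phi(v_1+v_2)-\phi(v_1)-\phi(v_2)$. *)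

(* Defs.v *)
From HB Require Import structures.
From mathcomp Require Import all_boot all_order all_algebra.
From mathcomp Require Import all_classical all_reals all_analysis.
From mathcomp Require Import ess_sup_inf.
Import Order.TTheory GRing.Theory Num.Theory.
Import numFieldNormedType.Exports.

Set Implicit Arguments.
Unset Strict Implicit.
Unset Printing Implicit Defensive.

Local Open Scope classical_set_scope.
Local Open Scope ring_scope.

(* Elements of the Lebesgue spaces on (0, oo) are represented by (Borel
   measurable on (0, oo)) functions R -> R, whose values outside (0, oo) and on
   null sets are irrelevant. *)

Notation leb R := (@lebesgue_measure R).

Definition nonneg_ae (R : realType) (f : R -> R) : Prop :=
  {ae leb R, forall v, 0 < v -> 0 <= f v}.

Definition weightedL1_norm (R : realType) (m r : R) (f : R -> R) : \bar R :=
  (\int[leb R]_(v in `]0%R, +oo[) ((v `^ m + v `^ r) * `|f v|)%:E)%E.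

Definition weightedL1 (R : realType) (m r : R) (f : R -> R) : Prop :=
  measurable_fun (`]0, +oo[ : set R) f /\ (weightedL1_norm m r f < +oo)%E.

(* The elements of the dual of L^1_{m,r}; by the norm bound, l depends only on
   the a.e. class of its argument. *)
Definition dual_weightedL1 (R : realType) (m r : R) (l : (R -> R) -> R) : Prop :=
  (forall (a : R) (f h : R -> R), weightedL1 m r f -> weightedL1 m r h ->
     l (fun v => a * f v + h v) = a * l f + l h) /\
  (exists M : R, forall f, weightedL1 m r f ->
     (`|l f|%:E <= M%:E * weightedL1_norm m r f)%E).

(* C([0,T]; w-L^1_{m,r}): a map into a space carrying the weak topology is
   continuous iff its composites with all the elements of the dual are. *)
Definition weakly_continuous (R : realType) (T m r : R) (c : R -> R -> R) : Prop :=
  (forall t : R, 0 <= t <= T -> weightedL1 m r (c t)) /\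
  (forall l, dual_weightedL1 m r l ->
     {within `[0, T], continuous (fun t : R => l (c t))}).

Definition simple_weightedL1 (R : realType) (m r : R) (s : R -> R -> R) : Prop :=
  exists (n : nat) (E : 'I_n -> set R) (x : 'I_n -> R -> R),
    [/\ forall i, measurable (E i),
        forall i, weightedL1 m r (x i) &
        forall t v, s t v = \sum_(i < n) \1_(E i) t * x i v].

Definition strongly_measurable (R : realType) (T m r : R) (c : R -> R -> R) : Prop :=
  exists s : nat -> R -> R -> R,
    (forall n, simple_weightedL1 m r (s n)) /\
    {ae leb R, forall t, 0 < t < T ->
       weightedL1 m r (c t) /\
       weightedL1_norm m r (s n t \- c t) @[n --> \oo] --> 0%E}.

(* Extending by 0 outside (0,T) does not change the essential supremum, the
   norm being nonnegative. *)
Definition Linfty_weightedL1_norm (R : realType) (T m r : R) (c : R -> R -> R) :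
    \bar R :=
  ess_sup (leb R) ((fun t : R => weightedL1_norm m r (c t)) \_ `]0, T[).

Definition Linfty_weightedL1 (R : realType) (T m r : R) (c : R -> R -> R) : Prop :=
  strongly_measurable T m r c /\ (Linfty_weightedL1_norm T m r c < +oo)%E.

Definition Linfty_pos (R : realType) (f : R -> R) : Prop :=
  measurable_fun (`]0, +oo[ : set R) f /\
  exists M : R, {ae leb R, forall v, 0 < v -> `|f v| <= M}.

(* C_c^oo(0, oo) *)
Definition test_function (R : realType) (zeta : R -> R) : Prop :=
  (forall (n : nat) (x : R), derivable (derive1n n zeta) x 1) /\
  (exists a b : R, 0 < a /\ forall v, ~~ (a <= v <= b) -> zeta v = 0).

(* phi is in W^{1,oo}(0, oo) with weak derivative dphi *)
Definition W1infty (R : realType) (phi dphi : R -> R) : Prop :=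
  [/\ Linfty_pos phi, Linfty_pos dphi &
      forall zeta, test_function zeta ->
        \int[leb R]_(v in `]0, +oo[) (phi v * derive1 zeta v) =
        - \int[leb R]_(v in `]0, +oo[) (dphi v * zeta v)].

Definition weak_solution (R : realType) (beta T : R) (K g : R -> R -> R)
    (c0 : R -> R) (c : R -> R -> R) : Prop :=
  [/\ forall t : R, 0 <= t <= T -> nonneg_ae (c t),
      weakly_continuous T (- beta) 1 c &
      forall (t : R) (phi dphi : R -> R), 0 <= t <= T -> W1infty phi dphi ->
        \int[leb R]_(v in `]0, +oo[) (c t v * phi v) =
          \int[leb R]_(v in `]0, +oo[) (c0 v * phi v)
          + \int[leb R]_(s in `[0, t])
              \int[leb R]_(v in `]0, +oo[) (dphi v * g s v * c s v)
          + 2^-1 * \int[leb R]_(s in `[0, t])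
              \int[leb R]_(v2 in `]0, +oo[) \int[leb R]_(v1 in `]0, +oo[)
                ((phi (v1 + v2) - phi v1 - phi v2) * K v1 v2 * c s v2 * c s v1)].

(* No condition is imposed when v1 = 1 or v2 = 1; the case
   (v1, v2) in (1,oo) x (0,1) follows by symmetry. *)
Definition coagulation_kernel (R : realType) (beta k : R) (K : R -> R -> R) : Prop :=
  measurable_fun ((`]0, +oo[ : set R) `*` (`]0, +oo[ : set R)) (fun p : R * R => K p.1 p.2) /\
  forall v1 v2 : R, 0 < v1 -> 0 < v2 ->
    [/\ 0 <= K v1 v2,
        K v1 v2 = K v2 v1,
        v1 < 1 -> v2 < 1 -> K v1 v2 <= k * (v1 * v2) `^ (- beta),
        v1 < 1 -> 1 < v2 -> K v1 v2 <= k * v2 * v1 `^ (- beta) &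
        1 < v1 -> 1 < v2 -> K v1 v2 <= k * (v1 + v2)].

(* d is the derivative of f at x relative to D (one-sided at an endpoint) *)
Definition is_derive_within (R : realType) (D : set R) (f : R -> R) (x d : R) : Prop :=
  (f y - f x) / (y - x) @[y --> within D x^'] --> d.

Definition growth_rate (R : realType) (A B : R) (g : R -> R -> R) : Prop :=
  [/\ forall t v : R, 0 <= t -> 0 <= v -> 0 <= g t v,
      {within (`[0, +oo[ : set R) `*` (`[0, +oo[ : set R), continuous (fun p : R * R => g p.1 p.2)},
      forall t : R, 0 <= t -> g t 0 = 0 &
      exists dg d2g : R -> R -> R, forall t v : R, 0 <= t -> 0 <= v ->
        [/\ is_derive_within `[0, +oo[ (g t) v (dg t v),
            is_derive_within `[0, +oo[ (dg t) v (d2g t v),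
            `|dg t v| < A & `|d2g t v| < B]].

(* Main.v *)
From HB Require Import structures.
From mathcomp Require Import all_boot all_order all_algebra.
From mathcomp Require Import all_classical all_reals all_analysis.
From mathcomp Require Import ess_sup_inf measurable_realfun ring lra.
Require Import Defs.
Import Order.TTheory GRing.Theory Num.Theory.
Import numFieldNormedType.Exports.

(** Stability holds by a duality argument. With [omega v = v^(-beta) + v], the
    norm of [L^1_{-beta,1}] of [c1 t - c2 t] is the supremum of
    [E_t(phi) = int phi d(c1 t - c2 t)] ([diffJ]) over the [phi] with [|phi| <= omega]
    ([dual_norm]), so it suffices to bound [E_t(phi)] for smooth [phi] with
    bounded support. The coagulation term is quadratic and symmetric, hence its
    difference is the pairing of [c1 - c2] with
    [b_t(psi)(v2) = 1/2 int (psi(v1 + v2) - psi v1 - psi v2) K(v1, v2) d(c1 + c2)(v1)]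
    ([coag_term_diff]), and [E_t(phi)] is controlled by running the linear dual
    equation [psi_t + g psi' + b_t(psi) = 0] backwards from [psi(t) = phi].

    The weight [omega] survives the dual evolution. Transport moves [v] to
    [v + h g <= v + h A v], and [omega (v + x) <= omega v + x], so a bound
    [|psi| <= P omega] is kept up to a factor [1 + A h] ([flow_step]). For the
    coagulation part, [|psi(v1 + v2) - psi v1| <= P (omega v2 + 2 omega v1)]; the
    first summand produces the unbounded rate [a = 1/2 int K(v1, v2) d(c1 + c2)],
    but it is exactly absorbed by the damping term [- a psi v2], and the second
    one produces only [2 k M omega v2], because [K <= 2 k omega omega] and
    [M >= int omega^2 d(c1 + c2)] ([coag_step]). Here [omega^2] is at most twice
    the weight of [L^1_{-2 beta,2}], so [M = 2 (N1 + N2)] where [N1], [N2] are the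
    two given norms, and the constant of the theorem is [exp ((2 k M + A) T)].

    To avoid solving the dual equation, it is discretised by explicit Euler steps
    of size [h], and [K] is replaced by a smooth kernel [Kt] with bounded support,
    for which the test functions remain of class C^{1,1} with a Lipschitz constant
    that stays bounded after [t / h] steps ([one_step], [euler_iter]). As [h]
    tends to 0 the only error left ([smooth_bound]) is the integral over time of
    [|K - Kt| omega omega] against the square of [c1 + c2]. It is a weighted L^1
    distance between [K] and [Kt] that does not involve the Lipschitz constants,
    and the smooth kernels are dense for it ([kernel_approx]); this gives
    [dual_bound].

    The solutions enter as kernels from time to measures on [(0, oo)]
    ([solution_kernel]). The essential bound on the moments holds at every time by
    weak continuity ([moment_bound]), and C^{1,1} functions are admissible in the
    weak formulation ([C11_W1infty], [weak_solution_kernel_solution]). *)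

Set Implicit Arguments.
Unset Strict Implicit.
Unset Printing Implicit Defensive.

Local Open Scope classical_set_scope.
Local Open Scope ring_scope.

(** * Functions of class C^{1,1} on the half-line *)

Section C11.
Context {R : realType}.
Implicit Types (f g df dg : R -> R) (L : R).

(** The class C^{1,1} is encoded by its second order Taylor inequality: with this
    form, sums, products, compositions and averages over a parameter need no
    limit, and all constants are explicit. The inequality forces [df] to be the
    derivative of [f] and to be [2 L]-Lipschitz ([C11_dlip]). *)
Definition C11 L f df := forall u v : R, 0 < u -> 0 < v ->
  [/\ `|f v| <= L, `|df v| <= L & `|f u - f v - df v * (u - v)| <= L * (u - v) ^+ 2].

Lemma C11_ge0 L f df : C11 L f df -> 0 <= L.
Proof. by move=> /(_ _ _ ltr01 ltr01)[+ _ _]; exact: le_trans. Qed.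

Lemma C11_bnd L f df v : C11 L f df -> 0 < v -> `|f v| <= L.
Proof. by move=> H v0; have [] := H v v v0 v0. Qed.

Lemma C11_dbnd L f df v : C11 L f df -> 0 < v -> `|df v| <= L.
Proof. by move=> H v0; have [] := H v v v0 v0. Qed.

Lemma C11_dlip L f df u v : C11 L f df -> 0 < u -> 0 < v ->
  `|df u - df v| <= 2 * L * `|u - v|.
Proof.
move=> H u0 v0; have [->|uv] := eqVneq u v; first by rewrite !subrr normr0 mulr0.
have d0 : 0 < `|u - v| by rewrite normr_gt0 subr_eq0.
rewrite -(ler_pM2r d0) -normrM.
have [_ _ H1] := H u v u0 v0; have [_ _ H2] := H v u v0 u0.
rewrite -[X in _ <= X]mulrA -expr2 real_normK ?num_real//.
by move: H1 H2; rewrite !ler_norml => /andP[? ?] /andP[? ?]; apply/andP; split; lra.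
Qed.

Lemma C11_lip_loc L f df u v : C11 L f df -> 0 < u -> 0 < v ->
  `|f u - f v| <= L * `|u - v| + L * `|u - v| ^+ 2.
Proof.
move=> H u0 v0; have [_ H2 H1] := H u v u0 v0.
rewrite -[X in `|X|](subrK (df v * (u - v))) addrC (le_trans (ler_normD _ _))//.
rewrite lerD//; first by rewrite normrM ler_wpM2r.
by rewrite (le_trans H1)// real_normK// num_real.
Qed.

Lemma C11_lip L f df u v : C11 L f df -> 0 < u -> 0 < v ->
  `|f u - f v| <= 2 * L * `|u - v|.
Proof.
move=> H u0 v0; have L0 := C11_ge0 H.
have [d1|d1] := leP `|u - v| 1.
  rewrite (le_trans (C11_lip_loc H u0 v0))// -mulrA mulrDl mul1r lerD2l ler_wpM2l//.
  by rewrite expr2 ler_piMl.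
have [fv _ _] := H u v u0 v0; have [fu _ _] := H v u v0 u0.
rewrite (le_trans (ler_normB _ _))//.
have : L <= L * `|u - v| by rewrite ler_peMr// ltW.
by move: fv fu; lra.
Qed.

Lemma C11_le L L' f df : L <= L' -> C11 L f df -> C11 L' f df.
Proof.
move=> LL' H u v u0 v0; have [h1 h2 h3] := H u v u0 v0.
split; [exact: le_trans LL'|exact: le_trans LL'|].
by rewrite (le_trans h3)// ler_wpM2r// sqr_ge0.
Qed.

Lemma C11_cst L c : `|c| <= L -> C11 L (cst c) (cst 0).
Proof.
move=> cL u v u0 v0; have L0 : 0 <= L by exact: le_trans cL.
by split; rewrite /= ?normr0// subrr mul0r subr0 normr0 mulr_ge0// sqr_ge0.
Qed.

Lemma C11D L M f g df dg : C11 L f df -> C11 M g dg ->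
  C11 (L + M) (fun v => f v + g v) (fun v => df v + dg v).
Proof.
move=> Hf Hg u v u0 v0; have [f1 f2 f3] := Hf u v u0 v0; have [g1 g2 g3] := Hg u v u0 v0.
split; [by rewrite (le_trans (ler_normD _ _))// lerD..|].
rewrite (_ : _ - _ = (f u - f v - df v * (u - v)) + (g u - g v - dg v * (u - v))); last by ring.
by rewrite (le_trans (ler_normD _ _))// mulrDl lerD.
Qed.

Lemma C11Z L c f df : C11 L f df -> C11 (`|c| * L) (fun v => c * f v) (fun v => c * df v).
Proof.
move=> Hf u v u0 v0; have [f1 f2 f3] := Hf u v u0 v0.
split; rewrite ?normrM ?ler_wpM2l//.
rewrite (_ : _ - _ = c * (f u - f v - df v * (u - v))); last by ring.
by rewrite normrM -mulrA ler_wpM2l.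
Qed.

Lemma C11B L M f g df dg : C11 L f df -> C11 M g dg ->
  C11 (L + M) (fun v => f v - g v) (fun v => df v - dg v).
Proof.
move=> Hf Hg.
have := C11D Hf (C11Z (-1) Hg); rewrite normrN1 mul1r.
by under [X in C11 _ X]eq_fun do rewrite mulN1r;
   under [X in C11 _ _ X]eq_fun do rewrite mulN1r.
Qed.

Lemma C11M L M f g df dg : C11 L f df -> C11 M g dg ->
  C11 (6 * (L * M)) (fun v => f v * g v) (fun v => df v * g v + f v * dg v).
Proof.
move=> Hf Hg u v u0 v0.
have [f1 f2 f3] := Hf u v u0 v0; have [g1 g2 g3] := Hg u v u0 v0.
have L0 := C11_ge0 Hf; have M0 := C11_ge0 Hg.
have LM0 : 0 <= L * M by rewrite mulr_ge0.
have fg x y : `|x| <= L -> `|y| <= M -> `|x * y| <= L * M.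
  by move=> *; rewrite normrM ler_pM.
split.
- by rewrite (le_trans (fg _ _ f1 g1))// ler_peMl//; lra.
- by rewrite (le_trans (ler_normD _ _))//; have := fg _ _ f2 g1; have := fg _ _ f1 g2; lra.
- have lf := C11_lip Hf u0 v0; have lg := C11_lip Hg u0 v0.
  rewrite (_ : _ - _ = (f u - f v - df v * (u - v)) * g v
      + f v * (g u - g v - dg v * (u - v)) + (f u - f v) * (g u - g v)); last by ring.
  rewrite (le_trans (ler_normD _ _))//.
  rewrite (_ : 6 * (L * M) * _ = (L * (u - v) ^+ 2 * M + L * (M * (u - v) ^+ 2)) +
    (2 * L * `|u - v|) * (2 * M * `|u - v|)); last first.
    by rewrite -[in LHS](@real_normK _ (u - v)) ?num_real// -[in RHS](@real_normK _ (u - v)) ?num_real//; ring.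
  rewrite lerD//; last by rewrite normrM ler_pM.
  by rewrite (le_trans (ler_normD _ _))// lerD// normrM ler_pM.
Qed.

(** Along a near-identity flow the constant grows by a factor [1 + O(h)] only,
    because the flow stretches distances by at most [1 + h A]. This factor, and
    not a larger constant, is what allows [1 / h] successive compositions. *)
Lemma C11_flow L (A B h : R) f df g dg :
  C11 L f df -> 0 <= h <= 1 -> 0 <= A -> 0 <= B ->
  (forall u v, 0 < u -> 0 < v -> [/\ 0 <= g v, `|dg v| <= A,
     `|g u - g v| <= A * `|u - v| &
     `|g u - g v - dg v * (u - v)| <= B * (u - v) ^+ 2]) ->
  C11 (L * (1 + (2 * A + A ^+ 2 + B) * h)) (fun v => f (v + h * g v))
     (fun v => df (v + h * g v) * (1 + h * dg v)).
Proof.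
move=> Hf /andP[h0 h1] A0 B0 Hg u v u0 v0.
have L0 := C11_ge0 Hf.
have [gv dgv glip gT] := Hg u v u0 v0; have [gu _ _ _] := Hg v u v0 u0.
have U0 : 0 < u + h * g u by rewrite ltr_wpDr// mulr_ge0.
have V0 : 0 < v + h * g v by rewrite ltr_wpDr// mulr_ge0.
have [f1 f2 f3] := Hf _ _ U0 V0.
have AB0 : 0 <= (2 * A + A ^+ 2 + B) * h by rewrite mulr_ge0//; nra.
have dgv1 : `|1 + h * dg v| <= 1 + h * A.
  by rewrite (le_trans (ler_normD _ _))// normr1 lerD2l normrM ger0_norm// ler_wpM2l.
split.
- by rewrite (le_trans f1)// ler_peMr//; lra.
- by rewrite normrM ler_pM// (le_trans dgv1)// lerD2l mulrC ler_wpM2r//; nra.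
- set V := v + h * g v in V0 f1 f2 f3 *; set U := u + h * g u in U0 f3 *.
  have UV : `|U - V| <= (1 + h * A) * `|u - v|.
    rewrite (_ : U - V = (u - v) + h * (g u - g v)); last by rewrite /U /V; ring.
    rewrite (le_trans (ler_normD _ _))// mulrDl mul1r lerD2l normrM ger0_norm// -mulrA.
    by rewrite ler_wpM2l.
  rewrite (_ : _ - _ = (f U - f V - df V * (U - V)) +
      df V * (h * (g u - g v - dg v * (u - v)))); last by rewrite /U /V; ring.
  rewrite (le_trans (ler_normD _ _))//.
  have -> : L * (1 + (2 * A + A ^+ 2 + B) * h) * (u - v) ^+ 2 =
     L * (((1 + h * A) * `|u - v|) ^+ 2 + (h - h ^+ 2) * A ^+ 2 * `|u - v| ^+ 2)
     + L * (h * (B * (u - v) ^+ 2)).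
    rewrite exprMn -[in LHS](@real_normK _ (u - v)) ?num_real//.
    by rewrite -[in RHS](@real_normK _ (u - v)) ?num_real//; ring.
  rewrite lerD//; last by rewrite normrM ler_pM// normrM ger0_norm// ler_wpM2l.
  rewrite (le_trans f3)// ler_wpM2l//.
  rewrite -[leLHS](@real_normK _ (U - V)) ?num_real//.
  rewrite -[leLHS]addr0 lerD//; first by rewrite lerXn2r// ?nnegrE// mulr_ge0// ?addr_ge0// mulr_ge0.
  by rewrite mulr_ge0 ?mulr_ge0 ?sqr_ge0//; nra.
Qed.

Lemma C11_shift L (a : R) f df : 0 <= a -> C11 L f df ->
  C11 L (fun v => f (a + v)) (fun v => df (a + v)).
Proof.
move=> a0 Hf u v u0 v0.
have [f1 f2 f3] := Hf (a + u) (a + v) (ltr_wpDl a0 u0) (ltr_wpDl a0 v0).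
by split=> //; move: f3; rewrite (_ : a + u - (a + v) = u - v)//; ring.
Qed.

Definition pos2 (x : R) := Num.max x 0 ^+ 2.
(** A C^{1,1} transition from 0 to 1 over [0, 1]: the second derivative equals 4
    on the first half of the interval and -4 on the second half. *)
Definition step (x : R) := 2 * pos2 x - 4 * pos2 (x - 2^-1) + 2 * pos2 (x - 1).
Definition dstep (x : R) := 2 * (2 * Num.max x 0) - 4 * (2 * Num.max (x - 2^-1) 0)
  + 2 * (2 * Num.max (x - 1) 0).

Lemma pos2_taylor (x y : R) : `|pos2 x - pos2 y - 2 * Num.max y 0 * (x - y)| <= (x - y) ^+ 2.
Proof.
rewrite /pos2 ler_norml;
have := sqr_ge0 x; have := sqr_ge0 y; have := sqr_ge0 (x - y); rewrite !expr2 => *.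
have [x0|x0] := leP x 0; have [y0|y0] := leP y 0.
- by apply/andP; split; lra.
- have ? : x * y <= 0 by rewrite mulr_le0_ge0// ltW.
  by apply/andP; split; lra.
- have ? : x * y <= 0 by rewrite mulr_ge0_le0// ltW.
  by apply/andP; split; lra.
- by apply/andP; split; lra.
Qed.

Lemma step_taylor (x y : R) : `|step x - step y - dstep y * (x - y)| <= 8 * (x - y) ^+ 2.
Proof.
have h1 := pos2_taylor x y; have := pos2_taylor (x - 2^-1) (y - 2^-1).
have := pos2_taylor (x - 1) (y - 1).
rewrite (_ : x - 1 - (y - 1) = x - y); last by ring.
rewrite (_ : x - 2^-1 - (y - 2^-1) = x - y); last by ring.
move: h1; rewrite /step /dstep !ler_norml.
move: (Num.max _ 0) (Num.max _ 0) (Num.max _ 0) => a b c.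
by move: (pos2 _) (pos2 _) (pos2 _) (pos2 _) (pos2 _) (pos2 _) => *; lra.
Qed.

Lemma step_le0 (x : R) : x <= 0 -> step x = 0.
Proof.
by move=> x0; rewrite /step /pos2 !max_r; [ring|lra..].
Qed.

Lemma dstep_le0 (x : R) : x <= 0 -> dstep x = 0.
Proof.
by move=> x0; rewrite /dstep !max_r; [ring|lra..].
Qed.

Lemma step_ge1 (x : R) : 1 <= x -> step x = 1.
Proof.
by move=> x0; rewrite /step /pos2 !max_l; [field|lra..].
Qed.

Lemma dstep_ge1 (x : R) : 1 <= x -> dstep x = 0.
Proof.
by move=> x0; rewrite /dstep !max_l; [field|lra..].
Qed.

Lemma step01 (x : R) : 0 <= step x <= 1.
Proof.
have [x0|x0] := leP x 0; first by rewrite step_le0// lexx ler01.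
have [x1|x1] := leP 1 x; first by rewrite step_ge1// lexx ler01.
rewrite /step /pos2 (@max_l _ _ x); last by lra.
rewrite (@max_r _ _ (x - 1)); last by lra.
by have [x2|x2] := leP (x - 2^-1) 0; nra.
Qed.

Lemma dstep_bnd (x : R) : `|dstep x| <= 8.
Proof.
have [x0|x0] := leP x 0; first by rewrite dstep_le0// normr0.
have [x1|x1] := leP 1 x; first by rewrite dstep_ge1// normr0.
rewrite /dstep ler_norml (@max_l _ _ x); last by lra.
rewrite (@max_r _ _ (x - 1)); last by lra.
by have [x2|x2] := leP (x - 2^-1) 0; apply/andP; split; lra.
Qed.

Lemma C11_step (n a : R) : 1 <= n -> C11 (8 * n ^+ 2) (fun v => step (n * (v - a))) (fun v => n * dstep (n * (v - a))).
Proof.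
move=> n1 u v u0 v0.
have /andP[s0 s1] := step01 (n * (v - a)).
split.
- by rewrite ger0_norm//; nra.
- rewrite normrM (ger0_norm (le_trans ler01 n1)).
  by have := dstep_bnd (n * (v - a)); nra.
- have := step_taylor (n * (u - a)) (n * (v - a)).
  rewrite (_ : n * (u - a) - _ = n * (u - v)); last by ring.
  by rewrite exprMn (mulrA 8) (mulrCA (dstep _)) (mulrA n).
Qed.

End C11.

(** * Pairings with kernels of measures *)

(** Packages a finite measure, whose finiteness is only a hypothesis, as an
    instance of the structure that Fubini's theorem asks for. *)
Section finite_measure.
Context d (T : measurableType d) (R : realType) (mu : {measure set T -> \bar R}).
Hypothesis mf : fin_num_fun mu.
Definition finite_measure_of (_ : fin_num_fun mu) : set T -> \bar R := mu.
HB.instance Definition _ := Measure.on (finite_measure_of mf).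
HB.instance Definition _ := Measure_isFinite.Build d T R (finite_measure_of mf) mf.
End finite_measure.

(** Precomposition lets a kernel carry additional parameters that it ignores, so
    that iterated integrals with parameters are measurable. *)
Section precomposition.
Context d1 d2 d3 (X : measurableType d1) (Y : measurableType d2) (Z : measurableType d3)
  (R : realType) (k : R.-fker X ~> Y) (f : Z -> X) (mf : measurable_fun setT f).

Definition kernel_precomp (_ : measurable_fun setT f) : Z -> {measure set Y -> \bar R} := fun z => k (f z).

Let mkpre U : measurable U -> measurable_fun [set: Z] (kernel_precomp mf ^~ U).
Proof. by move=> mU; exact: (measurableT_comp (measurable_kernel k U mU) mf). Qed.

HB.instance Definition _ := isKernel.Build _ _ _ _ R (kernel_precomp mf) mkpre.

Let kpre_uub : measure_fam_uub (kernel_precomp mf).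
Proof. by have [r hr] := measure_uub k; exists r => z; exact: hr. Qed.

HB.instance Definition _ := Kernel_isFinite.Build _ _ _ _ R (kernel_precomp mf) kpre_uub.
End precomposition.

Section ker_meas.
Context d1 d2 (X : measurableType d1) (Y : measurableType d2) (R : realType).

Lemma measurable_fun_Rintegral_kernel (k : R.-fker X ~> Y) (D : set Y) (F : X * Y -> R) :
  measurable D -> measurable_fun setT F ->
  measurable_fun setT (fun x => \int[k x]_(y in D) F (x, y)).
Proof.
move=> mD mF.
have mFD : measurable_fun setT (fun p : X * Y => ((F p) * \1_D p.2)%:E).
  apply/measurable_EFinP; apply: measurable_funM => //.
  by apply: measurableT_comp => //; exact: measurable_indic.
have H x : \int[k x]_(y in D) F (x, y) = fine (
    \int[k x]_y ((fun p : X * Y => ((F p) * \1_D p.2)%:E)^\+ (x, y)) -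
    \int[k x]_y ((fun p : X * Y => ((F p) * \1_D p.2)%:E)^\- (x, y)))%E.
  rewrite /Rintegral; congr fine; rewrite integral_mkcond.
  rewrite [RHS](_ : _ = \int[k x]_y (((F (x, y)) * \1_D y)%:E))%E; last first.
    rewrite [RHS]integralE.
    congr (_ - _)%E; apply: eq_integral => y _.
      by rewrite (funepos_comp (fun p : X * Y => ((F p) * \1_D p.2)%:E) (fun y => (x, y))).
    by rewrite (funeneg_comp (fun p : X * Y => ((F p) * \1_D p.2)%:E) (fun y => (x, y))).
  apply: eq_integral => y _; rewrite patchE indicE; case: ifPn => _.
    by rewrite mulr1.
  by rewrite mulr0.
under eq_fun do rewrite H.
apply: measurableT_comp => //; apply: emeasurable_funB.
- by apply: measurable_fun_integral_finite_kernel => //; exact: measurable_funepos.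
- by apply: measurable_fun_integral_finite_kernel => //; exact: measurable_funeneg.
Qed.
End ker_meas.

Section pairing.
Context {R : realType}.
Notation D := (`]0%R, +oo[%classic : set R).

Lemma mD : measurable D. Proof. exact: measurable_itv. Qed.

Variable om : R -> R.
Hypothesis om_meas : measurable_fun D om.
Hypothesis om_ge1 : forall v, 0 < v -> 1 <= om v.

Implicit Types (mu nu : {measure set (measurableTypeR R) -> \bar R}).

Definition J mu (f : R -> R) : R := \int[mu]_(v in D) f v.

Definition moment2_le mu (M : R) := (\int[mu]_(v in D) (om v ^+ 2)%:E <= M%:E)%E.

Lemma Dgt0 (v : R) : D v -> 0 < v. Proof. by rewrite /= in_itv/= andbT. Qed.
Lemma gt0D (v : R) : 0 < v -> D v. Proof. by rewrite /= in_itv/= andbT. Qed.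

Lemma om_ge0 v : 0 < v -> 0 <= om v.
Proof. by move=> /om_ge1; exact: le_trans. Qed.

Lemma om2_ge1 v : 0 < v -> 1 <= om v ^+ 2.
Proof. by move=> v0; rewrite expr_ge1// ?om_ge0// om_ge1. Qed.

Lemma om_le_om2 v : 0 < v -> om v <= om v ^+ 2.
Proof. by move=> v0; rewrite expr2 ler_peMr ?om_ge0// om_ge1. Qed.

Lemma moment2_ge0 mu M : moment2_le mu M -> 0 <= M.
Proof.
by rewrite -lee_fin; apply: le_trans; apply: integral_ge0 => v _; rewrite lee_fin sqr_ge0.
Qed.

Lemma integrable_om2 mu M : moment2_le mu M -> mu.-integrable D (EFin \o (fun v => om v ^+ 2)).
Proof.
move=> b; apply/integrableP; split.
  by apply/measurable_EFinP; apply: measurable_funX.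
under eq_integral do rewrite /= ger0_norm ?sqr_ge0//.
by rewrite (le_lt_trans b)// ltry.
Qed.

Lemma J_integrable mu M (f : R -> R) C : moment2_le mu M -> measurable_fun D f ->
  (forall v, 0 < v -> `|f v| <= C * om v ^+ 2) -> mu.-integrable D (EFin \o f).
Proof.
move=> b mf fC.
apply: (@le_integrable _ _ _ mu D mD _ (EFin \o (fun v => C * om v ^+ 2))).
- exact/measurable_EFinP.
- move=> v Dv /=; rewrite lee_fin.
  by rewrite (le_trans (fC _ (Dgt0 Dv)))// ler_norm.
- apply: (@eq_integrable _ _ _ mu D mD (fun v => C%:E * (EFin \o (fun v => (om v ^+ 2)%R)) v)%E).
    by move=> v _ /=; rewrite EFinM.
  exact: (@integrableZl _ _ _ mu D mD C _ (integrable_om2 b)).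
Qed.

Lemma J_om2_le mu M : moment2_le mu M -> J mu (fun v => om v ^+ 2) <= M.
Proof.
move=> b; rewrite -lee_fin /J /Rintegral fineK//.
by apply: integrable_fin_num => //; exact: integrable_om2 b.
Qed.

Lemma J_le mu M (f g : R -> R) C C' : moment2_le mu M -> measurable_fun D f -> measurable_fun D g ->
  (forall v, 0 < v -> `|f v| <= C * om v ^+ 2) ->
  (forall v, 0 < v -> `|g v| <= C' * om v ^+ 2) ->
  (forall v, 0 < v -> f v <= g v) -> J mu f <= J mu g.
Proof.
move=> b mf mg fC gC fg; apply: le_Rintegral => //.
- exact: (J_integrable b mf fC).
- exact: (J_integrable b mg gC).
- by move=> v /Dgt0; exact: fg.
Qed.

Lemma JZ mu M (f : R -> R) C a : moment2_le mu M -> measurable_fun D f ->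
  (forall v, 0 < v -> `|f v| <= C * om v ^+ 2) -> J mu (fun v => a * f v) = a * J mu f.
Proof.
by move=> b mf fC; rewrite /J RintegralZl//; exact: (J_integrable b mf fC).
Qed.

Lemma JD mu M (f g : R -> R) C C' : moment2_le mu M -> measurable_fun D f -> measurable_fun D g ->
  (forall v, 0 < v -> `|f v| <= C * om v ^+ 2) ->
  (forall v, 0 < v -> `|g v| <= C' * om v ^+ 2) ->
  J mu (fun v => f v + g v) = J mu f + J mu g.
Proof.
move=> b mf mg fC gC; rewrite /J RintegralD//.
- exact: (J_integrable b mf fC).
- exact: (J_integrable b mg gC).
Qed.

Lemma JB mu M (f g : R -> R) C C' : moment2_le mu M -> measurable_fun D f -> measurable_fun D g ->
  (forall v, 0 < v -> `|f v| <= C * om v ^+ 2) ->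
  (forall v, 0 < v -> `|g v| <= C' * om v ^+ 2) ->
  J mu (fun v => f v - g v) = J mu f - J mu g.
Proof.
move=> b mf mg fC gC; rewrite /J RintegralB//.
- exact: (J_integrable b mf fC).
- exact: (J_integrable b mg gC).
Qed.

Lemma eq_J mu (f g : R -> R) : (forall v, 0 < v -> f v = g v) -> J mu f = J mu g.
Proof. by move=> fg; apply: eq_Rintegral => v /set_mem/Dgt0; exact: fg. Qed.

Lemma J_norm_le mu M (f : R -> R) C : moment2_le mu M -> measurable_fun D f ->
  (forall v, 0 < v -> `|f v| <= C * om v ^+ 2) -> `|J mu f| <= C * J mu (fun v => om v ^+ 2).
Proof.
move=> b mf fC.
have mo : measurable_fun D (fun v => om v ^+ 2) by exact: measurable_funX.
rewrite (le_trans (@le_normr_Rintegral _ _ _ mu D f mD (J_integrable b mf fC)))//.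
rewrite -(@JZ mu M _ 1)//; last by move=> v v0; rewrite mul1r ger0_norm ?sqr_ge0.
apply: (@J_le mu M _ _ C `|C|) => //.
- exact: measurableT_comp.
- exact: measurable_funM.
- by move=> v v0; rewrite normr_id; exact: fC.
- by move=> v v0; rewrite normrM ler_wpM2l// ger0_norm ?sqr_ge0.
Qed.

Lemma J_norm_bnd mu M (f : R -> R) C : moment2_le mu M -> 0 <= C -> measurable_fun D f ->
  (forall v, 0 < v -> `|f v| <= C * om v ^+ 2) -> `|J mu f| <= C * M.
Proof.
by move=> b C0 mf fC; rewrite (le_trans (J_norm_le b mf fC))// ler_wpM2l// J_om2_le.
Qed.

Lemma J_norm_J mu M (f : R -> R) C : moment2_le mu M -> measurable_fun D f ->
  (forall v, 0 < v -> `|f v| <= C * om v ^+ 2) -> `|J mu f| <= J mu (fun v => `|f v|).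
Proof. by move=> b mf fC; exact: (@le_normr_Rintegral _ _ _ mu D f mD (J_integrable b mf fC)). Qed.

Implicit Types (m n : R.-fker (measurableTypeR R) ~> (measurableTypeR R)).
Implicit Type k : R * R -> R.

Lemma measurable_inner n (s : R) k : measurable_fun setT k ->
  measurable_fun setT (fun v2 => J (n s) (fun v1 => k (v1, v2))).
Proof.
move=> mk.
have mc : measurable_fun setT (fun _ : measurableTypeR R => s : measurableTypeR R) by exact: measurable_cst.
apply: (@measurable_fun_Rintegral_kernel _ _ _ (measurableTypeR R) _ (kernel_precomp n mc) D (fun p => k (p.2, p.1))) => //.
by apply: (measurableT_comp mk); exact: measurable_swap.
Qed.

Lemma measurable_inner_time m (k : R * R -> R) : measurable_fun setT k ->
  measurable_fun setT (fun s => J (m s) (fun v => k (s, v))).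
Proof.
by move=> mk; apply: (measurable_fun_Rintegral_kernel m).
Qed.

Lemma measurable_double_time m n (k : R * R -> R) : measurable_fun setT k ->
  measurable_fun setT (fun s => J (m s) (fun v2 => J (n s) (fun v1 => k (v1, v2)))).
Proof.
move=> mk.
have mf : measurable_fun setT (fst : measurableTypeR R * measurableTypeR R -> measurableTypeR R) by exact: measurable_fst.
have H : measurable_fun setT (fun p : R * R => J (n p.1) (fun v1 => k (v1, p.2))).
  apply: (@measurable_fun_Rintegral_kernel _ _ _ (measurableTypeR R) _ (kernel_precomp n mf) D (fun p => k (p.2, p.1.2))) => //.
  apply: (measurableT_comp mk); apply/measurable_fun_pairP; split.
    exact: measurable_snd.
  exact: (measurableT_comp measurable_snd measurable_fst).
exact: (measurable_inner_time m H).
Qed.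

Lemma inner_bnd n s M C k : moment2_le (n s) M -> 0 <= C -> measurable_fun setT k ->
  (forall v1 v2, 0 < v1 -> 0 < v2 -> `|k (v1, v2)| <= C * om v1 ^+ 2 * om v2 ^+ 2) ->
  forall v2, 0 < v2 -> `|J (n s) (fun v1 => k (v1, v2))| <= C * M * om v2 ^+ 2.
Proof.
move=> b C0 mk kC v2 v20; rewrite mulrAC.
apply: J_norm_bnd => //; first by rewrite mulr_ge0 ?sqr_ge0.
  by apply: measurable_funTS; apply: (measurableT_comp mk).
by move=> v v0; rewrite mulrAC; exact: kC.
Qed.

Lemma double_bnd m n s M M' C k : moment2_le (m s) M -> moment2_le (n s) M' -> 0 <= C -> measurable_fun setT k ->
  (forall v1 v2, 0 < v1 -> 0 < v2 -> `|k (v1, v2)| <= C * om v1 ^+ 2 * om v2 ^+ 2) ->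
  `|J (m s) (fun v2 => J (n s) (fun v1 => k (v1, v2)))| <= C * M' * M.
Proof.
move=> b b' C0 mk kC; apply: J_norm_bnd => //.
- by rewrite mulr_ge0// (moment2_ge0 b').
- by apply: measurable_funTS; exact: measurable_inner.
- exact: inner_bnd.
Qed.

(** The domination by [om v1 ^+ 2 * om v2 ^+ 2], integrable for the product of the
    two measures, is what makes the order of integration irrelevant. *)
Lemma J_Fubini m n s M M' C k : moment2_le (m s) M -> moment2_le (n s) M' -> measurable_fun setT k ->
  (forall v1 v2, 0 < v1 -> 0 < v2 -> `|k (v1, v2)| <= C * om v1 ^+ 2 * om v2 ^+ 2) ->
  J (m s) (fun v2 => J (n s) (fun v1 => k (v1, v2))) =
  J (n s) (fun v1 => J (m s) (fun v2 => k (v1, v2))).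
Proof.
move=> b b' mk kC.
have mo : measurable_fun D (fun v => om v ^+ 2) by exact: measurable_funX.
have fin_m : fin_num_fun (m s) by exact: finite_kernel_measure.
have fin_n : fin_num_fun (n s) by exact: finite_kernel_measure.
pose F (p : R * R) := k p * \1_D p.1 * \1_D p.2.
have mF : measurable_fun setT F.
  apply: measurable_funM; first apply: measurable_funM => //.
    by apply: (@measurableT_comp _ _ _ _ _ _ (\1_D : R -> R)) => //; exact: measurable_indic.
  by apply: (@measurableT_comp _ _ _ _ _ _ (\1_D : R -> R)) => //; exact: measurable_indic.
have ind1 (x : R) : 0 < x -> \1_D x = 1 :> R by move=> /gt0D x0; rewrite indicE mem_set.
have ind0 (x : R) : ~ D x -> \1_D x = 0 :> R by move=> x0; rewrite indicE memNset.
have E1 : J (m s) (fun v2 => J (n s) (fun v1 => k (v1, v2))) =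
    fine (\int[finite_measure_of fin_m]_y \int[finite_measure_of fin_n]_x (F (x, y))%:E)%E.
  rewrite /J [LHS]Rintegral_mkcond /Rintegral /finite_measure_of; congr fine.
  apply: eq_integral => y _; rewrite patchE; case: ifPn => [/set_mem/Dgt0 y0|/negP y0].
    have -> : (\int[n s]_x (F (x, y))%:E = \int[n s]_(x in D) (k (x, y))%:E)%E.
      rewrite [RHS]integral_mkcond; apply: eq_integral => x _; rewrite patchE /F/= (ind1 y)// mulr1.
      case: ifPn => [/set_mem/Dgt0 x0|/negP x0]; first by rewrite ind1// mulr1.
      by rewrite ind0 ?mulr0// => /mem_set.
    rewrite fineK//; apply: integrable_fin_num => //.
    apply: (@J_integrable (n s) M' (fun x => k (x, y)) (C * om y ^+ 2)) => //.
      apply: (measurable_funS measurableT) => //.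
      exact: (measurableT_comp mk).
    by move=> v v0; rewrite mulrAC; exact: kC.
  by rewrite integral0_eq// => x _; rewrite /F (ind0 y) ?mulr0// => /mem_set.
have E2 : J (n s) (fun v1 => J (m s) (fun v2 => k (v1, v2))) =
    fine (\int[finite_measure_of fin_n]_x \int[finite_measure_of fin_m]_y (F (x, y))%:E)%E.
  rewrite /J [LHS]Rintegral_mkcond /Rintegral /finite_measure_of; congr fine.
  apply: eq_integral => x _; rewrite patchE; case: ifPn => [/set_mem/Dgt0 x0|/negP x0].
    have -> : (\int[m s]_y (F (x, y))%:E = \int[m s]_(y in D) (k (x, y))%:E)%E.
      rewrite [RHS]integral_mkcond; apply: eq_integral => y _; rewrite patchE /F/= (ind1 x)// mulr1.
      case: ifPn => [/set_mem/Dgt0 y0|/negP y0]; first by rewrite ind1// mulr1.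
      by rewrite ind0 ?mulr0// => /mem_set.
    rewrite fineK//; apply: integrable_fin_num => //.
    apply: (@J_integrable (m s) M (fun y => k (x, y)) (C * om x ^+ 2)) => //.
      apply: (measurable_funS measurableT) => //.
      exact: (measurableT_comp mk).
    by move=> v v0; exact: kC.
  by rewrite integral0_eq// => y _; rewrite /F (ind0 x) ?mulr0 ?mul0r// => /mem_set.
rewrite E1 E2; congr fine; apply/esym.
apply: (@Fubini _ _ _ _ _ (finite_measure_of fin_n) (finite_measure_of fin_m) (EFin \o F)).
apply/integrable12ltyP; first exact/measurable_EFinP.
have C0 : 0 <= C.
  have := kC 1 1 ltr01 ltr01; have := om2_ge1 ltr01 => o1 h.
  have : 0 <= C * om 1 ^+ 2 * om 1 ^+ 2 by exact: le_trans h.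
  by rewrite !pmulr_lge0// (lt_le_trans _ o1).
rewrite /finite_measure_of.
apply: (@le_lt_trans _ _ (C * M * M')%:E); last exact: ltry.
apply: (@le_trans _ _ (\int[n s]_(x in D) (C * M * om x ^+ 2)%:E)%E); last first.
  under eq_integral do rewrite EFinM.
  rewrite ge0_integralZl//=.
  - rewrite [leRHS]EFinM lee_wpmul2l// lee_fin mulr_ge0// (moment2_ge0 b)//.
  - exact/measurable_EFinP.
  - by move=> x _; rewrite lee_fin sqr_ge0.
  - by rewrite lee_fin mulr_ge0// (moment2_ge0 b).
rewrite [leRHS]integral_mkcond; apply: ge0_le_integral => //.
- by move=> x _; apply: integral_ge0 => y _; exact: abse_ge0.
- apply: (@measurable_fun_fubini_tonelli_F _ _ _ _ _ (finite_measure_of fin_m) (fun p => `|(F p)%:E|%E)) => //.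
  by apply: measurableT_comp => //; exact/measurable_EFinP.
- apply/(measurable_restrictT _ mD); apply/measurable_EFinP; exact: measurable_funM.
- move=> x _; rewrite patchE; case: ifPn => [/set_mem/Dgt0 x0|/negP x0]; last first.
    by rewrite integral0_eq// => y _; rewrite /F/= (ind0 x) ?mulr0 ?mul0r ?normr0// => /mem_set.
  apply: (@le_trans _ _ (\int[m s]_(y in D) (C * om x ^+ 2 * om y ^+ 2)%:E)%E).
    rewrite [leRHS]integral_mkcond; apply: ge0_le_integral => //.
    + apply: measurableT_comp => //; apply/measurable_EFinP.
      exact: (measurableT_comp mF).
    + apply/(measurable_restrictT _ mD); apply/measurable_EFinP; exact: measurable_funM.
    + move=> y _; rewrite patchE /F/= (ind1 x)// mulr1; case: ifPn => [/set_mem/Dgt0 y0|/negP y0].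
        by rewrite ind1// mulr1 lee_fin; exact: kC.
      by rewrite (ind0 y) ?mulr0 ?normr0// => /mem_set.
  under eq_integral do rewrite EFinM.
  rewrite ge0_integralZl//=.
  - by rewrite mulrAC [leRHS]EFinM lee_wpmul2l// lee_fin mulr_ge0// sqr_ge0.
  - exact/measurable_EFinP.
  - by move=> y _; rewrite lee_fin sqr_ge0.
  - by rewrite lee_fin mulr_ge0// sqr_ge0.
Qed.

End pairing.

(** * Measurability of the integrands *)

Section lip_meas.
Context {R : realType}.
Notation D := (`]0%R, +oo[%classic : set R).

Lemma lip_continuous (C : R) (f : R -> R) :
  (forall u v, 0 < u -> 0 < v -> `|f u - f v| <= C * `|u - v|) ->
  {in D, continuous f}.
Proof.
move=> H v /set_mem/Dgt0 v0; apply/cvgrPdist_le => e e0.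
have C0 : 0 < `|C| + 1 by rewrite ltr_wpDl.
near=> u.
have u0 : 0 < u by near: u; exact: lt_nbhsr.
rewrite (le_trans (H _ _ v0 u0))//.
have : `|v - u| <= e / (`|C| + 1).
  by near: u; apply: (@cvgr_dist_le _ _ _ _ _ id) => //; rewrite divr_gt0.
rewrite ler_pdivlMr// => h; rewrite (le_trans _ h)// mulrC ler_wpM2l//.
by rewrite (le_trans (ler_norm _))// lerDl.
Unshelve. all: by end_near. Qed.

Lemma lip_measurable (C : R) (f : R -> R) :
  (forall u v, 0 < u -> 0 < v -> `|f u - f v| <= C * `|u - v|) ->
  measurable_fun D f.
Proof.
move=> H; apply: open_continuous_measurable_fun; first exact: interval_open.
exact: lip_continuous H.
Qed.

Lemma C11_measurable L (f df : R -> R) : C11 L f df -> measurable_fun D f.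
Proof. by move=> H; apply: (@lip_measurable (2 * L)) => u v; exact: C11_lip H. Qed.

Lemma C11_measurable_d L (f df : R -> R) : C11 L f df -> measurable_fun D df.
Proof. by move=> H; apply: (@lip_measurable (2 * L)) => u v; exact: C11_dlip H. Qed.

Definition tilde (chi : R -> R) (v1 v2 : R) := chi (v1 + v2) - chi v1 - chi v2.

Definition quadrant : set (R * R) := [set p | 0 < p.1 /\ 0 < p.2].

Lemma measurable_quadrant : measurable quadrant.
Proof.
rewrite (_ : quadrant = D `*` D); first exact: measurableX.
by apply/seteqP; split => p /=; rewrite !in_itv/= !andbT.
Qed.

Lemma tildeK_measurable (chi : R -> R) (K : R * R -> R) :
  measurable_fun D chi -> measurable_fun setT K ->
  measurable_fun setT ((fun p => tilde chi p.1 p.2 * K p) \_ quadrant).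
Proof.
move=> mc mK; apply/(measurable_restrictT _ measurable_quadrant).
have mc' (f : R * R -> R) : measurable_fun setT f -> (forall p, quadrant p -> 0 < f p) ->
    measurable_fun quadrant (fun p => chi (f p)).
  move=> mf f0; apply: (measurable_comp mD _ mc).
    by move=> _ [p /f0 p0 <-]; exact: gt0D.
  exact: (measurable_funS measurableT).
apply: measurable_funM; last exact: (measurable_funS measurableT).
apply: measurable_funB; first apply: measurable_funB.
- apply: (mc' (fun p => p.1 + p.2)); last by move=> p [? ?]; exact: addr_gt0.
  exact: measurable_funD.
- by apply: (mc' fst) => // p [].
- by apply: (mc' snd) => // p [].
Qed.

Lemma quadrantE (F : R * R -> R) v1 v2 : 0 < v1 -> 0 < v2 -> (F \_ quadrant) (v1, v2) = F (v1, v2).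
Proof. by move=> h1 h2; rewrite patchE mem_set. Qed.

End lip_meas.

(** * Integrals over time intervals *)

Section time.
Context {R : realType}.
Notation leb := (leb R).

(** Consistency of one time step: an integrand that stays within [Y + e] of a
    frozen value [X] has the integral [(t - s) X] up to the integrated error. *)
Lemma Rint_near (s t X Y : R) (f e : R -> R) : s <= t ->
  leb.-integrable `]s, t] (EFin \o f) -> leb.-integrable `]s, t] (EFin \o e) ->
  (forall tau, s < tau <= t -> `|f tau - X| <= Y + e tau) ->
  `|\int[leb]_(tau in `]s, t]) f tau - (t - s) * X|
     <= (t - s) * Y + \int[leb]_(tau in `]s, t]) e tau.
Proof.
move=> st fi ei H.
have mI : measurable (`]s, t] : set R) by exact: measurable_itv.
have lenI : fine (leb `]s, t]) = t - s.
  by rewrite lebesgue_measure_itv/= lte_fin; have [//|ts] := ltP s t;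
     rewrite (@le_anti _ _ s t) ?st// subrr.
have leby : (leb `]s, t] < +oo)%E.
  by rewrite lebesgue_measure_itv/=; case: ifP => _; rewrite ?ltry// -EFinB ltry.
have ci c : leb.-integrable `]s, t] (EFin \o (fun _ => c)).
  apply: measurable_bounded_integrable => //; exists `|c|; split => // x cx y _ /=.
  exact: ltW.
have -> : (t - s) * X = \int[leb]_(tau in `]s, t]) X by rewrite Rintegral_cst// lenI mulrC.
have -> : (t - s) * Y = \int[leb]_(tau in `]s, t]) Y by rewrite Rintegral_cst// lenI mulrC.
rewrite -RintegralB// -RintegralD//.
have fX : leb.-integrable `]s, t] (EFin \o (fun tau => f tau - X)).
  exact: (@integrableB _ _ _ leb _ mI _ _ fi (ci X)).
have Ye : leb.-integrable `]s, t] (EFin \o (fun tau => Y + e tau)).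
  exact: (@integrableD _ _ _ leb _ mI _ _ (ci Y) ei).
rewrite (le_trans (le_normr_Rintegral _ fX))//; apply: le_Rintegral => //.
exact: integrable_norm.
Qed.

Lemma Rint_split (s t : R) (f : R -> R) : 0 <= s -> s <= t ->
  leb.-integrable `[0, t] (EFin \o f) ->
  \int[leb]_(tau in `[0, t]) f tau =
  \int[leb]_(tau in `[0, s]) f tau + \int[leb]_(tau in `]s, t]) f tau.
Proof.
move=> s0 st fi.
have U : `[0, t]%classic = (`[0, s] `|` `]s, t])%classic :> set R.
  by rewrite (@itv_bndbnd_setU _ _ _ (BRight s))// bnd_simp.
rewrite U Rintegral_setU//; first by rewrite -U.
apply/disj_setPS => x [] /=; rewrite !in_itv/= => /andP[_ xs] /andP[sx _].
by move: (lt_le_trans sx xs); rewrite ltxx.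
Qed.

Lemma bounded_integrable (a b : R) (C : R) (f : R -> R) : measurable_fun setT f ->
  (forall s, a <= s <= b -> `|f s| <= C) -> leb.-integrable `[a, b] (EFin \o f).
Proof.
move=> mf fC; apply: measurable_bounded_integrable => //.
- by rewrite /= lebesgue_measure_itv/=; case: ifP => _; rewrite ?ltry// -EFinB ltry.
- exact: (measurable_funS measurableT).
- exists C; split => [|x Cx y /=]; first exact: num_real.
  by rewrite in_itv/= => /fC/le_trans; apply; exact: ltW.
Qed.

End time.

(** * The dual Euler scheme *)

Section core.
Context {R : realType}.
Notation D := (`]0%R, +oo[%classic : set R).
Notation leb := (leb R).

Variable om : R -> R.
Hypothesis om_meas : measurable_fun D om.
Hypothesis om_ge1 : forall v, 0 < v -> 1 <= om v.
Hypothesis om_id : forall v, 0 < v -> v <= om v.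
Hypothesis om_add : forall v x, 0 < v -> 0 <= x -> om (v + x) <= om v + x.

Variables (T k A B M : R).
Hypotheses (T0 : 0 < T) (k0 : 0 < k) (A0 : 0 < A) (B0 : 0 < B).

Variable K : R * R -> R.
Hypothesis K_meas : measurable_fun setT K.
Hypothesis K_ge0 : forall v1 v2, 0 < v1 -> 0 < v2 -> 0 <= K (v1, v2).
Hypothesis K_sym : forall v1 v2, 0 < v1 -> 0 < v2 -> K (v1, v2) = K (v2, v1).
Hypothesis K_le : forall v1 v2, 0 < v1 -> 0 < v2 -> K (v1, v2) <= 2 * k * (om v1 * om v2).

Variables g dg : R -> R -> R.
Hypothesis g_meas : measurable_fun setT (fun p : R * R => g p.1 p.2).
Hypothesis g_ge0 : forall t v, 0 <= t <= T -> 0 < v -> 0 <= g t v.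
Hypothesis g_le : forall t v, 0 <= t <= T -> 0 < v -> g t v <= A * v.
Hypothesis dg_le : forall t v, 0 <= t <= T -> 0 < v -> `|dg t v| <= A.
Hypothesis g_lip : forall t u v, 0 <= t <= T -> 0 < u -> 0 < v ->
  `|g t u - g t v| <= A * `|u - v|.
Hypothesis g_taylor : forall t u v, 0 <= t <= T -> 0 < u -> 0 < v ->
  `|g t u - g t v - dg t v * (u - v)| <= B * (u - v) ^+ 2.
Hypothesis g_unif : forall b rho : R, 0 < rho -> exists2 eta : R, 0 < eta &
  forall s t v, 0 <= s <= T -> 0 <= t <= T -> 0 < v <= b -> `|s - t| <= eta ->
    `|g s v - g t v| <= rho.

Implicit Types m : R.-fker (measurableTypeR R) ~> (measurableTypeR R).
Implicit Types chi dchi : R -> R.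
Implicit Types L s t v : R.

Definition coag_term m (chi : R -> R) (s : R) :=
  J (m s) (fun v2 => J (m s) (fun v1 => tilde chi v1 v2 * K (v1, v2))).

Definition transport_term m (dchi : R -> R) (s : R) := J (m s) (fun v => dchi v * g s v).

(** The weak formulation for a family of measures, tested against C^{1,1}
    functions. The initial datum is only present through the functional [I0]. *)
Definition kernel_solution m (I0 : (R -> R) -> R) := forall t chi dchi L, 0 <= t <= T -> C11 L chi dchi ->
  J (m t) chi = I0 chi + \int[leb]_(s in `[0, t]) transport_term m dchi s
     + 2^-1 * \int[leb]_(s in `[0, t]) coag_term m chi s.

Let mo2 : measurable_fun D (fun v => om v ^+ 2). Proof. exact: measurable_funX. Qed.

Lemma tilde_le chi L v1 v2 : (forall v, 0 < v -> `|chi v| <= L) -> 0 < v1 -> 0 < v2 ->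
  `|tilde chi v1 v2| <= 3 * L.
Proof.
move=> H v10 v20; have := H _ v10; have := H _ v20; have := H _ (addr_gt0 v10 v20).
rewrite /tilde !ler_norml => /andP[? ?] /andP[? ?] /andP[? ?]; apply/andP; split; lra.
Qed.

Lemma tildeK_le chi L v1 v2 : (forall v, 0 < v -> `|chi v| <= L) -> 0 < v1 -> 0 < v2 ->
  `|tilde chi v1 v2 * K (v1, v2)| <= 6 * k * L * om v1 ^+ 2 * om v2 ^+ 2.
Proof.
move=> H v10 v20; rewrite normrM (ger0_norm (K_ge0 _ _))//.
have L0 : 0 <= L by apply: le_trans (H 1 ltr01).
have o1 := om_ge0 om_ge1 v10; have o2 := om_ge0 om_ge1 v20.
rewrite (_ : 6 * _ * _ * _ * _ = 3 * L * (2 * k * (om v1 ^+ 2 * om v2 ^+ 2))); last by ring.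
apply: ler_pM => //; [exact: K_ge0|exact: tilde_le|].
rewrite (le_trans (K_le v10 v20))// ler_wpM2l//; first by rewrite mulr_ge0// ltW.
by apply: ler_pM => //; exact: om_le_om2.
Qed.

Lemma eq_J2 (mu nu : {measure set (measurableTypeR R) -> \bar R}) (f h : R -> R -> R) :
  (forall v1 v2, 0 < v1 -> 0 < v2 -> f v1 v2 = h v1 v2) ->
  J mu (fun v2 => J nu (fun v1 => f v1 v2)) = J mu (fun v2 => J nu (fun v1 => h v1 v2)).
Proof. by move=> fh; apply: eq_J => v2 v20; apply: eq_J => v1 v10; exact: fh. Qed.

Section one_solution.
Variable m : R.-fker (measurableTypeR R) ~> (measurableTypeR R).
Hypothesis bm : forall s, moment2_le om (m s) M.

Let M0 : 0 <= M. Proof. exact: (moment2_ge0 (bm 0)). Qed.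

Lemma coag_term_measurable chi : measurable_fun D chi -> measurable_fun setT (coag_term m chi).
Proof.
move=> mc.
have H := measurable_double_time m m (tildeK_measurable mc K_meas).
apply: eq_measurable_fun H => s _ /=; apply: eq_J2 => v1 v2 v10 v20.
by rewrite quadrantE.
Qed.

Lemma transport_term_measurable dchi : measurable_fun D dchi -> measurable_fun setT (transport_term m dchi).
Proof.
move=> mc.
have mk : measurable_fun setT (fun p : R * R => (dchi \_ D) p.2 * g p.1 p.2).
  apply: measurable_funM => //; apply: measurableT_comp; last exact: measurable_snd.
  exact/(measurable_restrictT _ mD).
apply: eq_measurable_fun (measurable_inner_time m mk) => s _ /=; apply: eq_J => v v0.
by rewrite patchE mem_set//; exact: gt0D.
Qed.

Lemma g_le_om2 t v : 0 <= t <= T -> 0 < v -> g t v <= A * om v ^+ 2.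
Proof.
move=> tT v0; rewrite (le_trans (g_le tT v0))// ler_wpM2l//; first exact: ltW.
by rewrite (le_trans (om_id v0))//; exact: om_le_om2.
Qed.

Lemma transport_term_le dchi L s : 0 <= s <= T -> measurable_fun D dchi ->
  (forall v, 0 < v -> `|dchi v| <= L) -> `|transport_term m dchi s| <= L * A * M.
Proof.
move=> sT mc H; have L0 : 0 <= L by apply: le_trans (H 1 ltr01).
apply: (J_norm_bnd om_meas (bm s)).
- by rewrite mulr_ge0// ltW.
- apply: measurable_funM => //; apply: (measurable_funS measurableT) => //.
  rewrite (_ : g s = (fun p : R * R => g p.1 p.2) \o (fun v => (s, v)))//.
  by apply: (measurableT_comp g_meas); exact: pair1_measurable.
- move=> v v0; rewrite normrM (ger0_norm (g_ge0 sT v0)) -mulrA.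
  by apply: ler_pM => //; [exact: g_ge0|exact: H|exact: g_le_om2].
Qed.

Lemma coag_term_le chi L s : measurable_fun D chi ->
  (forall v, 0 < v -> `|chi v| <= L) -> `|coag_term m chi s| <= 6 * k * L * M * M.
Proof.
move=> mc H; have L0 : 0 <= L by apply: le_trans (H 1 ltr01).
rewrite /coag_term (@eq_J2 _ _ _ (fun v1 v2 => ((fun p => tilde chi p.1 p.2 * K p) \_ quadrant) (v1, v2))).
  apply: (@double_bnd _ _ om_meas m m s M M (6 * k * L) ((fun p => tilde chi p.1 p.2 * K p) \_ quadrant)) => //; first by rewrite !mulr_ge0// ltW.
    exact: tildeK_measurable.
  by move=> v1 v2 v10 v20; rewrite quadrantE//; exact: tildeK_le.
by move=> v1 v2 v10 v20; rewrite quadrantE.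
Qed.

Definition rate_term (chi dchi : R -> R) s := transport_term m dchi s + 2^-1 * coag_term m chi s.

Lemma rate_term_measurable L chi dchi : C11 L chi dchi -> measurable_fun setT (rate_term chi dchi).
Proof.
move=> H; apply: measurable_funD.
  by apply: transport_term_measurable; exact: C11_measurable_d H.
by apply: measurable_funM => //; apply: coag_term_measurable; exact: C11_measurable H.
Qed.

Lemma rate_term_integrable L chi dchi t : C11 L chi dchi -> t <= T ->
  leb.-integrable `[0, t] (EFin \o rate_term chi dchi).
Proof.
move=> H tT; apply: (@bounded_integrable _ _ _ (L * A * M + 2^-1 * (6 * k * L * M * M))).
  exact: rate_term_measurable H.
move=> s /andP[s0 st]; rewrite (le_trans (ler_normD _ _))// lerD//.
  apply: transport_term_le; first by rewrite s0 (le_trans st).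
    exact: C11_measurable_d H.
  by move=> v v0; have [] := H v v v0 v0.
rewrite normrM gtr0_norm// ler_wpM2l//; apply: coag_term_le; first exact: C11_measurable H.
by move=> v v0; have [] := H v v v0 v0.
Qed.

Variable I0 : (R -> R) -> R.
Hypothesis sm : kernel_solution m I0.

Lemma kernel_solution_rterm t chi dchi L : 0 <= t <= T -> C11 L chi dchi ->
  J (m t) chi = I0 chi + \int[leb]_(s in `[0, t]) rate_term chi dchi s.
Proof.
move=> /andP[t0 tT] H; rewrite (sm _ H) ?t0// -addrA; congr (_ + _).
have pi : leb.-integrable `[0, t] (EFin \o transport_term m dchi).
  apply: (@bounded_integrable _ _ _ (L * A * M)).
    by apply: transport_term_measurable; exact: C11_measurable_d H.
  move=> s /andP[s0 st]; apply: transport_term_le; first by rewrite s0 (le_trans st).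
    exact: C11_measurable_d H.
  by move=> v v0; have [] := H v v v0 v0.
have qi : leb.-integrable `[0, t] (EFin \o coag_term m chi).
  apply: (@bounded_integrable _ _ _ (6 * k * L * M * M)).
    by apply: coag_term_measurable; exact: C11_measurable H.
  move=> s _; apply: coag_term_le; first exact: C11_measurable H.
  by move=> v v0; have [] := H v v v0 v0.
rewrite -RintegralZl//.
rewrite -RintegralD//.
exact: (@integrableZl _ _ _ leb _ (measurable_itv _) 2^-1 _ qi).
Qed.

Lemma kernel_solution_incr s t chi dchi L : 0 <= s -> s <= t -> t <= T -> C11 L chi dchi ->
  J (m t) chi - J (m s) chi = \int[leb]_(tau in `]s, t]) rate_term chi dchi tau.
Proof.
move=> s0 st tT H.
rewrite (kernel_solution_rterm _ H) ?tT ?(le_trans s0)// (kernel_solution_rterm _ H) ?s0 ?(le_trans st)//.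
by rewrite (Rint_split s0 st (rate_term_integrable H tT)); ring.
Qed.

Lemma integrable_sub (s t : R) f : 0 <= s ->
  leb.-integrable `[0, t] (EFin \o f) -> leb.-integrable `]s, t] (EFin \o f).
Proof.
move=> s0; apply: integrableS => //.
by apply: subset_itvr; rewrite bnd_simp.
Qed.

(** Pairings with C^{1,1} functions are Lipschitz in time, with a constant that
    involves only the sup norms of the function and of its derivative. *)
Lemma kernel_solution_lip s t chi dchi C L : 0 <= s -> s <= t -> t <= T -> C11 C chi dchi ->
  (forall v, 0 < v -> `|chi v| <= L) -> (forall v, 0 < v -> `|dchi v| <= L) ->
  `|J (m t) chi - J (m s) chi| <= (A * M + 3 * k * M ^+ 2) * L * (t - s).
Proof.
move=> s0 st tT H cL dL; rewrite (kernel_solution_incr s0 st tT H).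
have ri := integrable_sub s0 (rate_term_integrable H tT).
have zi : leb.-integrable `]s, t] (EFin \o (fun=> 0)) by exact: integrable0.
have := @Rint_near _ s t 0 ((A * M + 3 * k * M ^+ 2) * L) _ _ st ri zi.
rewrite mulr0 subr0 Rintegral_cst//.
rewrite mul0r !addr0 (mulrC (t - s)); apply => tau /andP[stau taut]; rewrite subr0.
have tauT : 0 <= tau <= T by rewrite (le_trans s0 (ltW stau)) (le_trans taut).
rewrite (le_trans (ler_normD _ _))//.
have := transport_term_le tauT (C11_measurable_d H) dL.
have := coag_term_le tau (C11_measurable H) cL.
rewrite normrM gtr0_norm// => hq hp.
by rewrite (_ : _ * L = L * A * M + 2^-1 * (6 * k * L * M * M)); [rewrite lerD// ler_wpM2l|field].
Qed.

Lemma kernel_solution_lip_abs s t chi dchi C L : 0 <= s <= T -> 0 <= t <= T -> C11 C chi dchi ->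
  (forall v, 0 < v -> `|chi v| <= L) -> (forall v, 0 < v -> `|dchi v| <= L) ->
  `|J (m t) chi - J (m s) chi| <= (A * M + 3 * k * M ^+ 2) * L * `|t - s|.
Proof.
move=> /andP[s0 sT] /andP[t0 tT] H cL dL; have [st|/ltW ts] := leP s t.
  by rewrite (@ger0_norm _ (t - s)) ?subr_ge0//; exact: kernel_solution_lip H cL dL.
rewrite distrC (distrC t s) (@ger0_norm _ (s - t)) ?subr_ge0//.
exact: kernel_solution_lip H cL dL.
Qed.

End one_solution.

Implicit Types f h : R -> R.
Implicit Types C : R.

(** This growth makes a function integrable against every measure with a finite
    second [om]-moment, so that [J] is linear and monotone on such functions. *)
Definition adm (f : R -> R) := measurable_fun D f /\
  exists C, forall v, 0 < v -> `|f v| <= C * om v ^+ 2.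

Lemma admD (f h : R -> R) : adm f -> adm h -> adm (fun v => f v + h v).
Proof.
move=> [mf [C fC]] [mh [C' hC]]; split; first exact: measurable_funD.
exists (C + C') => v v0; rewrite (le_trans (ler_normD _ _))// mulrDl lerD//; [exact: fC|exact: hC].
Qed.

Lemma admZ a (f : R -> R) : adm f -> adm (fun v => a * f v).
Proof.
move=> [mf [C fC]]; split; first exact: measurable_funM.
by exists (`|a| * C) => v v0; rewrite normrM -mulrA ler_wpM2l// fC.
Qed.

Lemma admB (f h : R -> R) : adm f -> adm h -> adm (fun v => f v - h v).
Proof.
move=> [mf [C fC]] [mh [C' hC]]; split; first exact: measurable_funB.
exists (C + C') => v v0; rewrite (le_trans (ler_normB _ _))// mulrDl lerD//; [exact: fC|exact: hC].
Qed.

Lemma adm_bounded L (f : R -> R) : measurable_fun D f -> (forall v, 0 < v -> `|f v| <= L) -> adm f.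
Proof.
move=> mf H; split => //; exists `|L| => v v0; rewrite (le_trans (H v v0))//.
by rewrite (le_trans (ler_norm _))// ler_peMr// (om2_ge1 om_ge1)//.
Qed.

Lemma adm_C11 L chi dchi : C11 L chi dchi -> adm chi.
Proof.
move=> H; apply: (@adm_bounded L); first exact: C11_measurable H.
by move=> v v0; have [] := H v v v0 v0.
Qed.

Lemma adm_mulg L (t : R) (f : R -> R) : 0 <= t <= T -> measurable_fun D f ->
  (forall v, 0 < v -> `|f v| <= L) -> adm (fun v => f v * g t v).
Proof.
move=> tT mf H; split.
  apply: measurable_funM => //; apply: (measurable_funS measurableT) => //.
  exact: (measurable_fun_pair2 _ g_meas).
exists (L * A) => v v0; rewrite normrM (ger0_norm (g_ge0 tT v0)) -mulrA.
by apply: ler_pM => //; [exact: g_ge0|exact: H|exact: g_le_om2].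
Qed.

Section J_adm.
Variable mu : {measure set (measurableTypeR R) -> \bar R}.
Hypothesis bmu : moment2_le om mu M.

Lemma J_addf f h : adm f -> adm h -> J mu (fun v => f v + h v) = J mu f + J mu h.
Proof. by move=> [mf [C fC]] [mh [C' hC]]; exact: (JD om_meas bmu mf mh fC hC). Qed.

Lemma J_subf f h : adm f -> adm h -> J mu (fun v => f v - h v) = J mu f - J mu h.
Proof. by move=> [mf [C fC]] [mh [C' hC]]; exact: (JB om_meas bmu mf mh fC hC). Qed.

Lemma J_scalef a f : adm f -> J mu (fun v => a * f v) = a * J mu f.
Proof. by move=> [mf [C fC]]; exact: (JZ om_meas a bmu mf fC). Qed.

Lemma J_lef f h : adm f -> adm h -> (forall v, 0 < v -> f v <= h v) -> J mu f <= J mu h.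
Proof. by move=> [mf [C fC]] [mh [C' hC]]; exact: (J_le om_meas bmu mf mh fC hC). Qed.

Lemma J_normf C f : measurable_fun D f -> (forall v, 0 < v -> `|f v| <= C * om v ^+ 2) ->
  `|J mu f| <= C * M.
Proof.
move=> mf fC; apply: (J_norm_bnd om_meas bmu) => //.
have := fC 1 ltr01; move/(le_trans (normr_ge0 _)); rewrite pmulr_lge0//.
by rewrite (lt_le_trans ltr01)// (om2_ge1 om_ge1)//.
Qed.

Lemma J_norm1 C f : measurable_fun D f -> 0 <= C -> (forall v, 0 < v -> `|f v| <= C) ->
  `|J mu f| <= C * M.
Proof.
move=> mf C0 fC; apply: J_normf => // v v0; rewrite (le_trans (fC v v0))//.
by rewrite ler_peMr// (om2_ge1 om_ge1)//.
Qed.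

End J_adm.

Section two_solutions.
Variables m1 m2 : R.-fker (measurableTypeR R) ~> (measurableTypeR R).
Definition msum : R.-fker (measurableTypeR R) ~> (measurableTypeR R) := kadd m1 m2.
Hypothesis bS : forall s, moment2_le om (msum s) M.

Lemma integral_msum s (f : R -> \bar R) : measurable_fun D f -> (forall v, 0 < v -> (0 <= f v)%E) ->
  (\int[msum s]_(v in D) f v = \int[m1 s]_(v in D) f v + \int[m2 s]_(v in D) f v)%E.
Proof. by move=> mf f0; apply: ge0_integral_measure_add => // v /Dgt0; exact: f0. Qed.

Lemma msum_moment2 s : moment2_le om (m1 s) M /\ moment2_le om (m2 s) M.
Proof.
have := bS s; rewrite /moment2_le integral_msum//; last first.
- by move=> v v0; rewrite lee_fin sqr_ge0.
- exact/measurable_EFinP.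
move=> H; split; apply: le_trans H.
  by rewrite leeDl// integral_ge0// => v _; rewrite lee_fin sqr_ge0.
by rewrite leeDr// integral_ge0// => v _; rewrite lee_fin sqr_ge0.
Qed.

Lemma m1_moment2 s : moment2_le om (m1 s) M. Proof. by case: (msum_moment2 s). Qed.
Lemma m2_moment2 s : moment2_le om (m2 s) M. Proof. by case: (msum_moment2 s). Qed.

Let M0 : 0 <= M. Proof. exact: (moment2_ge0 (bS 0)). Qed.

(** Clear for non-negative functions, a case to which [f] is reduced by adding a
    multiple of [om ^+ 2]. *)
Lemma J_msum s f : adm f -> J (msum s) f = J (m1 s) f + J (m2 s) f.
Proof.
move=> af.
have pos h : adm h -> (forall v, 0 < v -> 0 <= h v) -> J (msum s) h = J (m1 s) h + J (m2 s) h.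
  move=> [mh [C hC]] h0; rewrite /J /Rintegral integral_msum//.
  - rewrite fineD//; apply: integrable_fin_num => //.
      exact: (J_integrable om_meas (m1_moment2 s) mh hC).
    exact: (J_integrable om_meas (m2_moment2 s) mh hC).
  - exact/measurable_EFinP.
move: (af) => [mf [C fC]].
have aom : adm (fun v => C * om v ^+ 2).
  split; first exact: measurable_funM.
  by exists `|C| => v v0; rewrite normrM (ger0_norm (sqr_ge0 _)).
have E : forall mu : {measure set (measurableTypeR R) -> \bar R}, moment2_le om mu M ->
    J mu f = J mu (fun v => f v + C * om v ^+ 2) - J mu (fun v => C * om v ^+ 2).
  by move=> mu bmu; rewrite (J_addf bmu)// addrK.
rewrite (E (msum s))// (E (m1 s)) ?(E (m2 s)); [|exact: m2_moment2|exact: m1_moment2].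
rewrite (pos (fun v => f v + _)); last 2 first.
- exact: admD.
- by move=> v v0; have := fC v v0; rewrite ler_norml => /andP[+ _]; lra.
rewrite (pos (fun v => C * _)) //; first by ring.
by move=> v v0; rewrite (le_trans _ (fC v v0)).
Qed.

Definition diffJ t chi := J (m1 t) chi - J (m2 t) chi.

Lemma diffJ_addf t f h : adm f -> adm h -> diffJ t (fun v => f v + h v) = diffJ t f + diffJ t h.
Proof. by move=> af ah; rewrite /diffJ (J_addf (m1_moment2 t))// (J_addf (m2_moment2 t))//; ring. Qed.

Lemma diffJ_subf t f h : adm f -> adm h -> diffJ t (fun v => f v - h v) = diffJ t f - diffJ t h.
Proof. by move=> af ah; rewrite /diffJ (J_subf (m1_moment2 t))// (J_subf (m2_moment2 t))//; ring. Qed.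

Lemma diffJ_scalef t a f : adm f -> diffJ t (fun v => a * f v) = a * diffJ t f.
Proof. by move=> af; rewrite /diffJ (J_scalef (m1_moment2 t))// (J_scalef (m2_moment2 t))//; ring. Qed.

Lemma eq_diffJ t (f h : R -> R) : (forall v, 0 < v -> f v = h v) -> diffJ t f = diffJ t h.
Proof. by move=> fh; rewrite /diffJ (eq_J _ fh) (eq_J (m2 t) fh). Qed.

Lemma diffJ_le_msum t f : adm f -> `|diffJ t f| <= J (msum t) (fun v => `|f v|).
Proof.
move=> af; move: (af) => [mf [C fC]].
have an : adm (fun v => `|f v|).
  split; first exact: measurableT_comp.
  by exists C => v v0; rewrite normr_id; exact: fC.
rewrite (J_msum _ an) (le_trans (ler_normB _ _))// lerD//.
  exact: (J_norm_J om_meas (m1_moment2 t) mf fC).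
exact: (J_norm_J om_meas (m2_moment2 t) mf fC).
Qed.

Lemma diffJ_norm t C f : measurable_fun D f -> (forall v, 0 < v -> `|f v| <= C * om v ^+ 2) ->
  `|diffJ t f| <= C * M.
Proof.
move=> mf fC; have af : adm f by split => //; exists C.
rewrite (le_trans (diffJ_le_msum t af))//.
rewrite (le_trans (ler_norm _))// (J_normf (bS t))//; first exact: measurableT_comp.
by move=> v v0; rewrite normr_id; exact: fC.
Qed.

Lemma diffJ_norm1 t C f : measurable_fun D f -> 0 <= C -> (forall v, 0 < v -> `|f v| <= C) ->
  `|diffJ t f| <= C * M.
Proof.
move=> mf C0 fC; apply: diffJ_norm => // v v0; rewrite (le_trans (fC v v0))//.
by rewrite ler_peMr// (om2_ge1 om_ge1)//.
Qed.

(** Polarisation: by symmetry of the integrand, the difference of the squares of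
    two measures is their difference times their sum. This turns the difference
    of the two coagulation terms into a pairing that is linear in [m1 - m2]. *)
Lemma coag_term_diff chi L s : measurable_fun D chi -> (forall v, 0 < v -> `|chi v| <= L) ->
  coag_term m1 chi s - coag_term m2 chi s =
  diffJ s (fun v2 => J (msum s) (fun v1 => tilde chi v1 v2 * K (v1, v2))).
Proof.
move=> mc H; have L0 : 0 <= L by apply: le_trans (H 1 ltr01).
pose F := (fun p => tilde chi p.1 p.2 * K p) \_ quadrant.
have mF : measurable_fun setT F by exact: tildeK_measurable.
have FE v1 v2 : 0 < v1 -> 0 < v2 -> F (v1, v2) = tilde chi v1 v2 * K (v1, v2).
  by move=> *; rewrite /F quadrantE.
have Fsym v1 v2 : 0 < v1 -> 0 < v2 -> F (v1, v2) = F (v2, v1).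
  by move=> *; rewrite !FE// K_sym// /tilde (addrC v1); ring.
have FC v1 v2 : 0 < v1 -> 0 < v2 -> `|F (v1, v2)| <= 6 * k * L * om v1 ^+ 2 * om v2 ^+ 2.
  by move=> *; rewrite FE//; exact: tildeK_le.
have C0 : 0 <= 6 * k * L by rewrite mulr_ge0// mulr_ge0// ltW.
have q m : coag_term m chi s = J (m s) (fun v2 => J (m s) (fun v1 => F (v1, v2))).
  by apply: eq_J2 => *; rewrite FE.
have aF v2 : 0 < v2 -> adm (fun v1 => F (v1, v2)).
  move=> v20; split.
    by apply: measurable_funTS; exact: (measurable_fun_pair1 _ mF).
  by exists (6 * k * L * om v2 ^+ 2) => v v0; rewrite mulrAC; exact: FC.
have ai m : (forall s, moment2_le om (m s) M) -> adm (fun v2 => J (m s) (fun v1 => F (v1, v2))).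
  move=> bm; split.
    by apply: measurable_funTS; exact: measurable_inner.
  exists (6 * k * L * M) => v2 v20.
  exact: (@inner_bnd _ _ om_meas m s M (6 * k * L) F (bm s)).
rewrite [RHS](@eq_diffJ _ _ (fun v2 => J (m1 s) (fun v1 => F (v1, v2)) + J (m2 s) (fun v1 => F (v1, v2)))); last first.
  move=> v2 v20; rewrite -(J_msum _ (aF v2 v20)); apply: eq_J => v1 v10; by rewrite FE.
rewrite diffJ_addf; [|exact: ai m1_moment2|exact: ai m2_moment2].
rewrite /diffJ !q (@J_Fubini _ _ om_meas om_ge1 m1 m2 s M M _ F (m1_moment2 s) (m2_moment2 s) mF FC).
rewrite (@eq_J2 (m2 s) (m1 s) (fun v1 v2 => F (v2, v1)) (fun v1 v2 => F (v1, v2))); first by ring.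
by move=> *; exact: Fsym.
Qed.

Variables I1 I2 : (R -> R) -> R.
Hypothesis s1 : kernel_solution m1 I1.
Hypothesis s2 : kernel_solution m2 I2.

Definition time_lip := A * M + 3 * k * M ^+ 2.

Lemma time_lip_ge0 : 0 <= time_lip.
Proof. by rewrite addr_ge0// ?mulr_ge0 ?sqr_ge0// ltW. Qed.

Lemma diffJ_lip s t chi dchi C L : 0 <= s <= T -> 0 <= t <= T -> C11 C chi dchi ->
  (forall v, 0 < v -> `|chi v| <= L) -> (forall v, 0 < v -> `|dchi v| <= L) ->
  `|diffJ t chi - diffJ s chi| <= 2 * time_lip * L * `|t - s|.
Proof.
move=> sT tT H cL dL.
have h1 := kernel_solution_lip_abs m1_moment2 s1 sT tT H cL dL.
have h2 := kernel_solution_lip_abs m2_moment2 s2 sT tT H cL dL.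
rewrite (_ : diffJ t chi - diffJ s chi = (J (m1 t) chi - J (m1 s) chi) - (J (m2 t) chi - J (m2 s) chi)); last first.
  by rewrite /diffJ; ring.
rewrite (le_trans (ler_normB _ _))// -!mulrA mulrDl mul1r !mulrA.
exact: lerD.
Qed.

Lemma msum_lip s t chi dchi C L : 0 <= s <= T -> 0 <= t <= T -> C11 C chi dchi ->
  (forall v, 0 < v -> `|chi v| <= L) -> (forall v, 0 < v -> `|dchi v| <= L) ->
  `|J (msum t) chi - J (msum s) chi| <= 2 * time_lip * L * `|t - s|.
Proof.
move=> sT tT H cL dL.
have h1 := kernel_solution_lip_abs m1_moment2 s1 sT tT H cL dL.
have h2 := kernel_solution_lip_abs m2_moment2 s2 sT tT H cL dL.
rewrite !J_msum; try exact: adm_C11 H.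
rewrite (_ : _ - _ = (J (m1 t) chi - J (m1 s) chi) + (J (m2 t) chi - J (m2 s) chi)); last by ring.
rewrite (le_trans (ler_normD _ _))// -!mulrA mulrDl mul1r !mulrA.
exact: lerD.
Qed.

Section smooth_kernel.
Variables (Kt : R * R -> R) (dK2 : R -> R -> R) (kap b : R).
Hypothesis b0 : 0 < b.
Hypothesis Kt_meas : measurable_fun setT Kt.
Hypothesis Kt_ge0 : forall v1 v2, 0 < v1 -> 0 < v2 -> 0 <= Kt (v1, v2).
Hypothesis Kt_le : forall v1 v2, 0 < v1 -> 0 < v2 -> Kt (v1, v2) <= 2 * k * (om v1 * om v2).
Hypothesis Kt_C11r : forall v1, 0 < v1 -> C11 kap (fun v2 => Kt (v1, v2)) (dK2 v1).
Hypothesis dK2_meas : forall v2, 0 < v2 -> measurable_fun D (fun v1 => dK2 v1 v2).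
Hypothesis Kt_C11l : forall v2, 0 < v2 -> exists dK1, C11 kap (fun v1 => Kt (v1, v2)) dK1.
Hypothesis Kt_supp : forall v1 v2, 0 < v1 -> 0 < v2 -> b <= v2 -> Kt (v1, v2) = 0 /\ dK2 v1 v2 = 0.

Lemma kap_ge0 : 0 <= kap. Proof. exact: C11_ge0 (Kt_C11r ltr01). Qed.

Lemma C11_ext L (f f' df df' : R -> R) : (forall v, 0 < v -> f v = f' v) ->
  (forall v, 0 < v -> df v = df' v) -> C11 L f df -> C11 L f' df'.
Proof.
move=> ff' dff' H u v u0 v0; have [h1 h2 h3] := H u v u0 v0.
by rewrite -!ff'// -!dff'.
Qed.

Lemma tilde_C11 L psi dpsi a : 0 < a -> C11 L psi dpsi ->
  C11 (3 * L) (tilde psi a) (fun v => dpsi (a + v) - dpsi v).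
Proof.
move=> a0 H; have [ha _ _] := H a a a0 a0.
have := C11B (C11B (C11_shift (ltW a0) H) (C11_cst ha)) H.
rewrite (_ : L + L + L = 3 * L); last by ring.
by apply: C11_ext => v v0; rewrite /= ?subr0.
Qed.

Lemma tildeC psi v1 v2 : tilde psi v1 v2 = tilde psi v2 v1.
Proof. by rewrite /tilde (addrC v1); ring. Qed.

(** The inequalities that define [C11] are linear, hence stable under averaging
    over a parameter; integrating them costs the mass bound [M]. *)
Lemma C11_average mu (F dF : R -> R -> R) C : moment2_le om mu M ->
  (forall v1, 0 < v1 -> C11 C (F v1) (dF v1)) ->
  (forall v2, 0 < v2 -> measurable_fun D (F ^~ v2)) ->
  (forall v2, 0 < v2 -> measurable_fun D (dF ^~ v2)) ->
  C11 (C * M) (fun v2 => J mu (F ^~ v2)) (fun v2 => J mu (dF ^~ v2)).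
Proof.
move=> bmu H mF mdF u v u0 v0.
have C0 : 0 <= C by exact: C11_ge0 (H 1 ltr01).
have aF w : 0 < w -> adm (F ^~ w).
  by move=> w0; apply: (@adm_bounded C); [exact: mF|move=> x x0; have [] := H x x0 w w w0 w0].
have adF w : 0 < w -> adm (dF ^~ w).
  by move=> w0; apply: (@adm_bounded C); [exact: mdF|move=> x x0; have [] := H x x0 w w w0 w0].
split.
- by apply: (J_norm1 bmu) => //; [exact: mF|move=> x x0; have [] := H x x0 v v v0 v0].
- by apply: (J_norm1 bmu) => //; [exact: mdF|move=> x x0; have [] := H x x0 v v v0 v0].
- rewrite (_ : _ - _ = J mu (fun x => F x u - F x v - (u - v) * dF x v)); last first.
    rewrite (J_subf bmu); [|by apply: admB; exact: aF|by apply: admZ; exact: adF].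
    rewrite (J_subf bmu); [|exact: aF..].
    by rewrite (J_scalef bmu _ (adF _ v0)) mulrC.
  rewrite mulrAC; apply: (J_norm1 bmu).
  + apply: measurable_funB; first by apply: measurable_funB; exact: mF.
    by apply: measurable_funM => //; exact: mdF.
  + by rewrite mulr_ge0// sqr_ge0.
  + by move=> x x0; have [_ _] := H x x0 u v u0 v0; rewrite (mulrC (u - v)).
Qed.

(** The adjoint of the linearised coagulation operator, acting on [psi], with the
    kernel [Kt]. *)
Definition dual_coag psi t v2 := 2^-1 * J (msum t) (fun v1 => tilde psi v1 v2 * Kt (v1, v2)).
Definition d_dual_coag psi dpsi t v2 := 2^-1 * J (msum t) (fun v1 =>
  (dpsi (v1 + v2) - dpsi v2) * Kt (v1, v2) + tilde psi v1 v2 * dK2 v1 v2).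

Lemma tilde_measurable1 L psi dpsi v2 : 0 < v2 -> C11 L psi dpsi ->
  measurable_fun D (fun v1 => tilde psi v1 v2).
Proof.
move=> v20 H; apply: eq_measurable_fun (C11_measurable (tilde_C11 v20 H)) => v1 _.
exact: tildeC.
Qed.

Lemma Kt_measurable1 v2 : 0 < v2 -> measurable_fun D (fun v1 => Kt (v1, v2)).
Proof. by move=> /Kt_C11l[dK1]; exact: C11_measurable. Qed.

Lemma dual_coag_C11 L psi dpsi t : C11 L psi dpsi ->
  C11 (9 * M * kap * L) (dual_coag psi t) (d_dual_coag psi dpsi t).
Proof.
move=> H.
have := C11Z 2^-1 (@C11_average _ (fun v1 v2 => tilde psi v1 v2 * Kt (v1, v2))
  (fun v1 v2 => (dpsi (v1 + v2) - dpsi v2) * Kt (v1, v2) + tilde psi v1 v2 * dK2 v1 v2)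
  (6 * (3 * L * kap)) (bS t) _ _ _).
rewrite (_ : _ * (_ * M) = 9 * M * kap * L); last by rewrite gtr0_norm//; field.
apply.
- by move=> v1 v10; apply: C11M; [exact: tilde_C11|exact: Kt_C11r].
- by move=> v2 v20; apply: measurable_funM; [exact: tilde_measurable1 H|exact: Kt_measurable1].
- move=> v2 v20; apply: measurable_funD; apply: measurable_funM.
  + apply: measurable_funB => //.
    apply: (@lip_measurable _ (2 * L)) => x y x0 y0.
    rewrite (le_trans (C11_dlip H (addr_gt0 x0 v20) (addr_gt0 y0 v20)))//.
    by rewrite opprD addrACA subrr addr0.
  + exact: Kt_measurable1.
  + exact: tilde_measurable1 H.
  + exact: dK2_meas.
Qed.

(** The invariant class of the backward scheme: [P] measures [psi] in the dual norm
    and grows at a rate independent of [Kt]; [L], which depends on [Kt], need only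
    stay bounded for a fixed [Kt]. *)
Definition dual_class P L psi dpsi := [/\ C11 L psi dpsi,
  (forall v, 0 < v -> `|psi v| <= P * om v) &
  forall v, 0 < v -> b <= v -> psi v = 0 /\ dpsi v = 0].

Lemma dual_coag_supp psi dpsi t v : (forall v, 0 < v -> b <= v -> psi v = 0 /\ dpsi v = 0) ->
  0 < v -> b <= v -> dual_coag psi t v = 0 /\ d_dual_coag psi dpsi t v = 0.
Proof.
move=> H v0 bv; rewrite /dual_coag /d_dual_coag.
have J0 f : (forall v, 0 < v -> f v = 0) -> J (msum t) f = 0.
  by move=> f0; rewrite (@eq_J _ _ f (fun=> 0))// /J /Rintegral integral0.
by rewrite !J0 ?mulr0// => v1 v10; have [kt0 dk0] := Kt_supp v10 v0 bv;
  rewrite kt0 ?dk0 !mulr0 ?addr0.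
Qed.

(** The term [psi v2] of [tilde psi] damps: the step replaces [psi v] by
    [(1 - h a) psi v] plus an increment, with [a] the total coagulation rate of
    [v]. The increment contains [h a P om v], which the damping compensates
    exactly, so the unbounded rate [a] disappears from the bound. Nonnegativity of
    [1 - h a] is where the time step must be small with respect to [Kt]. *)
Lemma coag_step P L psi dpsi t (h : R) : 0 <= P -> 0 <= h -> h * (kap * M) <= 1 ->
  dual_class P L psi dpsi ->
  dual_class (P * (1 + 2 * k * M * h)) (L * (1 + 9 * M * kap * h))
    (fun v => psi v + h * dual_coag psi t v) (fun v => dpsi v + h * d_dual_coag psi dpsi t v).
Proof.
move=> P0 h0 hk [H HP Hs]; split.
- rewrite (_ : L * _ = L + `|h| * (9 * M * kap * L)); last by rewrite ger0_norm//; ring.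
  by apply: C11D => //; apply: C11Z; exact: dual_coag_C11.
- move=> v v0.
  have L0 := C11_ge0 H; have ov0 := om_ge0 om_ge1 v0.
  have mK := Kt_measurable1 v0.
  have [dK1 HK1] := Kt_C11l v0.
  have aK : adm (fun v1 => Kt (v1, v)) by exact: adm_C11 HK1.
  (* the total coagulation rate of v, which drives the damping *)
  pose a := 2^-1 * J (msum t) (fun v1 => Kt (v1, v)).
  have a0 : 0 <= a.
    by rewrite mulr_ge0//; apply: Rintegral_ge0 => x /Dgt0 x0; exact: Kt_ge0.
  have ale : a <= kap * M.
    have : `|J (msum t) (fun v1 => Kt (v1, v))| <= kap * M.
      by apply: (J_norm1 (bS t) mK kap_ge0) => x x0; have [] := HK1 x x x0 x0.
    move/(le_trans (ler_norm _)); rewrite /a.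
    have : 0 <= kap * M by rewrite mulr_ge0// kap_ge0.
    by lra.
  have ha1 : h * a <= 1 by rewrite (le_trans _ hk)// ler_wpM2l.
  pose G v1 := (psi (v1 + v) - psi v1) * Kt (v1, v).
  have mpsi := C11_measurable H.
  have mG : measurable_fun D G.
    apply: measurable_funM => //; apply: measurable_funB => //.
    apply: eq_measurable_fun (C11_measurable (C11_shift (ltW v0) H)) => u _.
    by rewrite addrC.
  have bE : dual_coag psi t v = 2^-1 * J (msum t) G - psi v * a.
    rewrite /dual_coag /a mulrCA -mulrBr; congr (_ * _).
    rewrite -(J_scalef (bS t) _ aK) -(J_subf (bS t)).
    + by apply: eq_J => v1 v10; rewrite /G /tilde; ring.
    + apply: (@adm_bounded (2 * L * kap)) => // x x0; rewrite normrM.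
      apply: ler_pM => //; last by have [] := HK1 x x x0 x0.
      rewrite (le_trans (ler_normB _ _))// mulrDl mul1r lerD//.
        by have [] := H _ (x + v) (addr_gt0 x0 v0) (addr_gt0 x0 v0).
      by have [] := H _ x x0 x0.
    + exact: admZ.
  have Gle : `|2^-1 * J (msum t) G| <= P * om v * a + 2 * k * M * P * om v.
    rewrite normrM gtr0_norm//.
    have aoK : adm (fun v1 => om v1 * Kt (v1, v)).
      split; first exact: measurable_funM.
      exists (2 * k * om v) => x x0; have ox := om_ge0 om_ge1 x0.
      rewrite ger0_norm; last by rewrite mulr_ge0// Kt_ge0.
      rewrite (_ : 2 * k * om v * _ = om x * (2 * k * (om x * om v))); last by ring.
      by rewrite ler_wpM2l// Kt_le.
    have JoK : J (msum t) (fun v1 => om v1 * Kt (v1, v)) <= 2 * k * om v * M.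
      rewrite (le_trans (ler_norm _))// (J_normf (bS t))//; first by case: aoK.
      move=> x x0; have ox := om_ge0 om_ge1 x0.
      rewrite ger0_norm; last by rewrite mulr_ge0// Kt_ge0.
      rewrite (_ : 2 * k * om v * _ = om x * (2 * k * (om x * om v))); last by ring.
      by rewrite ler_wpM2l// Kt_le.
    have aG : adm (fun v1 => P * om v * Kt (v1, v) + 2 * P * (om v1 * Kt (v1, v))).
      by apply: admD; exact: admZ.
    have Gpt x : 0 < x -> `|G x| <= P * om v * Kt (x, v) + 2 * P * (om x * Kt (x, v)).
      move=> x0; rewrite /G normrM (ger0_norm (Kt_ge0 x0 v0)).
      rewrite [leRHS](_ : _ = (P * om v + 2 * P * om x) * Kt (x, v)); last by ring.
      rewrite ler_wpM2r ?Kt_ge0// (le_trans (ler_normB _ _))//.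
      have h1 := HP _ (addr_gt0 x0 v0); have h2 := HP _ x0.
      have h3 : P * om (x + v) <= P * (om v + om x).
        rewrite ler_wpM2l// addrC (le_trans (om_add v0 (ltW x0)))// lerD2l.
        exact: om_id.
      by move: h1 h2 h3; lra.
    have JG : `|J (msum t) G| <= P * om v * J (msum t) (fun v1 => Kt (v1, v)) +
        2 * P * J (msum t) (fun v1 => om v1 * Kt (v1, v)).
      rewrite -(J_scalef (bS t) _ aK) -(J_scalef (bS t) _ aoK) -(J_addf (bS t)); [|exact: admZ..].
      have [maG [C aGC]] := aG.
      have GC x : 0 < x -> `|G x| <= C * om x ^+ 2.
        by move=> x0; rewrite (le_trans (Gpt x x0))// (le_trans (ler_norm _))// aGC.
      rewrite (le_trans (J_norm_J om_meas (bS t) mG GC))//.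
      apply: (J_lef (bS t)) => //; split; first exact: measurableT_comp.
      by exists C => x x0; rewrite normr_id; exact: GC.
    have PJ : P * J (msum t) (fun v1 => om v1 * Kt (v1, v)) <= P * (2 * k * om v * M).
      by rewrite ler_wpM2l.
    by rewrite /a; move: JG PJ; lra.
  rewrite bE (_ : psi v + _ = (1 - h * a) * psi v + h * (2^-1 * J (msum t) G)); last by ring.
  rewrite (le_trans (ler_normD _ _))//.
  rewrite normrM ger0_norm ?subr_ge0// normrM (ger0_norm h0).
  have h1 : (1 - h * a) * `|psi v| <= (1 - h * a) * (P * om v).
    by rewrite ler_wpM2l ?subr_ge0// HP.
  have h2 := ler_wpM2l h0 Gle.
  by move: h1 h2; lra.
- move=> v v0 bv; have [-> ->] := Hs v v0 bv.
  by have [-> ->] := dual_coag_supp t Hs v0 bv; rewrite mulr0 addr0.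
Qed.

Definition euler_flow t (h : R) v := v + h * g t v.

Lemma euler_flow_gt0 t (h : R) v : 0 <= t <= T -> 0 <= h -> 0 < v -> 0 < euler_flow t h v.
Proof. by move=> tT h0 v0; rewrite ltr_wpDr// mulr_ge0// g_ge0. Qed.

Lemma flow_step P L psi dpsi t (h : R) : 0 <= t <= T -> 0 <= P -> 0 <= h <= 1 ->
  dual_class P L psi dpsi ->
  dual_class (P * (1 + A * h)) (L * (1 + (2 * A + A ^+ 2 + B) * h))
    (fun v => psi (euler_flow t h v)) (fun v => dpsi (euler_flow t h v) * (1 + h * dg t v)).
Proof.
move=> tT P0 h01 [H HP Hs]; have /andP[h0 h1] := h01; split.
- apply: C11_flow => //; [exact: ltW..|] => u v u0 v0; split.
  + exact: g_ge0.
  + exact: dg_le.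
  + exact: g_lip.
  + exact: g_taylor.
- move=> v v0; have p0 := euler_flow_gt0 tT h0 v0.
  rewrite (le_trans (HP _ p0))// -mulrA ler_wpM2l//.
  have hg0 : 0 <= h * g t v by rewrite mulr_ge0// g_ge0.
  rewrite (le_trans (om_add v0 hg0))// mulrDl mul1r lerD2l.
  rewrite (mulrC A) -mulrA ler_wpM2l// (le_trans (g_le tT v0))// ler_wpM2l ?om_id//.
  exact: ltW.
- move=> v v0 bv; have pb : b <= euler_flow t h v by rewrite (le_trans bv)// lerDl mulr_ge0// g_ge0.
  by have [-> ->] := Hs _ (euler_flow_gt0 tT h0 v0) pb; rewrite mul0r.
Qed.

(** The error of replacing [K] by [Kt]; the weight is the one that bounds
    [tilde psi] for [psi] in [dual_class]. *)
Definition kernel_gap : R * R -> R := (fun p => `|K p - Kt p| * (om p.1 * om p.2)) \_ quadrant.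

Lemma kernel_gap_meas : measurable_fun setT kernel_gap.
Proof.
apply/(measurable_restrictT _ measurable_quadrant); apply: measurable_funM.
  by apply: measurableT_comp => //; apply: measurable_funB; exact: (measurable_funS measurableT).
have mo (f : R * R -> R) : measurable_fun setT f -> (forall p, quadrant p -> 0 < f p) ->
    measurable_fun quadrant (fun p => om (f p)).
  move=> mf f0; apply: (measurable_comp mD _ om_meas).
    by move=> _ [p /f0 p0 <-]; exact: gt0D.
  exact: (measurable_funS measurableT).
by apply: measurable_funM; [apply: (mo fst) => // p []|apply: (mo snd) => // p []].
Qed.

Lemma kernel_gap_le v1 v2 : 0 < v1 -> 0 < v2 -> `|kernel_gap (v1, v2)| <= 2 * k * om v1 ^+ 2 * om v2 ^+ 2.
Proof.
move=> v10 v20; rewrite /kernel_gap quadrantE//=.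
have o1 := om_ge0 om_ge1 v10; have o2 := om_ge0 om_ge1 v20.
have oo : 0 <= om v1 * om v2 by rewrite mulr_ge0.
rewrite normrM normr_id (ger0_norm oo).
rewrite (_ : 2 * k * _ * _ = 2 * k * (om v1 * om v2) * (om v1 * om v2)); last by ring.
rewrite ler_wpM2r// ler_norml.
have := K_ge0 v10 v20; have := K_le v10 v20; have := Kt_ge0 v10 v20; have := Kt_le v10 v20.
by move=> *; apply/andP; split; lra.
Qed.

Definition gap_term s := J (msum s) (fun v2 => J (msum s) (fun v1 => kernel_gap (v1, v2))).

Lemma gap_term_meas : measurable_fun setT gap_term.
Proof. exact: measurable_double_time kernel_gap_meas. Qed.

Lemma gap_term_integrable s t : 0 <= s -> leb.-integrable `]s, t] (EFin \o gap_term).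
Proof.
move=> s0; apply: integrable_sub => //.
apply: (@bounded_integrable _ _ _ (2 * k * M * M)); first exact: gap_term_meas.
move=> x _; apply: (double_bnd om_meas (bS x) (bS x) _ kernel_gap_meas kernel_gap_le).
by rewrite mulr_ge0// ltW.
Qed.

(** Collects the constants of the consistency error of one Euler step, relative to
    [L (h + rho)] and to the length [h] of the step; it depends on [Kt] through
    [kap] and [b]. *)
Definition step_const := M + M * A ^+ 2 + 2 * time_lip * (2 * A * b + A) + 36 * M * time_lip * kap
  + 18 * M ^+ 2 * kap * A.

Lemma dual_coag_time_lip L psi dpsi s t v2 : C11 L psi dpsi -> 0 <= s <= T -> 0 <= t <= T -> 0 < v2 ->
  `|dual_coag psi t v2 - dual_coag psi s v2| <= 18 * time_lip * kap * L * `|t - s|.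
Proof.
move=> H sT tT v20; have [dK1 HK1] := Kt_C11l v20.
have tv : C11 (3 * L) (fun v1 => tilde psi v1 v2) (fun v => dpsi (v2 + v) - dpsi v).
  by apply: C11_ext (tilde_C11 v20 H) => // v _; exact: tildeC.
have HF := C11M tv HK1.
have := msum_lip sT tT HF (fun v => C11_bnd HF) (fun v => C11_dbnd HF).
rewrite /dual_coag -mulrBr normrM gtr0_norm// => HL.
rewrite (_ : 18 * _ * _ * _ * _ = 2^-1 * (2 * time_lip * (6 * (3 * L * kap)) * `|t - s|)); last by field.
by rewrite ler_wpM2l.
Qed.

(** One backward step of the dual equation: coagulation first, then transport along
    the frozen characteristic. *)
Definition euler_test psi t (h : R) := fun v => psi (euler_flow t h v) + h * dual_coag psi t (euler_flow t h v).
Definition d_euler_test psi dpsi t (h : R) := fun v =>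
  (dpsi (euler_flow t h v) + h * d_dual_coag psi dpsi t (euler_flow t h v)) * (1 + h * dg t v).

Lemma euler_test_class P L psi dpsi t (h : R) : 0 <= t <= T -> 0 <= P -> 0 <= h <= 1 ->
  h * (kap * M) <= 1 -> dual_class P L psi dpsi ->
  dual_class (P * (1 + 2 * k * M * h) * (1 + A * h))
      (L * (1 + 9 * M * kap * h) * (1 + (2 * A + A ^+ 2 + B) * h))
      (euler_test psi t h) (d_euler_test psi dpsi t h).
Proof.
move=> tT P0 h01 hk H; have /andP[h0 h1] := h01.
apply: (flow_step tT _ h01 (coag_step t P0 h0 hk H)).
by rewrite mulr_ge0// addr_ge0// !mulr_ge0// ltW.
Qed.

(** The scheme is consistent: the forward evolution of [diffJ] tested on [psi] agrees
    with [diffJ] tested on the backward step of [psi], up to a term of order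
    [h (h + rho)] and to the kernel error. The kernel error is multiplied by [P]
    only, never by [L], and can be made small after [h] has tended to 0. *)
Lemma one_step P L psi dpsi t (h rho : R) : 0 <= t -> 0 < h -> h <= 1 -> t + h <= T ->
  0 <= P -> h * (kap * M) <= 1 -> dual_class P L psi dpsi ->
  (forall tau v, t <= tau <= t + h -> 0 < v <= b -> `|g tau v - g t v| <= rho) ->
  diffJ (t + h) psi <= diffJ t (euler_test psi t h) + h * (step_const * L * (h + rho))
    + 2 * P * \int[leb]_(tau in `]t, t + h]) gap_term tau.
Proof.
move=> t0 h0 h1 thT P0 hk HD grho; have [H HP Hs] := HD.
have L0 := C11_ge0 H; have CT0 := time_lip_ge0; have kap0 := kap_ge0.
have A0' := ltW A0; have b0' := ltW b0; have h0' := ltW h0; have k0' := ltW k0.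
have tT : 0 <= t <= T by rewrite t0 (le_trans _ thT)// lerDl ltW.
have h01 : 0 <= h <= 1 by rewrite ltW.
have rho0 : 0 <= rho.
  apply: (le_trans _ (grho t b _ _)); [exact: normr_ge0| |by rewrite b0 lexx].
  by rewrite lexx lerDl ltW.
have mdpsi := C11_measurable_d H.
have [HPhi _ sPhi] := flow_step tT P0 h01 HD.
pose chi v := h^-1 * (psi (euler_flow t h v) - psi v).
pose dchi v := h^-1 * (dpsi (euler_flow t h v) * (1 + h * dg t v) - dpsi v).
have Hchi := C11Z h^-1 (C11B HPhi H).
have Hb := dual_coag_C11 t H.
have Hd : dual_class (P * (1 + 2 * k * M * h)) (L * (1 + 9 * M * kap * h))
    (fun v => psi v + h * dual_coag psi t v) (fun v => dpsi v + h * d_dual_coag psi dpsi t v).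
  by apply: coag_step => //; exact: ltW.
pose bPhi v := dual_coag psi t (euler_flow t h v).
have PhiE v : 0 < v -> `|euler_flow t h v - v| = h * g t v.
  by move=> v0; rewrite /euler_flow addrC addKr ger0_norm// mulr_ge0 ?g_ge0// ltW.
have HbPhi : C11 (9 * M * kap * L * (1 + (2 * A + A ^+ 2 + B) * h)) bPhi
    (fun v => d_dual_coag psi dpsi t (euler_flow t h v) * (1 + h * dg t v)).
  apply: C11_flow => //; [exact: ltW..|] => u v u0 v0; split.
  + exact: g_ge0.
  + exact: dg_le.
  + exact: g_lip.
  + exact: g_taylor.
have apsi := adm_C11 H; have achi := adm_C11 Hchi.
have ab := adm_C11 Hb; have abPhi := adm_C11 HbPhi.
pose X := diffJ t chi + diffJ t bPhi.
have E1 : diffJ t (euler_test psi t h) = diffJ t psi + h * X.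
  rewrite /X mulrDr -(diffJ_scalef t h achi) -(diffJ_scalef t h abPhi).
  rewrite -(diffJ_addf t (admZ h achi) (admZ h abPhi)).
  rewrite -(diffJ_addf t apsi (admD (admZ h achi) (admZ h abPhi))).
  apply: eq_diffJ => v v0; rewrite /euler_test /chi /bPhi mulVKf ?gt_eqF//.
  by ring.
have ri (mi : R.-fker (measurableTypeR R) ~> (measurableTypeR R)) :
    (forall s, moment2_le om (mi s) M) ->
    leb.-integrable `]t, t + h] (EFin \o rate_term mi psi dpsi).
  by move=> bm; apply: (integrable_sub t0); exact: (rate_term_integrable bm H thT).
have E2 : diffJ (t + h) psi - diffJ t psi =
    \int[leb]_(tau in `]t, t + h]) (rate_term m1 psi dpsi tau - rate_term m2 psi dpsi tau).
  rewrite RintegralB//; [|exact: (ri m1 m1_moment2)|exact: (ri m2 m2_moment2)].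
  rewrite -(kernel_solution_incr m1_moment2 s1 t0 _ thT H) ?lerDl ?ltW//.
  by rewrite -(kernel_solution_incr m2_moment2 s2 t0 _ thT H) ?lerDl ?ltW// /diffJ; ring.
pose Y := step_const * L * (h + rho).
suff HY tau : t < tau <= t + h ->
    `|(rate_term m1 psi dpsi tau - rate_term m2 psi dpsi tau) - X| <= Y + 2 * P * gap_term tau.
  have tth : t <= t + h by rewrite lerDl ltW.
  have ei := gap_term_integrable (t + h) t0.
  have i1 : leb.-integrable `]t, t + h]
      (EFin \o (fun tau => rate_term m1 psi dpsi tau - rate_term m2 psi dpsi tau)).
    exact: (@integrableB _ _ _ leb _ (measurable_itv _) _ _ (ri m1 m1_moment2) (ri m2 m2_moment2)).
  have i2 : leb.-integrable `]t, t + h] (EFin \o (fun tau => 2 * P * gap_term tau)).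
    exact: (@integrableZl _ _ _ leb _ (measurable_itv _) (2 * P) _ ei).
  have := Rint_near tth i1 i2 HY.
  rewrite -E2 RintegralZl// (_ : t + h - t = h); last by ring.
  by move/(le_trans (ler_norm _)); rewrite E1 /Y; lra.
move=> /andP[ttau tauth].
have tauT : 0 <= tau <= T by rewrite (le_trans t0 (ltW ttau)) (le_trans tauth).
have dtau : `|tau - t| <= h by rewrite ger0_norm ?lerBlDl// subr_ge0 ltW.
have dtau' : `|t - tau| <= h by rewrite distrC.
have bE s v2 : 2^-1 * J (msum s) (fun v1 => tilde psi v1 v2 * Kt (v1, v2)) = dual_coag psi s v2 by [].
pose iK v2 := J (msum tau) (fun v1 => tilde psi v1 v2 * K (v1, v2)).
have mpsi := C11_measurable H.
have psiL v : 0 < v -> `|psi v| <= L by move=> v0; have [] := H v v v0 v0.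
have dpsiL v : 0 < v -> `|dpsi v| <= L by move=> v0; have [] := H v v v0 v0.
have aiK : adm iK.
  split.
    have mm : measurable_fun D (fun v2 => J (msum tau) (fun v1 =>
        ((fun p => tilde psi p.1 p.2 * K p) \_ quadrant) (v1, v2))).
      apply: (measurable_funS measurableT) => //.
      exact: (measurable_inner msum tau (tildeK_measurable mpsi K_meas)).
    apply: eq_measurable_fun mm => v2 /set_mem/Dgt0 v20 /=.
    by apply: eq_J => v1 v10; rewrite quadrantE.
  exists (6 * k * L * M) => v2 v20.
  have C0 : 0 <= 6 * k * L by rewrite mulr_ge0// mulr_ge0// ltW.
  have := @inner_bnd _ _ om_meas msum tau M (6 * k * L) _ (bS tau) C0 (tildeK_measurable mpsi K_meas) _ v2 v20.
  rewrite (@eq_J _ _ (fun v1 => ((fun p => tilde psi p.1 p.2 * K p) \_ quadrant) (v1, v2))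
    (fun v1 => tilde psi v1 v2 * K (v1, v2))); last by move=> v1 v10; rewrite quadrantE.
  apply=> v1 w2 v10 w20; rewrite quadrantE//; exact: tildeK_le.
have rE : rate_term m1 psi dpsi tau - rate_term m2 psi dpsi tau =
    diffJ tau (fun v => dpsi v * g tau v) + 2^-1 * diffJ tau iK.
  by rewrite -(coag_term_diff _ mpsi psiL) /rate_term /diffJ /transport_term; ring.
have adg : adm (fun v => dpsi v * g tau v) by exact: adm_mulg dpsiL.
have abtau := adm_C11 (dual_coag_C11 tau H).
have aiK2 : adm (fun v => 2^-1 * iK v) by exact: admZ.
(* The error is telescoped. For transport: the difference quotient along the flow
   against the derivative, then the change of [diffJ] between [t] and [tau]. For
   coagulation: [Kt] against [K], then the dual operator and [diffJ] at time [t] against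
   time [tau], and last the effect of composing with the flow. *)
have T1 : `|diffJ tau (fun v => dpsi v * g tau v - chi v)| <= (L * rho + L * h * A ^+ 2) * M.
  apply: diffJ_norm; first by case: (admB adg achi).
  move=> v v0; have gt0 := g_ge0 tT v0; have o1 := om2_ge1 om_ge1 v0.
  have [bv|vb] := leP b v.
    have [pv dv] := Hs v v0 bv; have [pPv _] := sPhi v v0 bv.
    rewrite /chi pPv pv dv mul0r subrr mulr0 subrr normr0 mulr_ge0 ?sqr_ge0//.
    by rewrite addr_ge0// ?mulr_ge0// ?sqr_ge0// ltW.
  rewrite (_ : _ - chi v = dpsi v * (g tau v - g t v) -
     h^-1 * (psi (euler_flow t h v) - psi v - dpsi v * (euler_flow t h v - v))); last first.
    by rewrite /chi /euler_flow; field; rewrite gt_eqF.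
  rewrite (le_trans (ler_normB _ _))// mulrDl lerD//.
    rewrite normrM -[leLHS]mulr1 ler_pM ?mulr_ge0//.
    apply: ler_pM => //; first exact: dpsiL.
    by apply: grho; [rewrite (ltW ttau)|rewrite v0 ltW].
  rewrite normrM gtr0_norm ?invr_gt0// ler_pdivrMl//.
  have [_ _] := H _ _ (euler_flow_gt0 tT (ltW h0) v0) v0 => /le_trans; apply.
  rewrite -[in leLHS](@real_normK _ (euler_flow t h v - v)) ?num_real// PhiE//.
  rewrite (_ : h * (L * h * A ^+ 2 * om v ^+ 2) = L * (h * (A * om v)) ^+ 2); last by ring.
  have gA : h * g t v <= h * (A * om v).
    by rewrite ler_wpM2l// (le_trans (g_le tT v0))// ler_wpM2l// om_id.
  have hg0 : 0 <= h * g t v by rewrite mulr_ge0.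
  by rewrite ler_wpM2l// lerXn2r// nnegrE (le_trans hg0).
have T2 : `|diffJ tau chi - diffJ t chi| <= 2 * time_lip * (L * (2 * A * b + A)) * h.
  apply: (@le_trans _ _ (2 * time_lip * (L * (2 * A * b + A)) * `|tau - t|)); last first.
    by rewrite ler_wpM2l// !mulr_ge0// addr_ge0// ?mulr_ge0// ltW.
  have gAb v : 0 < v -> v < b -> h^-1 * `|euler_flow t h v - v| <= A * b.
    move=> v0 vb; rewrite PhiE// mulKf ?gt_eqF// (le_trans (g_le tT v0))// ler_wpM2l//; exact: ltW.
  apply: (diffJ_lip tT tauT Hchi) => v v0.
    have [bv|vb] := leP b v.
      have [pv dv] := Hs v v0 bv; have [pPv _] := sPhi v v0 bv.
      by rewrite pPv pv subrr mulr0 normr0 mulr_ge0// addr_ge0// ?mulr_ge0// ltW.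
    rewrite normrM gtr0_norm ?invr_gt0//.
    have h2 := C11_lip H (euler_flow_gt0 tT (ltW h0) v0) v0.
    have hV : 0 <= h^-1 by rewrite invr_ge0 ltW.
    have h3 := ler_wpM2l hV h2.
    have h4 := ler_wpM2l L0 (gAb v v0 vb).
    have h5 : 0 <= L * A by rewrite mulr_ge0// ltW.
    by move: h3 h4 h5; lra.
  have [bv|vb] := leP b v.
    have [pv dv] := Hs v v0 bv; have [_ dPv] := sPhi v v0 bv.
    by rewrite dPv dv subrr mulr0 normr0 mulr_ge0// addr_ge0// ?mulr_ge0// ltW.
  rewrite (_ : h^-1 * _ = h^-1 * (dpsi (euler_flow t h v) - dpsi v) + dpsi (euler_flow t h v) * dg t v); last first.
    by field; rewrite gt_eqF.
  rewrite (le_trans (ler_normD _ _))// [leRHS]mulrDr lerD//.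
    rewrite normrM gtr0_norm ?invr_gt0//.
    have h2 := C11_dlip H (euler_flow_gt0 tT (ltW h0) v0) v0.
    have hV : 0 <= h^-1 by rewrite invr_ge0 ltW.
    have h3 := ler_wpM2l hV h2.
    have h4 := ler_wpM2l L0 (gAb v v0 vb).
    by move: h3 h4; lra.
  rewrite normrM ler_pM//; first exact: dpsiL (euler_flow_gt0 tT (ltW h0) v0).
  exact: dg_le.
have T3 : `|diffJ tau (fun v => 2^-1 * iK v - dual_coag psi tau v)| <= 2 * P * gap_term tau.
  have aD := admB aiK2 abtau.
  have aEk : adm (fun v2 => J (msum tau) (fun v1 => kernel_gap (v1, v2))).
    split.
      by apply: measurable_funTS; exact: measurable_inner kernel_gap_meas.
    exists (2 * k * M) => v2 v20.
    apply: (@inner_bnd _ _ om_meas msum tau M (2 * k) kernel_gap (bS tau) _ kernel_gap_meas kernel_gap_le v2 v20).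
    by rewrite mulr_ge0// ltW.
  rewrite (le_trans (diffJ_le_msum tau aD))// -(J_scalef (bS tau) _ aEk).
  have an : adm (fun v => `|2^-1 * iK v - dual_coag psi tau v|).
    move: aD => [md [C dC]]; split; first exact: measurableT_comp.
    by exists C => v v0; rewrite normr_id; exact: dC.
  apply: (J_lef (bS tau) an); first exact: admZ.
  move=> v2 v20.
  have aE1 : adm (fun v1 => kernel_gap (v1, v2)).
    split.
      by apply: measurable_funTS; exact: (measurable_fun_pair1 _ kernel_gap_meas).
    exists (2 * k * om v2 ^+ 2) => v1 v10; rewrite mulrAC; exact: kernel_gap_le.
  have atK : adm (fun v1 => tilde psi v1 v2 * K (v1, v2)).
    split.
      have mm : measurable_fun D (fun v1 => K (v1, v2)).
        by apply: measurable_funTS; exact: (measurable_fun_pair1 _ K_meas).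
      by apply: measurable_funM => //; exact: tilde_measurable1 H.
    exists (6 * k * L * om v2 ^+ 2) => v1 v10; rewrite mulrAC.
    exact: (tildeK_le psiL v10 v20).
  have atKt : adm (fun v1 => tilde psi v1 v2 * Kt (v1, v2)).
    have [dK1 HK1] := Kt_C11l v20.
    have tv : C11 (3 * L) (fun v1 => tilde psi v1 v2) (fun v => dpsi (v2 + v) - dpsi v).
      by apply: C11_ext (tilde_C11 v20 H) => // v _; exact: tildeC.
    exact: adm_C11 (C11M tv HK1).
  rewrite /iK /dual_coag -mulrBr -(J_subf (bS tau) atK atKt) -(J_scalef (bS tau) _ (admB atK atKt)).
  have := admZ 2^-1 (admB atK atKt) => -[mz [Cz hz]].
  rewrite (le_trans (J_norm_J om_meas (bS tau) mz hz))// -(J_scalef (bS tau) _ aE1).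
  apply: (J_lef (bS tau)); [|exact: admZ|].
    split; first exact: measurableT_comp.
    by exists Cz => v v0; rewrite normr_id; exact: hz.
  move=> v1 v10; rewrite /kernel_gap quadrantE//= -mulrBr normrM gtr0_norm// normrM.
  have o1 := om_ge0 om_ge1 v10; have o2 := om_ge0 om_ge1 v20.
  have tle : `|tilde psi v1 v2| <= 4 * P * (om v1 * om v2).
    have h2 := HP _ v10; have h3 := HP _ v20; have h4 := HP _ (addr_gt0 v10 v20).
    have h5 : om (v1 + v2) <= om v1 + om v2.
      by rewrite (le_trans (om_add v10 (ltW v20)))// lerD2l om_id.
    have h6 : om v1 + om v2 <= 2 * (om v1 * om v2).
      by have := om_ge1 v10; have := om_ge1 v20; nra.
    have h7 := ler_wpM2l P0 h5; have h8 := ler_wpM2l P0 h6.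
    rewrite (le_trans (ler_normB _ _))// (le_trans (lerD (ler_normB _ _) (lexx _)))//.
    by move: h2 h3 h4 h7 h8; lra.
  have KK := normr_ge0 (K (v1, v2) - Kt (v1, v2)).
  have := ler_wpM2r KK tle; lra.
have T4 : `|diffJ tau (fun v => dual_coag psi tau v - dual_coag psi t v)| <= 18 * time_lip * kap * L * h * M.
  apply: diffJ_norm1; first by case: (admB abtau ab).
    by rewrite !mulr_ge0// ltW.
  move=> v v0; rewrite (le_trans (dual_coag_time_lip H tT tauT v0))// ler_wpM2l//.
  by rewrite !mulr_ge0.
have T5 : `|diffJ tau (dual_coag psi t) - diffJ t (dual_coag psi t)| <= 2 * time_lip * (9 * M * kap * L) * h.
  apply: (@le_trans _ _ (2 * time_lip * (9 * M * kap * L) * `|tau - t|)); last first.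
    by rewrite ler_wpM2l// !mulr_ge0.
  by apply: (diffJ_lip tT tauT Hb) => v v0; have [] := Hb v v v0 v0.
have T6 : `|diffJ t (fun v => dual_coag psi t v - bPhi v)| <= 2 * (9 * M * kap * L) * (h * A) * M.
  apply: diffJ_norm; first by case: (admB ab abPhi).
  move=> v v0; rewrite distrC.
  rewrite (le_trans (C11_lip Hb (euler_flow_gt0 tT (ltW h0) v0) v0))// PhiE//.
  rewrite [leRHS](_ : _ = 2 * (9 * M * kap * L) * (h * (A * om v ^+ 2))); last by ring.
  have hg : h * g t v <= h * (A * om v ^+ 2) by rewrite ler_wpM2l// g_le_om2.
  by apply: ler_wpM2l hg; rewrite !mulr_ge0.
have S1 : diffJ tau (fun v => dpsi v * g tau v - chi v) = diffJ tau (fun v => dpsi v * g tau v) - diffJ tau chi.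
  exact: diffJ_subf.
have S3 : diffJ tau (fun v => 2^-1 * iK v - dual_coag psi tau v) = 2^-1 * diffJ tau iK - diffJ tau (dual_coag psi tau).
  by rewrite diffJ_subf// diffJ_scalef.
have S4 : diffJ tau (fun v => dual_coag psi tau v - dual_coag psi t v) = diffJ tau (dual_coag psi tau) - diffJ tau (dual_coag psi t).
  exact: diffJ_subf.
have S6 : diffJ t (fun v => dual_coag psi t v - bPhi v) = diffJ t (dual_coag psi t) - diffJ t bPhi.
  exact: diffJ_subf.
rewrite rE (_ : _ - X = diffJ tau (fun v => dpsi v * g tau v - chi v) + (diffJ tau chi - diffJ t chi)
   + diffJ tau (fun v => 2^-1 * iK v - dual_coag psi tau v)
   + diffJ tau (fun v => dual_coag psi tau v - dual_coag psi t v)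
   + (diffJ tau (dual_coag psi t) - diffJ t (dual_coag psi t))
   + diffJ t (fun v => dual_coag psi t v - bPhi v)); last first.
  by rewrite S1 S3 S4 S6 /X; ring.
apply: le_trans (ler_normD _ _) _.
apply: le_trans (lerD (ler_normD _ _) T6) _.
apply: le_trans (lerD (lerD (ler_normD _ _) T5) (lexx _)) _.
apply: le_trans (lerD (lerD (lerD (ler_normD _ _) T4) (lexx _)) (lexx _)) _.
apply: le_trans (lerD (lerD (lerD (lerD (ler_normD _ _) T3) (lexx _)) (lexx _)) (lexx _)) _.
apply: le_trans (lerD (lerD (lerD (lerD (lerD T1 T2) (lexx _)) (lexx _)) (lexx _)) (lexx _)) _.
have Q : 0 <= M * L * h + (M * A ^+ 2 + 2 * time_lip * (2 * A * b + A) + 36 * M * time_lip * kap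
  + 18 * M ^+ 2 * kap * A) * L * rho.
  by rewrite addr_ge0 ?mulr_ge0// !addr_ge0// !mulr_ge0// ?addr_ge0 ?mulr_ge0// exprn_ge0.
rewrite -subr_ge0 [leRHS](_ : _ = M * L * h + (M * A ^+ 2 + 2 * time_lip * (2 * A * b + A) + 36 * M * time_lip * kap
  + 18 * M ^+ 2 * kap * A) * L * rho)//.
by rewrite /Y /step_const; ring.
Qed.

Variable n0 : R.
Hypothesis n0_ge0 : 0 <= n0.
Hypothesis E0_le : forall P L psi dpsi, 0 <= P -> C11 L psi dpsi ->
  (forall v, 0 < v -> `|psi v| <= P * om v) -> diffJ 0 psi <= P * n0.

Definition gronwall_rate := 2 * k * M + A.
Definition lip_rate := 9 * M * kap + (2 * A + A ^+ 2 + B).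

Lemma gap_term_ge0 s : 0 <= gap_term s.
Proof.
apply: Rintegral_ge0 => v2 /Dgt0 v20; apply: Rintegral_ge0 => v1 /Dgt0 v10.
by rewrite /kernel_gap quadrantE// mulr_ge0// mulr_ge0// om_ge0.
Qed.

Lemma prod_le_expR (x y : R) : 0 <= x -> 0 <= y -> (1 + x) * (1 + y) <= expR (x + y).
Proof.
by move=> x0 y0; rewrite expRD ler_pM ?addr_ge0// expR_ge1Dx.
Qed.

(** Induction on the number of steps, from the last time back to the initial one.
    The bounds [Pm] and [Lm] are those reached at time 0; they are fixed in advance
    so that the errors of all the steps add up linearly. *)
Lemma euler_iter (h rho Pm Lm : R) : 0 < h -> h <= 1 -> h * (kap * M) <= 1 -> 0 <= rho ->
  (forall s t v, 0 <= s <= T -> 0 <= t <= T -> 0 < v <= b -> `|s - t| <= h ->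
    `|g s v - g t v| <= rho) ->
  forall j : nat, j%:R * h <= T -> forall P L psi dpsi, 0 <= P -> dual_class P L psi dpsi ->
    P * expR (gronwall_rate * (j%:R * h)) <= Pm -> L * expR (lip_rate * (j%:R * h)) <= Lm ->
    diffJ (j%:R * h) psi <= P * expR (gronwall_rate * (j%:R * h)) * n0
      + j%:R * h * (step_const * Lm * (h + rho))
      + 2 * Pm * \int[leb]_(s in `[0, j%:R * h]) gap_term s.
Proof.
move=> h0 h1 hk rho0 gr; have kap0 := kap_ge0; have CT0 := time_lip_ge0.
have h0' := ltW h0; have A0' := ltW A0; have B0' := ltW B0; have k0' := ltW k0.
have b0' := ltW b0.
have Lam0 : 0 <= gronwall_rate by rewrite addr_ge0 ?mulr_ge0.
have Cg0 : 0 <= lip_rate by rewrite !addr_ge0 ?mulr_ge0// exprn_ge0.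
have Cs0 : 0 <= step_const.
  by rewrite /step_const !addr_ge0 ?mulr_ge0// ?addr_ge0 ?mulr_ge0// exprn_ge0.
elim => [_|j IH jT] P L psi dpsi P0 HD HP HL.
  have [H HPs _] := HD.
  rewrite mul0r mulr0 expR0 mulr1 mul0r addr0 in HP HL *.
  rewrite (le_trans (E0_le P0 H HPs))// lerDl.
  have Pm0 : 0 <= Pm by exact: le_trans HP.
  rewrite mulr_ge0//; first by rewrite mulr_ge0.
  by apply: Rintegral_ge0 => s _; exact: gap_term_ge0.
have [H HPs _] := HD; have L0 := C11_ge0 H.
(* t is kept abstract, so that the arithmetic does not unfold it *)
have [t tE] : exists t, j%:R * h = t by exists (j%:R * h).
have Et : j.+1%:R * h = t + h by rewrite -natr1 mulrDl mul1r tE.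
rewrite tE in IH; rewrite Et in jT HP HL *.
have t0 : 0 <= t by rewrite -tE mulr_ge0.
have tT : t <= T by rewrite (le_trans _ jT)// lerDl.
have st : 0 <= t <= T by rewrite t0.
have P1 := euler_test_class st P0 _ hk HD; rewrite h0' h1 in P1; have {}P1 := P1 erefl.
have gP : (1 + 2 * k * M * h) * (1 + A * h) <= expR (gronwall_rate * h).
  rewrite (_ : gronwall_rate * h = 2 * k * M * h + A * h); last by rewrite /gronwall_rate; ring.
  by rewrite prod_le_expR// !mulr_ge0.
have gL : (1 + 9 * M * kap * h) * (1 + (2 * A + A ^+ 2 + B) * h) <= expR (lip_rate * h).
  rewrite (_ : lip_rate * h = 9 * M * kap * h + (2 * A + A ^+ 2 + B) * h); last by rewrite /lip_rate; ring.
  by rewrite prod_le_expR// ?mulr_ge0// !addr_ge0 ?mulr_ge0// exprn_ge0.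
have PP : P * (1 + 2 * k * M * h) * (1 + A * h) * expR (gronwall_rate * t) <= P * expR (gronwall_rate * (t + h)).
  rewrite (_ : gronwall_rate * (t + h) = gronwall_rate * h + gronwall_rate * t); last by ring.
  by rewrite expRD [leRHS]mulrA ler_wpM2r ?expR_ge0// -mulrA ler_wpM2l.
have LL : L * (1 + 9 * M * kap * h) * (1 + (2 * A + A ^+ 2 + B) * h) * expR (lip_rate * t)
    <= L * expR (lip_rate * (t + h)).
  rewrite (_ : lip_rate * (t + h) = lip_rate * h + lip_rate * t); last by ring.
  by rewrite expRD [leRHS]mulrA ler_wpM2r ?expR_ge0// -mulrA ler_wpM2l.
have P10 : 0 <= P * (1 + 2 * k * M * h) * (1 + A * h).
  by rewrite !mulr_ge0// addr_ge0// !mulr_ge0.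
have := IH tT _ _ _ _ P10 P1 (le_trans PP HP) (le_trans LL HL).
move=> IHt.
have LLm : L <= Lm.
  by rewrite (le_trans _ HL)// ler_peMr// -expR0 ler_expR mulr_ge0// addr_ge0.
have PPm : P <= Pm.
  by rewrite (le_trans _ HP)// ler_peMr// -expR0 ler_expR mulr_ge0// addr_ge0.
have grho tau v : t <= tau <= t + h -> 0 < v <= b -> `|g tau v - g t v| <= rho.
  move=> /andP[ttau tauth] vb; apply: gr => //.
    by rewrite (le_trans t0)//= (le_trans tauth).
  by rewrite ger0_norm ?subr_ge0// lerBlDl.
have := one_step t0 h0 h1 jT P0 hk HD grho => OS.
have th : t <= t + h by rewrite lerDl.
have ei : leb.-integrable `[0, t + h] (EFin \o gap_term).
  apply: (@bounded_integrable _ _ _ (2 * k * M * M)); first exact: gap_term_meas.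
  move=> x _; apply: (double_bnd om_meas (bS x) (bS x) _ kernel_gap_meas kernel_gap_le).
  by rewrite mulr_ge0.
rewrite (Rint_split t0 th ei).
have i0 : 0 <= \int[leb]_(s in `]t, t + h]) gap_term s.
  by apply: Rintegral_ge0 => s _; exact: gap_term_ge0.
have h2 : P * (1 + 2 * k * M * h) * (1 + A * h) * expR (gronwall_rate * t) * n0 <=
    P * expR (gronwall_rate * (t + h)) * n0 by rewrite ler_wpM2r.
have h3 : h * (step_const * L * (h + rho)) <= h * (step_const * Lm * (h + rho)).
  by rewrite ler_wpM2l// ler_wpM2r ?addr_ge0// ler_wpM2l.
have h4 : 2 * P * \int[leb]_(s in `]t, t + h]) gap_term s <= 2 * Pm * \int[leb]_(s in `]t, t + h]) gap_term s.
  by rewrite ler_wpM2r// ler_wpM2l.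
apply: (le_trans OS); apply: (le_trans (lerD (lerD IHt h3) h4)).
rewrite -subr_ge0 [leRHS](_ : _ = P * expR (gronwall_rate * (t + h)) * n0 -
   P * (1 + 2 * k * M * h) * (1 + A * h) * expR (gronwall_rate * t) * n0); last by ring.
by rewrite subr_ge0.
Qed.

(** With [Kt] fixed, the number of steps tends to infinity: the consistency error is
    of order [h + rho], where [rho] is the oscillation in time of [g] on the
    bounded set that contains the supports. *)
Lemma smooth_bound t L phi dphi : 0 < t <= T -> dual_class 1 L phi dphi ->
  diffJ t phi <= expR (gronwall_rate * t) * n0
    + 2 * expR (gronwall_rate * t) * \int[leb]_(s in `[0, t]) gap_term s.
Proof.
move=> /andP[t0 tT] HD; have [H _ _] := HD; have L0 := C11_ge0 H.
have kap0 := kap_ge0; have CT0 := time_lip_ge0.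
have A0' := ltW A0; have B0' := ltW B0; have k0' := ltW k0; have b0' := ltW b0.
have Cs0 : 0 <= step_const.
  by rewrite /step_const !addr_ge0 ?mulr_ge0// ?addr_ge0 ?mulr_ge0// exprn_ge0.
apply/ler_addgt0Pr => e e0.
pose Lm := L * expR (lip_rate * t).
have Lm0 : 0 <= Lm by rewrite mulr_ge0// expR_ge0.
pose X := t * (step_const * Lm).
have X0 : 0 <= X by rewrite !mulr_ge0// ltW.
pose d := e / (2 * (X + 1)).
have d0 : 0 < d by rewrite divr_gt0// mulr_gt0// ltr_wpDl.
have [eta eta0 Heta] := g_unif b d0.
(* the step must be below the modulus of continuity of g, below the tolerance, and
   small enough for the damping factor to be non-negative *)
pose q := Num.min (Num.min eta d) (Num.min 1 (kap * M + 1)^-1).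
have q0 : 0 < q by rewrite !lt_min eta0 d0 ltr01 invr_gt0 ltr_wpDl// mulr_ge0.
pose N := (Num.truncn (t / q)).+1.
pose h := t / N%:R.
have N0 : 0 < (N%:R : R) by rewrite ltr0n.
have h0 : 0 < h by rewrite divr_gt0.
have hq : h <= q.
  rewrite ler_pdivrMr// mulrC -ler_pdivrMr//.
  by have /truncn_itv/andP[_ /ltW] : 0 <= t / q by rewrite divr_ge0// ltW.
have := hq; rewrite !le_min => /andP[/andP[heta hd] /andP[h1 hk]].
have hkM : h * (kap * M) <= 1.
  have kM : 0 <= kap * M by rewrite mulr_ge0.
  rewrite (le_trans (ler_wpM2r kM hk))// mulrC ler_pdivrMr ?mul1r ?lerDl//.
  by rewrite ltr_wpDl.
have NE : N%:R * h = t by rewrite /h mulrC divfK// gt_eqF.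
have := @euler_iter h d (expR (gronwall_rate * t)) Lm h0 h1 hkM (ltW d0) _ N.
rewrite NE => /(_ _ tT 1 L phi dphi ler01 HD); rewrite mul1r lexx => /(_ _ isT (lexx _)).
move=> HH; have {HH} : diffJ t phi <= expR (gronwall_rate * t) * n0 + t * (step_const * Lm * (h + d)) +
    2 * expR (gronwall_rate * t) * \int[leb]_(s in `[0, t]) gap_term s.
  apply: HH => s u v sT uT vb su; apply: Heta => //; exact: le_trans heta.
suff : t * (step_const * Lm * (h + d)) <= e by lra.
rewrite (_ : t * (step_const * Lm * (h + d)) = X * (h + d)); last by rewrite /X; ring.
have : X * (h + d) <= X * (2 * d) by rewrite ler_wpM2l//; lra.
have : (X + 1) * (2 * d) = e by rewrite /d; field; rewrite gt_eqF// ltr_wpDl.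
by move: (ltW d0); lra.
Qed.

End smooth_kernel.

End two_solutions.
End core.

(** * Density of smooth functions in weighted L^1 *)

Lemma cvge0_small (R : realType) (u : nat -> \bar R) (e : R) :
  u n @[n --> \oo] --> 0%E -> 0 < e -> exists n, (u n <= e%:E)%E.
Proof.
move=> H e0; have : \forall n \near \oo, (u n < e%:E)%E.
  have Hn : nbhs 0%E [set x : \bar R | (x < e%:E)%E] by apply: open_ereal_lt'; rewrite lte_fin.
  exact: (H _ Hn).
by case=> n _ /(_ n (leqnn n)) /ltW ?; exists n.
Qed.

(** Abstract density: a class of [0, 1]-valued functions that contains 0 and is
    stable under [1 - f], products and midpoints approximates every measurable
    [0, 1]-valued function in the weighted L^1 norm, as soon as it approximates
    the indicators of a generating family of sets. *)
Section approximation.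
Context d (T : measurableType d) (R : realType) (mu : {measure set T -> \bar R}).
Variable theta : T -> R.
Hypothesis theta_meas : measurable_fun setT theta.
Hypothesis theta_ge0 : forall x, 0 <= theta x.
Hypothesis theta_int : (\int[mu]_x (theta x)%:E < +oo)%E.
Variable nice : (T -> R) -> Prop.
Hypothesis nice_meas : forall f, nice f -> measurable_fun setT f.
Hypothesis nice_01 : forall f x, nice f -> 0 <= f x <= 1.
Hypothesis nice0 : nice (cst 0).
Hypothesis niceC : forall f, nice f -> nice (fun x => 1 - f x).
Hypothesis niceM : forall f h, nice f -> nice h -> nice (fun x => f x * h x).
Hypothesis niceavg : forall f h, nice f -> nice h -> nice (fun x => 2^-1 * (f x + h x)).

Implicit Types f g h : T -> R.

Definition wnorm (f : T -> R) : \bar R := (\int[mu]_x (`|f x| * theta x)%:E)%E.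

Let wmeas f : measurable_fun setT f -> measurable_fun setT (fun x => (`|f x| * theta x)%:E).
Proof.
move=> mf; apply/measurable_EFinP; apply: measurable_funM => //.
exact: measurableT_comp.
Qed.

Let wpos f x : (0 <= (`|f x| * theta x)%:E)%E.
Proof. by rewrite lee_fin mulr_ge0. Qed.

Lemma wnorm_le2 f g h : measurable_fun setT f -> measurable_fun setT g -> measurable_fun setT h ->
  (forall x, `|f x| <= `|g x| + `|h x|) -> (wnorm f <= wnorm g + wnorm h)%E.
Proof.
move=> mf mg mh H; rewrite /wnorm -ge0_integralD//; try exact: wmeas.
apply: ge0_le_integral => //; first exact: wmeas.
- by apply: emeasurable_funD; exact: wmeas.
- by move=> x _; rewrite -EFinD lee_fin -mulrDl ler_wpM2r.
Qed.

Lemma wnorm_scale f c : measurable_fun setT f -> (wnorm (fun x => c * f x)%R = `|c|%:E * wnorm f)%E.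
Proof.
move=> mf; rewrite /wnorm -ge0_integralZl//; last exact: wmeas.
by apply: eq_integral => x _; rewrite normrM -mulrA EFinM.
Qed.

Lemma wnorm_dct (f_ : nat -> T -> R) : (forall n, measurable_fun setT (f_ n)) ->
  (forall n x, `|f_ n x| <= 1) -> (forall x, theta x != 0 -> f_ ^~ x @ \oo --> (0 : R)) ->
  wnorm (f_ n) @[n --> \oo] --> 0%E.
Proof.
move=> mf f1 f0.
have it : mu.-integrable setT (EFin \o theta).
  apply/integrableP; split; first exact/measurable_EFinP.
  by under eq_integral do rewrite /= ger0_norm//.
have := @dominated_convergence _ _ _ mu setT measurableT
  (fun n x => (`|f_ n x| * theta x)%:E) (cst 0%E) (EFin \o theta).
case.
- by move=> n; exact: wmeas.
- exact: measurable_cst.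
- apply/aeW => x _; apply: cvg_EFin; first by apply: nearW.
  have [->|t0] := eqVneq (theta x) 0.
    by under eq_fun do rewrite mulr0; exact: cvg_cst.
  rewrite -[X in _ --> X](mul0r (theta x)); apply: cvgMl.
  by rewrite -(normr0 R); apply: cvg_norm; exact: f0.
- exact: it.
- apply/aeW => x n _; rewrite /= lee_fin normrM normr_id (ger0_norm (theta_ge0 x)).
  by rewrite ler_piMl.
- by move=> _ _; rewrite integral0.
Qed.

(** These sets form a sigma-algebra, which reduces the approximation of indicators
    to a generating family. *)
Definition approximable (A : set T) := measurable A /\
  forall e : R, 0 < e -> exists2 f, nice f & (wnorm (fun x => \1_A x - f x)%R <= e%:E)%E.

Let mind (A : set T) : measurable A -> measurable_fun setT (\1_A : T -> R).
Proof. exact: measurable_indic. Qed.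

Let msub f h : measurable_fun setT f -> measurable_fun setT h ->
  measurable_fun setT (fun x => f x - h x : R).
Proof. exact: measurable_funB. Qed.

Lemma approximable0 : approximable set0.
Proof.
split=> // e e0; exists (cst 0) => //.
rewrite /wnorm; under eq_integral do rewrite indic0 subr0 normr0 mul0r.
by rewrite integral0 lee_fin ltW.
Qed.

Lemma approximableC A : approximable A -> approximable (~` A).
Proof.
move=> [mA HA]; split; first exact: measurableC.
move=> e e0; have [f Nf Hf] := HA e e0; exists (fun x => 1 - f x); first exact: niceC.
rewrite (le_trans _ Hf)// /wnorm; apply: ge0_le_integral => //.
- by move=> x _; rewrite lee_fin mulr_ge0.
- by apply: wmeas; apply: msub; [apply: mind; exact: measurableC|apply: nice_meas; exact: niceC].
- by apply: wmeas; apply: msub; [exact: mind|exact: nice_meas].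
- move=> x _; rewrite lee_fin ler_wpM2r// -normrN.
  rewrite (_ : - _ = \1_A x - f x)// !indicE in_setC.
  by case: (x \in A) => /=; ring.
Qed.

Lemma approximableI A B : approximable A -> approximable B -> approximable (A `&` B).
Proof.
move=> [mA HA] [mB HB]; split; first exact: measurableI.
move=> e e0; have e2 : 0 < e / 2 by rewrite divr_gt0.
have [f Nf Hf] := HA _ e2; have [h Nh Hh] := HB _ e2.
exists (fun x => f x * h x); first exact: niceM.
have -> : e%:E = ((e / 2)%:E + (e / 2)%:E)%E by rewrite -EFinD -splitr.
apply: le_trans (leeD Hf Hh); apply: wnorm_le2.
- by apply: msub; [apply: mind; exact: measurableI|apply: nice_meas; exact: niceM].
- by apply: msub; [exact: mind|exact: nice_meas].
- by apply: msub; [exact: mind|exact: nice_meas].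
- move=> x; rewrite indicI/= (_ : _ - _ = (\1_A x - f x) * \1_B x + f x * (\1_B x - h x)); last by ring.
  have /andP[f0 f1] := nice_01 x Nf.
  rewrite (le_trans (ler_normD _ _))// !normrM lerD//.
    by rewrite ler_piMr// indicE; case: (_ \in _); rewrite ?normr1 ?normr0.
  by rewrite ler_piMl// ger0_norm.
Qed.

Lemma approximableU A B : approximable A -> approximable B -> approximable (A `|` B).
Proof.
by move=> hA hB; rewrite -[A `|` B]setCK setCU; apply: approximableC; apply: approximableI; exact: approximableC.
Qed.

Lemma approximable_bigcup (F : nat -> set T) : (forall n, approximable (F n)) -> approximable (\bigcup_n F n).
Proof.
move=> HF; pose G n := \big[setU/set0]_(i < n) F i.
have aG n : approximable (G n).
  by rewrite /G; elim/big_ind : _ => //; [exact: approximable0|exact: approximableU].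
have mU : measurable (\bigcup_n F n) by apply: bigcup_measurable => n _; case: (HF n).
split => // e e0; have e2 : 0 < e / 2 by rewrite divr_gt0.
have H : wnorm (fun x => \1_(\bigcup_n F n) x - \1_(G n) x) @[n --> \oo] --> 0%E.
  apply: (@wnorm_dct (fun n x => \1_(\bigcup_n F n) x - \1_(G n) x)).
- by move=> n; apply: msub; apply: mind => //; case: (aG n).
- move=> n x; rewrite !indicE.
  by case: (_ \in _); case: (_ \in _); rewrite /= ?subrr ?subr0 ?sub0r ?normrN ?normr1 ?normr0.
- move=> x _; apply: cvg_near_cst.
  have [/= [n _ Fn]|nU] := pselect ((\bigcup_n F n) x); last first.
    apply: nearW => n.
    have nG : ~ G n x by rewrite /G -bigcup_mkord => -[i _ Fi]; apply: nU; exists i.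
    by rewrite !indicE !memNset// subrr.
  near=> m.
  have Gm : G m x by rewrite /G -bigcup_mkord; exists n => //=; near: m; exists n.+1.
  have Ux : (\bigcup_n F n) x by exists n.
  by rewrite !indicE !mem_set// subrr.
have [n Hn] := cvge0_small H e2.
have [mG /(_ _ e2) [f Nf Hf]] := aG n; exists f => //.
have -> : e%:E = ((e / 2)%:E + (e / 2)%:E)%E by rewrite -EFinD -splitr.
apply: le_trans (leeD Hn Hf); apply: wnorm_le2.
+ by apply: msub; [exact: mind|exact: nice_meas].
+ by apply: msub; exact: mind.
+ by apply: msub; [exact: mind|exact: nice_meas].
+ move=> x; rewrite (le_trans _ (ler_normD _ _))//.
  by rewrite [X in _ <= `|X|](_ : _ = \1_(\bigcup_n F n) x - f x)//; ring.
Unshelve. all: by end_near. Qed.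

Lemma approximable_sigma : sigma_algebra setT approximable.
Proof.
split; [exact: approximable0|by move=> A hA; rewrite setTD; exact: approximableC|exact: approximable_bigcup].
Qed.

(** Binary expansion: [kappa = (1_A + kappa') / 2] with [A] the set where
    [kappa >= 1/2] and [kappa'] again [0, 1]-valued. Each digit halves the error,
    and midpoints of members of the class stay in the class. *)
Lemma approx01 : (forall A, measurable A -> approximable A) ->
  forall kappa : T -> R, measurable_fun setT kappa -> (forall x, 0 <= kappa x <= 1) ->
  forall e, 0 < e -> exists2 f, nice f & (wnorm (fun x => kappa x - f x)%R <= e%:E)%E.
Proof.
move=> HA.
pose I := fine (\int[mu]_x (theta x)%:E).
have IE : I%:E = (\int[mu]_x (theta x)%:E)%E.
  by rewrite fineK// ge0_fin_numE// integral_ge0// => x _; rewrite lee_fin.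
have I0 : 0 <= I by rewrite fine_ge0// integral_ge0// => x _; rewrite lee_fin.
have main (n : nat) : forall (kappa : T -> R), measurable_fun setT kappa -> (forall x, 0 <= kappa x <= 1) ->
  forall e, 0 < e -> exists2 f, nice f & (wnorm (fun x => kappa x - f x)%R <= (I * 2^-1 ^+ n + e)%:E)%E.
  elim: n => [|n IH] kappa mk k01 e e0.
    exists (cst 0) => //; rewrite expr0 mulr1.
    apply: (@le_trans _ _ I%:E); last by rewrite lee_fin lerDl ltW.
    rewrite IE; apply: ge0_le_integral => //.
    - by move=> x _; rewrite lee_fin mulr_ge0.
    - by apply: wmeas; apply: msub.
    - exact/measurable_EFinP.
    - move=> x _; rewrite /= subr0 lee_fin; have /andP[a0 a1] := k01 x.
      by rewrite ger0_norm// ler_piMl.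
  pose A := [set x | 2^-1 <= kappa x].
  have mA : measurable A.
    by rewrite -[A]setTI; apply: measurable_fun_le => //; exact: measurable_cst.
  pose kp x := 2 * kappa x - \1_A x.
  have mkp : measurable_fun setT kp.
    by apply: msub; [exact: measurable_funM|exact: mind].
  have kp01 x : 0 <= kp x <= 1.
    have /andP[a0 a1] := k01 x; rewrite /kp indicE.
    have [xA|xA] := boolP (x \in A).
      by move: xA; rewrite inE /A/= => xA; apply/andP; split; lra.
    move: xA; rewrite notin_setE /A/= => /negP; rewrite -ltNge => xA.
    by apply/andP; split; lra.
  have [f Nf Hf] := IH kp mkp kp01 e e0.
  have [_ /(_ _ e0) [h Nh Hh]] := HA A mA.
  exists (fun x => 2^-1 * (f x + h x)); first exact: niceavg.
  have -> : (I * 2^-1 ^+ n.+1 + e)%:E =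
      (`|2^-1|%:E * (I * 2^-1 ^+ n + e)%:E + `|2^-1|%:E * e%:E)%E.
    by rewrite -!EFinM -EFinD ger0_norm ?invr_ge0// exprS; congr EFin; field.
  have mkf : measurable_fun setT (fun x => kp x - f x) by apply: msub => //; exact: nice_meas.
  have mAh : measurable_fun setT (fun x => \1_A x - h x) by apply: msub; [exact: mind|exact: nice_meas].
  have HS : (`|2^-1|%:E * wnorm (fun x => kp x - f x)%R + `|2^-1|%:E * wnorm (fun x => \1_A x - h x)%R
     <= `|2^-1|%:E * (I * 2^-1 ^+ n + e)%:E + `|2^-1|%:E * e%:E)%E.
    by apply: leeD; apply: lee_wpmul2l => //; rewrite lee_fin.
  apply: le_trans HS; rewrite -!wnorm_scale//; apply: wnorm_le2.
  - by apply: msub => //; apply: nice_meas; exact: niceavg.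
  - exact: measurable_funM.
  - exact: measurable_funM.
  - move=> x; rewrite (le_trans _ (ler_normD _ _))//.
    by rewrite [X in _ <= `|X|](_ : _ = kappa x - 2^-1 * (f x + h x))// /kp; field.
move=> kappa mk k01 e e0.
have e2 : 0 < e / 2 by rewrite divr_gt0.
have [n Hn] : exists n : nat, I * 2^-1 ^+ n <= e / 2.
  have : I * 2^-1 ^+ n @[n --> \oo] --> (0 : R).
    rewrite -[X in _ --> X](mulr0 I); apply: cvgMr; apply: cvg_expr.
    by rewrite ger0_norm ?invr_ge0// invf_lt1// ltr1n.
  move/cvgr_le => /(_ _ e2)[n _ /(_ n (leqnn n))] ?; by exists n.
have [f Nf Hf] := main n kappa mk k01 _ e2; exists f => //.
by rewrite (le_trans Hf)// lee_fin [leRHS]splitr lerD2r.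
Qed.

(** The steps of slope [n] at [a] converge to the indicator of [p > a], including at
    the points where [p = a], since they vanish there. *)
Lemma approximable_ray (p : T -> R) (a : R) : measurable_fun setT p ->
  (forall n : nat, nice (fun x => step (n.+1%:R * (p x - a)))) -> approximable (p @^-1` `]a, +oo[).
Proof.
move=> mp HN.
have mA : measurable (p @^-1` `]a, +oo[) by rewrite -[X in measurable X]setTI; exact: mp.
split => // e e0.
have H : wnorm (fun x => \1_(p @^-1` `]a, +oo[) x - step (n.+1%:R * (p x - a))) @[n --> \oo] --> 0%E.
  apply: (@wnorm_dct (fun n x => \1_(p @^-1` `]a, +oo[) x - step (n.+1%:R * (p x - a)))).
  - by move=> n; apply: msub; [exact: mind|exact: (nice_meas (HN n))].
  - move=> n x; have /andP[s0 s1] := step01 (n.+1%:R * (p x - a)).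
    by rewrite indicE ler_norml; case: (_ \in _) => /=; apply/andP; split; lra.
  - move=> x _; apply: cvg_near_cst.
    have [pa|ap] := leP (p x) a.
      apply: nearW => n; rewrite indicE memNset/= ?in_itv/= ?andbT; last by rewrite ltNge pa.
      by rewrite step_le0 ?subrr// mulr_ge0_le0// subr_le0.
    exists (Num.truncn (p x - a)^-1) => // n /= hn.
    rewrite indicE mem_set/= ?in_itv/= ?andbT//.
    have d0 : 0 < p x - a by rewrite subr_gt0.
    rewrite step_ge1 ?subrr// -ler_pdivrMr// div1r.
    have /truncn_itv/andP[_ /ltW/le_trans] : 0 <= (p x - a)^-1 by rewrite invr_ge0 ltW.
    by apply; rewrite ler_nat.
have [n Hn] := cvge0_small H e0.
by exists (fun x => step (n.+1%:R * (p x - a))).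
Qed.

Lemma approximable_preimage (p : T -> R) : (forall a : R, approximable (p @^-1` `]a, +oo[)) ->
  forall A : set (measurableTypeR R), measurable A -> approximable (p @^-1` A).
Proof.
move=> HG.
suff : (@RGenOInfty.G R).-sigma.-measurable `<=` [set A | approximable (p @^-1` A)].
  by move=> H A mA; apply: H; rewrite -RGenOInfty.measurableE.
apply: smallest_sub; last by move=> _ [a ->]; exact: HG.
split.
- by rewrite /= preimage_set0; exact: approximable0.
- by move=> A /=; rewrite setTD preimage_setC; exact: approximableC.
- by move=> F HF /=; rewrite preimage_bigcup; exact: approximable_bigcup.
Qed.

End approximation.

Section smooth_functions.
Context {R : realType}.
Notation D := (`]0%R, +oo[%classic : set R).

Lemma step_measurable d (T : measurableType d) (f : T -> R) : measurable_fun setT f ->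
  measurable_fun setT (fun x => step (f x)).
Proof.
move=> mf.
have mp2 (c : R) : measurable_fun setT (fun x => pos2 (f x - c)).
  apply: measurable_funX; apply: measurable_maxr => //; exact: measurable_funB.
have mp0 : measurable_fun setT (fun x => pos2 (f x)).
  by apply: measurable_funX; exact: measurable_maxr.
by apply: measurable_funD; [apply: measurable_funB|]; exact: measurable_funM.
Qed.

Definition smooth1 (f : R -> R) := [/\ measurable_fun setT f, forall x, 0 <= f x <= 1
  & exists L df, C11 L f df].

Lemma smooth1_0 : smooth1 (cst 0).
Proof.
split; [exact: measurable_cst|by move=> x /=; rewrite lexx ler01|].
by exists 0, (cst 0); apply: C11_cst; rewrite normr0.
Qed.

Lemma smooth1_C f : smooth1 f -> smooth1 (fun x => 1 - f x).
Proof.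
move=> [mf f01 [L [df H]]]; split.
- exact: measurable_funB.
- by move=> x; have /andP[? ?] := f01 x; apply/andP; split; lra.
- by exists (1 + L), (fun v => cst 0 v - df v); apply: (@C11B _ _ _ (cst 1)) => //; apply: C11_cst; rewrite normr1.
Qed.

Lemma smooth1_M f h : smooth1 f -> smooth1 h -> smooth1 (fun x => f x * h x).
Proof.
move=> [mf f01 [L [df H]]] [mh h01 [L' [dh H']]]; split.
- exact: measurable_funM.
- by move=> x; have /andP[? ?] := f01 x; have /andP[? ?] := h01 x; rewrite mulr_ge0//= mulr_ile1.
- by eexists; eexists; exact: C11M H H'.
Qed.

Lemma smooth1_avg f h : smooth1 f -> smooth1 h -> smooth1 (fun x => 2^-1 * (f x + h x)).
Proof.
move=> [mf f01 [L [df H]]] [mh h01 [L' [dh H']]]; split.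
- by apply: measurable_funM => //; exact: measurable_funD.
- by move=> x; have /andP[? ?] := f01 x; have /andP[? ?] := h01 x; apply/andP; split; lra.
- by eexists; eexists; apply: C11Z; exact: C11D H H'.
Qed.

Definition smooth2 (f : R * R -> R) := [/\ measurable_fun setT f, forall x, 0 <= f x <= 1
  & exists L d1 d2, [/\ forall v1, 0 < v1 -> C11 L (fun v2 => f (v1, v2)) (d2 v1),
      forall v2, 0 < v2 -> C11 L (fun v1 => f (v1, v2)) (d1 v2) &
      forall v2, 0 < v2 -> measurable_fun D (fun v1 => d2 v1 v2)]].

Lemma smooth2_0 : smooth2 (cst 0).
Proof.
split; [exact: measurable_cst|by move=> x /=; rewrite lexx ler01|].
exists 0, (fun _ => cst 0), (fun _ => cst 0).
by split => // *; apply: C11_cst; rewrite normr0.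
Qed.

Lemma smooth2_C f : smooth2 f -> smooth2 (fun x => 1 - f x).
Proof.
move=> [mf f01 [L [d1 [d2 [H2 H1 m2]]]]]; split.
- exact: measurable_funB.
- by move=> x; have /andP[? ?] := f01 x; apply/andP; split; lra.
- exists (1 + L), (fun v v' => cst 0 v' - d1 v v'), (fun v v' => cst 0 v' - d2 v v'); split.
  + move=> v v0; apply: (@C11B _ _ _ (cst 1)); last exact: H2.
    by apply: C11_cst; rewrite normr1.
  + move=> v v0; apply: (@C11B _ _ _ (cst 1)); last exact: H1.
    by apply: C11_cst; rewrite normr1.
  + by move=> v v0; apply: measurable_funB => //; exact: m2.
Qed.

Lemma smooth2_M f h : smooth2 f -> smooth2 h -> smooth2 (fun x => f x * h x).
Proof.
move=> [mf f01 [L [d1 [d2 [H2 H1 m2]]]]] [mh h01 [L' [d1' [d2' [H2' H1' m2']]]]]; split.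
- exact: measurable_funM.
- by move=> x; have /andP[? ?] := f01 x; have /andP[? ?] := h01 x; rewrite mulr_ge0//= mulr_ile1.
- exists (6 * (L * L')), (fun v2 v1 => d1 v2 v1 * h (v1, v2) + f (v1, v2) * d1' v2 v1),
    (fun v1 v2 => d2 v1 v2 * h (v1, v2) + f (v1, v2) * d2' v1 v2); split.
  + by move=> v v0; apply: C11M; [exact: H2|exact: H2'].
  + by move=> v v0; apply: C11M; [exact: H1|exact: H1'].
  + move=> v v0; apply: measurable_funD; apply: measurable_funM.
    * exact: m2.
    * exact: C11_measurable (H1' v v0).
    * exact: C11_measurable (H1 v v0).
    * exact: m2'.
Qed.

Lemma smooth2_avg f h : smooth2 f -> smooth2 h -> smooth2 (fun x => 2^-1 * (f x + h x)).
Proof.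
move=> [mf f01 [L [d1 [d2 [H2 H1 m2]]]]] [mh h01 [L' [d1' [d2' [H2' H1' m2']]]]]; split.
- by apply: measurable_funM => //; exact: measurable_funD.
- by move=> x; have /andP[? ?] := f01 x; have /andP[? ?] := h01 x; apply/andP; split; lra.
- exists (`|2^-1| * (L + L')), (fun v2 v1 => 2^-1 * (d1 v2 v1 + d1' v2 v1)),
    (fun v1 v2 => 2^-1 * (d2 v1 v2 + d2' v1 v2)); split.
  + by move=> v v0; apply: C11Z; apply: C11D; [exact: H2|exact: H2'].
  + by move=> v v0; apply: C11Z; apply: C11D; [exact: H1|exact: H1'].
  + by move=> v v0; apply: measurable_funM => //; apply: measurable_funD; [exact: m2|exact: m2'].
Qed.

Lemma smooth1_step (n : nat) (a : R) : smooth1 (fun x => step (n.+1%:R * (x - a))).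
Proof.
split.
- by apply: step_measurable; apply: measurable_funM => //; exact: measurable_funB.
- by move=> x; exact: step01.
- by eexists; eexists; apply: C11_step; rewrite ler1n.
Qed.

Lemma smooth1_fst f : smooth1 f -> smooth2 (fun x => f x.1).
Proof.
move=> [mf f01 [L [df H]]]; split; [exact: measurableT_comp|by []|].
have L0 := C11_ge0 H.
exists L, (fun _ => df), (fun _ => cst 0); split => //.
by move=> v v0; exact: (C11_cst (C11_bnd H v0)).
Qed.

Lemma smooth1_snd f : smooth1 f -> smooth2 (fun x => f x.2).
Proof.
move=> [mf f01 [L [df H]]]; split; [exact: measurableT_comp|by []|].
exists L, (fun _ => cst 0), (fun _ => df); split => //.
by move=> v v0; exact: (C11_cst (C11_bnd H v0)).
Qed.

Lemma approx_smooth1 (mu : {measure set (measurableTypeR R) -> \bar R}) (theta : R -> R) :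
  measurable_fun setT theta -> (forall x, 0 <= theta x) ->
  (\int[mu]_x (theta x)%:E < +oo)%E ->
  forall kappa : R -> R, measurable_fun setT kappa -> (forall x, 0 <= kappa x <= 1) ->
  forall e, 0 < e -> exists2 f, smooth1 f &
    (wnorm mu theta (fun x => kappa x - f x)%R <= e%:E)%E.
Proof.
have N0 : forall f, smooth1 f -> measurable_fun setT f by move=> f [].
have N1 : forall f x, smooth1 f -> 0 <= f x <= 1 by move=> f x [_ + _]; exact.
move=> mt t0 ti.
apply: (@approx01 _ _ _ mu theta mt t0 ti smooth1 N0 smooth1_0 smooth1_avg) => A mA.
apply: (@approximable_preimage _ _ _ mu theta mt t0 ti smooth1 N0 N1 smooth1_0 smooth1_C smooth1_M id _ A mA).
move=> a; apply: (@approximable_ray _ _ _ mu theta mt t0 ti smooth1 N0 id a) => //.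
by move=> n; exact: smooth1_step.
Qed.

(** The sets that depend on one coordinate are approximable, hence so are their
    intersections, the measurable rectangles, which generate. *)
Lemma approx_smooth2 (mu : {measure set (measurableTypeR R * measurableTypeR R) -> \bar R})
    (theta : R * R -> R) :
  measurable_fun setT theta -> (forall x, 0 <= theta x) ->
  (\int[mu]_x (theta x)%:E < +oo)%E ->
  forall kappa : R * R -> R, measurable_fun setT kappa -> (forall x, 0 <= kappa x <= 1) ->
  forall e, 0 < e -> exists2 f, smooth2 f &
    (wnorm mu theta (fun x => kappa x - f x)%R <= e%:E)%E.
Proof.
have N0 : forall f, smooth2 f -> measurable_fun setT f by move=> f [].
have N1 : forall f x, smooth2 f -> 0 <= f x <= 1 by move=> f x [_ + _]; exact.
move=> mt t0 ti.
apply: (@approx01 _ _ _ mu theta mt t0 ti smooth2 N0 smooth2_0 smooth2_avg).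
have A1 : forall A : set (measurableTypeR R), measurable A ->
    approximable mu theta smooth2 ((fst : R * R -> R) @^-1` A).
  apply: (@approximable_preimage _ _ _ mu theta mt t0 ti smooth2 N0 N1 smooth2_0 smooth2_C smooth2_M).
  move=> a; apply: (@approximable_ray _ _ _ mu theta mt t0 ti smooth2 N0 fst a) => //.
  by move=> n; apply: (smooth1_fst (smooth1_step n a)).
have A2 : forall A : set (measurableTypeR R), measurable A ->
    approximable mu theta smooth2 ((snd : R * R -> R) @^-1` A).
  apply: (@approximable_preimage _ _ _ mu theta mt t0 ti smooth2 N0 N1 smooth2_0 smooth2_C smooth2_M).
  move=> a; apply: (@approximable_ray _ _ _ mu theta mt t0 ti smooth2 N0 snd a) => //.
  by move=> n; apply: (smooth1_snd (smooth1_step n a)).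
rewrite measurable_prod_measurableType; apply: smallest_sub.
  exact: (@approximable_sigma _ _ _ mu theta mt t0 ti smooth2 N0 N1 smooth2_0 smooth2_C smooth2_M).
move=> _ [X mX [Y mY <-]].
rewrite (_ : X `*` Y = (fst @^-1` X) `&` (snd @^-1` Y))//.
exact: (@approximableI _ _ _ mu theta mt t0 smooth2 N0 N1 smooth2_M _ _ (A1 X mX) (A2 Y mY)).
Qed.

End smooth_functions.

(** * Measures and kernels given by densities *)

Section density.
Context d (T : measurableType d) (R : realType) (mu : {measure set T -> \bar R}).
Variable f : T -> R.
Hypothesis mf : measurable_fun setT f.
Hypothesis f0 : forall x, 0 <= f x.

(** The proofs are arguments of the definition so that the measure structure can be
    inferred from the term. *)
Definition density_measure (_ : measurable_fun setT f) (_ : forall x, 0 <= f x) (A : set T) : \bar R :=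
  (\int[mu]_(x in A) (f x)%:E)%E.

Let dens0 : density_measure mf f0 set0 = 0%E.
Proof. by rewrite /density_measure integral_set0. Qed.

Let dens_ge0 A : (0 <= density_measure mf f0 A)%E.
Proof. by apply: integral_ge0 => x _; rewrite lee_fin. Qed.

Let dens_sigma_additive : semi_sigma_additive (density_measure mf f0).
Proof.
move=> /= F mF tF mUF; rewrite /density_measure; apply: cvg_toP.
  apply: ereal_nondecreasing_is_cvgn => m n mn.
  apply: lee_sum_nneg_natr => // k _ _.
  by apply: integral_ge0 => /= x Fkx; rewrite lee_fin.
rewrite ge0_integral_bigcup//=.
- by apply: measurable_funTS; exact/measurable_EFinP.
- by move=> x _; rewrite lee_fin.
Qed.

HB.instance Definition _ := isMeasure.Build _ _ _ (density_measure mf f0)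
  dens0 dens_ge0 dens_sigma_additive.

Import HBNNSimple.

Let integral_dens_nnsfun (h : {nnsfun T >-> R}) :
  (\int[density_measure mf f0]_x (h x)%:E = \int[mu]_x ((h x)%:E * (f x)%:E))%E.
Proof.
under [LHS]eq_integral do rewrite fimfunE -fsumEFin//.
rewrite ge0_integral_fsum//; last 2 first.
- by move=> r; apply/measurable_EFinP; exact: measurable_funM.
- by move=> r x _; rewrite nnfun_muleindic_ge0.
under [RHS]eq_integral => x _.
  rewrite fimfunE -fsumEFin// ge0_mule_fsuml; last first.
    by move=> r; rewrite nnfun_muleindic_ge0.
  over.
rewrite ge0_integral_fsum//; last 2 first.
- move=> r; apply: emeasurable_funM; apply/measurable_EFinP => //.
  exact: measurable_funM.
- by move=> r x _; rewrite mule_ge0 ?nnfun_muleindic_ge0// lee_fin.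
apply: eq_fsbigr => r _.
rewrite integralZl_indic_nnsfun// integral_indic// setIT.
under [RHS]eq_integral do rewrite EFinM -muleA.
have [r0|r0] := leP 0 r.
  rewrite ge0_integralZl//; last 2 first.
  - apply: emeasurable_funM; apply/measurable_EFinP => //; exact: measurable_indic.
  - by move=> x _; rewrite mule_ge0 ?lee_fin.
  congr (_ * _)%E; rewrite /density_measure [LHS]integral_mkcond; apply: eq_integral => x _.
  by rewrite patchE indicE; case: (_ \in _); rewrite ?mul1e ?mul0e.
rewrite preimage_nnfun0// measure0 mule0 integral0_eq// => x _.
by rewrite indic0 mul0e mule0.
Qed.

(** Holds for simple functions by definition, and passes to the limit by monotone
    convergence on both sides. *)
Lemma ge0_integral_density (F : T -> \bar R) : measurable_fun setT F -> (forall x, 0 <= F x)%E ->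
  (\int[density_measure mf f0]_x F x = \int[mu]_x (F x * (f x)%:E))%E.
Proof.
move=> mF F0; pose h := nnsfun_approx measurableT mF.
have -> : (\int[density_measure mf f0]_x F x = lim (\int[density_measure mf f0]_x (EFin \o h n) x @[n --> \oo]))%E.
  have fE x : F x = lim ((EFin \o h n) x @[n --> \oo]).
    by apply/esym/cvg_lim => //; exact: cvg_nnsfun_approx.
  under eq_integral do rewrite fE.
  apply: monotone_convergence => //.
  - by move=> n; apply/measurable_EFinP.
  - by move=> n x _ //=; rewrite lee_fin.
  - by move=> x _ a b ab; rewrite lee_fin; exact/lefP/nd_nnsfun_approx.
have -> : (\int[mu]_x (F x * (f x)%:E) =
    lim (\int[mu]_x ((EFin \o h n) x * (f x)%:E) @[n --> \oo]))%E.
  have fE x : (F x * (f x)%:E = lim (((EFin \o h n) x * (f x)%:E) @[n --> \oo]))%E.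
    by apply/esym/cvg_lim => //; apply: cvgeZr => //; exact: cvg_nnsfun_approx.
  under eq_integral do rewrite fE.
  apply: monotone_convergence => //.
  - by move=> n; apply: emeasurable_funM; apply/measurable_EFinP.
  - by move=> n x _ //=; rewrite mule_ge0 ?lee_fin.
  - move=> x _ a b ab; rewrite lee_wpmul2r ?lee_fin//; exact/lefP/nd_nnsfun_approx.
by under eq_fun do rewrite integral_dens_nnsfun.
Qed.

Lemma Rintegral_density (D : set T) (F : T -> R) : measurable D -> measurable_fun D F ->
  \int[density_measure mf f0]_(x in D) F x = \int[mu]_(x in D) (F x * f x).
Proof.
move=> mD mF; rewrite /Rintegral; congr fine.
rewrite integral_mkcond [RHS]integral_mkcond.
rewrite (_ : (fun x => (F x)%:E) \_ D = EFin \o (F \_ D)); last by rewrite restrict_EFin.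
rewrite (_ : (fun x => (F x * f x)%:E) \_ D = EFin \o (fun x => (F \_ D) x * f x)); last first.
  by apply/funext => x; rewrite /= !patchE; case: ifP => //; rewrite mul0r.
have mG : measurable_fun setT (F \_ D) by apply/(measurable_restrictT _ mD).
move: (F \_ D) mG => G mG.
rewrite integralE [RHS]integralE !ge0_integral_density//; last 2 first.
- by apply: measurable_funeneg; exact/measurable_EFinP.
- by apply: measurable_funepos; exact/measurable_EFinP.
congr (_ - _)%E; apply: eq_integral => x _.
- rewrite !funeposE/= -!fine_max//= -EFinM; congr EFin.
  have [G0|G0] := leP 0 (G x).
    by rewrite (max_l (mulr_ge0 _ _)).
  by rewrite mul0r max_r// mulr_le0_ge0// ltW.
- rewrite !funenegE/= -!fine_max//= -EFinM; congr EFin.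
  have [G0|G0] := leP 0 (- G x).
    by rewrite -mulNr max_l// mulr_ge0.
  by rewrite mul0r max_r// -mulNr mulr_le0_ge0// ltW.
Qed.

End density.

Section kernel_of_density.
Context d (X : measurableType d) (R : realType).
Variable f : X -> R -> R.
Hypothesis mf : forall x, measurable_fun setT (f x).
Hypothesis f0 : forall x v, 0 <= f x v.
Hypothesis mk : forall A : set (measurableTypeR R), measurable A ->
  measurable_fun setT (fun x => \int[leb R]_(v in A) (f x v)%:E)%E.
Hypothesis ub : exists r, forall x, (\int[leb R]_v (f x v)%:E < r%:E)%E.

Definition density_kernel (_ : forall A : set (measurableTypeR R), measurable A ->
    measurable_fun setT (fun x => \int[leb R]_(v in A) (f x v)%:E)%E)
    (_ : exists r, forall x, (\int[leb R]_v (f x v)%:E < r%:E)%E) :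
    X -> {measure set (measurableTypeR R) -> \bar R} :=
  fun x => density_measure (leb R) (mf x) (f0 x).

HB.instance Definition _ := isKernel.Build _ _ _ _ R (density_kernel mk ub) mk.

HB.instance Definition _ := Kernel_isFinite.Build _ _ _ _ R (density_kernel mk ub) ub.

End kernel_of_density.

(** The measure [ds m_s(dv1) m_s(dv2)] on pairs of sizes, integrated over [0, T]. For
    this measure, the total kernel error of the Euler scheme is a single weighted
    L^1 norm of [K - Kt], to which density arguments apply. *)
Section spacetime.
Context {R : realType}.
Notation D := (`]0%R, +oo[%classic : set R).
Notation mR := (measurableTypeR R).
Notation leb := (leb R).
Variables (T : R) (m : R.-fker (measurableTypeR R) ~> (measurableTypeR R)).

Let tf (_ : unit) : R -> R := \1_(`[0, T]).
Let mtf x : measurable_fun setT (tf x). Proof. by apply: measurable_indic; exact: measurable_itv. Qed.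
Let tf0 x v : 0 <= tf x v. Proof. by rewrite /tf. Qed.
Let mkt (A : set mR) : measurable A -> measurable_fun setT (fun x => \int[leb]_(v in A) (tf x v)%:E)%E.
Proof. by move=> mA; rewrite /tf; apply: measurable_cst. Qed.
Let ubt : exists r, forall x, (\int[leb]_v (tf x v)%:E < r%:E)%E.
Proof.
exists (`|T| + 1) => x; rewrite /tf integral_indic//.
rewrite setIT /= lebesgue_measure_itv/= lte_fin; case: ifP => _.
  by rewrite -EFinB lte_fin subr0 (le_lt_trans (ler_norm T))// ltrDl.
by rewrite lte_fin ltr_wpDl.
Qed.

Let l1 : R.-fker unit ~> mR := density_kernel mtf tf0 mkt ubt.
Let l2 : R.-fker (unit * mR)%type ~> mR :=
  kernel_precomp m (measurable_snd : measurable_fun setT (snd : unit * mR -> mR)).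
Let l3 : R.-fker (unit * mR * mR)%type ~> mR :=
  kernel_precomp m (measurableT_comp measurable_snd measurable_fst
    : measurable_fun setT (fun x : unit * mR * mR => x.1.2)).
Let pairf (x : unit * mR * mR * mR) : (mR * mR)%type := (x.2, x.1.2).
Let mpairf : measurable_fun setT pairf.
Proof.
apply/measurable_fun_pairP; split; first exact: measurable_snd.
exact: (measurableT_comp measurable_snd measurable_fst).
Qed.
Let l4 : R.-sfker (unit * mR * mR * mR)%type ~> (mR * mR)%type := kdirac mpairf.
Let l34 : R.-sfker (unit * mR * mR)%type ~> (mR * mR)%type := mkcomp l3 l4.
Let l234 : R.-sfker (unit * mR)%type ~> (mR * mR)%type := mkcomp l2 l34.
Let l1234 : R.-sfker unit ~> (mR * mR)%type := mkcomp l1 l234.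

Definition spacetime_measure : {measure set (mR * mR) -> \bar R} := l1234 tt.

Lemma integral_spacetime_measure (F : R * R -> \bar R) : measurable_fun setT F -> (forall x, 0 <= F x)%E ->
  (\int[spacetime_measure]_p F p = \int[leb]_(s in `[0%R, T]) \int[m s]_v2 \int[m s]_v1 F (v1, v2))%E.
Proof.
move=> mF F0.
have mi : measurable_fun setT (fun s => \int[m s]_v2 \int[m s]_v1 F (v1, v2))%E.
  have mf : measurable_fun setT (fst : mR * mR -> mR) by exact: measurable_fst.
  have H : measurable_fun setT (fun p : mR * mR => \int[m p.1]_v1 F (v1, p.2))%E.
    apply: (@measurable_fun_integral_finite_kernel _ _ (mR * mR)%type mR R (fun p => F (p.2, p.1.2)) (kernel_precomp m mf)) => //.
    apply: (measurableT_comp mF); apply/measurable_fun_pairP; split.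
      exact: measurable_snd.
    exact: (measurableT_comp measurable_snd measurable_fst).
  apply: (@measurable_fun_integral_finite_kernel _ _ mR mR R (fun p => \int[m p.1]_v1 F (v1, p.2))%E m) => //.
  by move=> p; exact: integral_ge0.
rewrite /spacetime_measure /l1234 /mkcomp integral_kcomp//.
transitivity (\int[l1 tt]_s \int[m s]_v2 \int[m s]_v1 F (v1, v2))%E.
  apply: eq_integral => s _; rewrite /l234 /mkcomp integral_kcomp//.
  apply: eq_integral => v2 _; rewrite /l34 /mkcomp integral_kcomp//.
  apply: eq_integral => v1 _; rewrite /l4 /kdirac integral_dirac//.
  by rewrite diracT mul1e.
rewrite /l1 /density_kernel ge0_integral_density//; last first.
  by move=> s; apply: integral_ge0 => v2 _; exact: integral_ge0.
rewrite [RHS]integral_mkcond; apply: eq_integral => s _.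
by rewrite patchE /tf indicE; case: ifP => _; rewrite ?mule1 ?mule0.
Qed.

End spacetime.

(** * Smoothing the coagulation kernel *)

Section kernel_approximation.
Context {R : realType}.
Notation D := (`]0%R, +oo[%classic : set R).
Notation leb := (leb R).

Variable om : R -> R.
Hypothesis om_meas : measurable_fun D om.
Hypothesis om_ge1 : forall v, 0 < v -> 1 <= om v.
Variables (T k M : R).
Hypotheses (T0 : 0 < T) (k0 : 0 < k).
Variable K : R * R -> R.
Hypothesis K_meas : measurable_fun setT K.
Hypothesis K_ge0 : forall v1 v2, 0 < v1 -> 0 < v2 -> 0 <= K (v1, v2).
Hypothesis K_le : forall v1 v2, 0 < v1 -> 0 < v2 -> K (v1, v2) <= 2 * k * (om v1 * om v2).
Variables m1 m2 : R.-fker (measurableTypeR R) ~> (measurableTypeR R).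
Hypothesis bS : forall s, moment2_le om (msum m1 m2 s) M.
Variables (eta deta : nat -> R -> R) (Leta : nat -> R).
Hypothesis eta_C11 : forall n, C11 (Leta n) (eta n) (deta n).
Hypothesis eta_ge0 : forall n v, 0 < v -> 0 <= eta n v.
Hypothesis eta_le : forall n v, 0 < v -> eta n v <= om v.
Hypothesis eta_cvg : forall v, 0 < v -> eta n v @[n --> \oo] --> om v.

Lemma om_DD_meas (f : R * R -> R) : measurable_fun setT f -> (forall p, quadrant p -> 0 < f p) ->
    measurable_fun (quadrant : set (R * R)) (fun p => om (f p)).
Proof.
move=> mf f0; apply: (measurable_comp mD _ om_meas).
  by move=> _ [p /f0 p0 <-]; exact: gt0D.
exact: (measurable_funS measurableT).
Qed.

Lemma om1_DD_meas : measurable_fun (quadrant : set (R * R)) (fun p => om p.1).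
Proof. by apply: (om_DD_meas (f := fst)) => // p []. Qed.

Lemma om2_DD_meas : measurable_fun (quadrant : set (R * R)) (fun p => om p.2).
Proof. by apply: (om_DD_meas (f := snd)) => // p []. Qed.

(** The weight for which the kernel error becomes a distance between functions with
    values in [0, 1]: one factor [om om] of it comes from the bound on the test
    functions, and the other one, together with [2 k], from the bound on [K]. *)
Definition weight2 : R * R -> R := (fun p => 2 * k * (om p.1 ^+ 2 * om p.2 ^+ 2)) \_ quadrant.

Lemma weight2_meas : measurable_fun setT weight2.
Proof.
apply/(measurable_restrictT _ measurable_quadrant); apply: measurable_funM => //.
by apply: measurable_funM; apply: measurable_funX; [exact: om1_DD_meas|exact: om2_DD_meas].
Qed.

Lemma weight2_ge0 p : 0 <= weight2 p.
Proof.
rewrite /weight2 patchE; case: ifP => // _.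
by apply: mulr_ge0; apply: mulr_ge0; rewrite ?sqr_ge0// ltW.
Qed.

Lemma integral_spacetime_J (G : R * R -> R) C : measurable_fun setT G -> (forall p, 0 <= G p) ->
  (forall p, ~ quadrant p -> G p = 0) -> 0 <= C ->
  (forall v1 v2, 0 < v1 -> 0 < v2 -> `|G (v1, v2)| <= C * om v1 ^+ 2 * om v2 ^+ 2) ->
  (\int[spacetime_measure T (msum m1 m2)]_p (G p)%:E =
   (\int[leb]_(s in `[0%R, T])
     J (msum m1 m2 s) (fun v2 => J (msum m1 m2 s) (fun v1 => G (v1, v2))))%R%:E)%E.
Proof.
move=> mG G0 Gz C0 GC; pose m := msum m1 m2.
rewrite integral_spacetime_measure; [|exact/measurable_EFinP|by move=> p; rewrite lee_fin].
have inner s v2 : (\int[m s]_v1 (G (v1, v2))%:E = (if v2 \in D then J (m s) (fun v1 => G (v1, v2)) else 0)%:E)%E.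
  case: ifPn => [/set_mem/Dgt0 v20|/negP v20]; last first.
    rewrite integral0_eq// => v1 _; rewrite Gz// => -[_ /= v2p].
    by apply: v20; apply/mem_set; exact: gt0D.
  have iG : (m s).-integrable D (EFin \o (fun v1 => G (v1, v2))).
    apply: (@J_integrable _ om om_meas (m s) M (fun v1 => G (v1, v2)) (C * om v2 ^+ 2) (bS s)).
      by apply: measurable_funTS; exact: (measurable_fun_pair1 _ mG).
    by move=> v v0; rewrite mulrAC; exact: GC.
  rewrite /J /Rintegral fineK; last exact: integrable_fin_num.
  rewrite [RHS]integral_mkcond; apply: eq_integral => v1 _; rewrite patchE.
  case: ifPn => // /negP v1n; rewrite Gz// => -[/= v1p _].
  by apply: v1n; apply/mem_set; exact: gt0D.
have outer s : (\int[m s]_v2 \int[m s]_v1 (G (v1, v2))%:E =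
    (J (m s) (fun v2 => J (m s) (fun v1 => G (v1, v2))))%:E)%E.
  under eq_integral do rewrite inner.
  have mi : measurable_fun D (fun v2 => J (m s) (fun v1 => G (v1, v2))).
    by apply: measurable_funTS; exact: measurable_inner.
  have iG : (m s).-integrable D (EFin \o (fun v2 => J (m s) (fun v1 => G (v1, v2)))).
    apply: (@J_integrable _ om om_meas (m s) M _ (C * M) (bS s)) => // v2 v20.
    exact: (@inner_bnd _ _ om_meas m s M C G (bS s)).
  rewrite [in RHS]/J /Rintegral fineK; last exact: integrable_fin_num.
  rewrite [RHS]integral_mkcond; apply: eq_integral => v2 _; rewrite patchE.
  by case: ifP.
under eq_integral do rewrite outer.
rewrite /Rintegral fineK//; apply: integrable_fin_num => //.
apply: (@bounded_integrable _ _ _ (C * M * M)); first exact: measurable_double_time.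
by move=> s _; exact: (double_bnd om_meas (bS s) (bS s) C0 mG GC).
Qed.

Lemma weight2_le v1 v2 : 0 < v1 -> 0 < v2 -> `|weight2 (v1, v2)| <= 2 * k * om v1 ^+ 2 * om v2 ^+ 2.
Proof. by move=> v10 v20; rewrite ger0_norm ?weight2_ge0// /weight2 quadrantE// mulrA. Qed.

Let k20 : 0 <= 2 * k. Proof. by rewrite mulr_ge0// ltW. Qed.

Lemma weight2_int : (\int[spacetime_measure T (msum m1 m2)]_p (weight2 p)%:E < +oo)%E.
Proof.
rewrite (integral_spacetime_J weight2_meas weight2_ge0 _ k20 weight2_le) ?ltry//.
by move=> p np; rewrite /weight2 patchE memNset.
Qed.

Definition ratioK : R * R -> R := (fun p => K p * (2 * k * (om p.1 * om p.2)) `^ (-1)) \_ quadrant.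

Lemma ratioK_meas : measurable_fun setT ratioK.
Proof.
apply/(measurable_restrictT _ measurable_quadrant); apply: measurable_funM; first exact: (measurable_funS measurableT).
have mden : measurable_fun (quadrant : set (R * R)) (fun p => 2 * k * (om p.1 * om p.2)).
  by apply: measurable_funM => //; apply: measurable_funM; [exact: om1_DD_meas|exact: om2_DD_meas].
exact: (measurableT_comp (@measurable_powR R (-1)) mden).
Qed.

Lemma oo_gt0 v1 v2 : 0 < v1 -> 0 < v2 -> 0 < 2 * k * (om v1 * om v2).
Proof. by move=> v10 v20; rewrite !mulr_gt0// (lt_le_trans ltr01)// om_ge1. Qed.

Lemma ratioKE v1 v2 : 0 < v1 -> 0 < v2 -> ratioK (v1, v2) = K (v1, v2) / (2 * k * (om v1 * om v2)).
Proof. by move=> v10 v20; rewrite /ratioK quadrantE//= powR_inv1// ltW// oo_gt0. Qed.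

Lemma ratioK01 p : 0 <= ratioK p <= 1.
Proof.
have [[p1 p2]|np] := pselect (quadrant p); last by rewrite /ratioK patchE memNset// lexx ler01.
case: p p1 p2 => v1 v2 /= v10 v20; rewrite ratioKE//.
have h := oo_gt0 v10 v20.
by rewrite divr_ge0 ?K_ge0 ?(ltW h)//= ler_pdivrMr// mul1r K_le.
Qed.

Definition cut_omega n v := eta n v * (1 - step (1 * (v - n%:R))).
Definition d_cut_omega n v := deta n v * (1 - step (1 * (v - n%:R)))
  + eta n v * (cst 0 v - 1 * dstep (1 * (v - n%:R))).

Lemma cut_omega_C11 n : C11 (6 * (Leta n * (1 + 8 * 1 ^+ 2))) (cut_omega n) (d_cut_omega n).
Proof.
apply: C11M; first exact: eta_C11.
by apply: (@C11B _ _ _ (cst 1)); [apply: C11_cst; rewrite normr1|exact: C11_step].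
Qed.

Lemma cut_omega_ge0 n v : 0 < v -> 0 <= cut_omega n v.
Proof.
move=> v0; have /andP[s0 s1] := step01 (1 * (v - n%:R)).
by rewrite mulr_ge0 ?eta_ge0// subr_ge0.
Qed.

Lemma cut_omega_le n v : 0 < v -> cut_omega n v <= om v.
Proof.
move=> v0; have /andP[s0 s1] := step01 (1 * (v - n%:R)).
by rewrite (le_trans _ (eta_le n v0))// ler_piMr ?eta_ge0//; lra.
Qed.

Lemma cut_omega_supp n v : n.+1%:R <= v -> cut_omega n v = 0 /\ d_cut_omega n v = 0.
Proof.
rewrite -natr1 => nv; have h : 1 <= 1 * (v - n%:R) by lra.
by rewrite /cut_omega /d_cut_omega step_ge1// dstep_ge1// subrr !mulr0 subr0 mulr0 addr0.
Qed.

Lemma cut_omega_cvg v : 0 < v -> cut_omega n v @[n --> \oo] --> om v.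
Proof.
move=> v0.
have H : \forall n \near \oo, eta n v = cut_omega n v.
  exists (Num.truncn v).+1 => // n /= hn; rewrite /cut_omega step_le0 ?subr0 ?mulr1//.
  rewrite mul1r subr_le0.
  have /truncn_itv/andP[_ /ltW/le_trans] : 0 <= v by exact: ltW.
  by apply; rewrite ler_nat.
by apply: cvg_trans (eta_cvg v0); apply: near_eq_cvg; apply: filterS H => n ->.
Qed.

(** Write [K = 2 k om om kappa] with [0 <= kappa <= 1]. Replacing [kappa] by a smooth
    function and both weights [om] by smooth functions with bounded support that tend
    to [om] from below gives an admissible [Kt]. The two replacements are small in
    the weighted L^1 norm, by density and by dominated convergence respectively. *)
Lemma kernel_approx (e b0 : R) : 0 < e -> exists (Kt : R * R -> R) (dK2 : R -> R -> R) (kap b : R),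
  [/\ [/\ 0 < b, b0 <= b & measurable_fun setT Kt],
      [/\ forall v1 v2, 0 < v1 -> 0 < v2 -> 0 <= Kt (v1, v2) &
          forall v1 v2, 0 < v1 -> 0 < v2 -> Kt (v1, v2) <= 2 * k * (om v1 * om v2)],
      [/\ forall v1, 0 < v1 -> C11 kap (fun v2 => Kt (v1, v2)) (dK2 v1),
          forall v2, 0 < v2 -> measurable_fun D (fun v1 => dK2 v1 v2) &
          forall v2, 0 < v2 -> exists dK1, C11 kap (fun v1 => Kt (v1, v2)) dK1],
      forall v1 v2, 0 < v1 -> 0 < v2 -> b <= v2 -> Kt (v1, v2) = 0 /\ dK2 v1 v2 = 0 &
      \int[leb]_(s in `[0, T]) gap_term om K m1 m2 Kt s <= e].
Proof.
move=> e0; have e2 : 0 < e / 2 by rewrite divr_gt0.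
pose mu := spacetime_measure T (msum m1 m2).
have [kt [mkt kt01 [L [d1 [d2 [H2 H1 md2]]]]] Hkt] :=
  approx_smooth2 weight2_meas weight2_ge0 weight2_int ratioK_meas ratioK01 e2.
pose N0 := (Num.truncn b0).+1.
pose lam n v := cut_omega n v * om v `^ (-1).
pose G n : R * R -> R := (fun p => 1 - lam (n + N0)%N p.1 * lam (n + N0)%N p.2) \_ quadrant.
have lamE n v : 0 < v -> lam n v = cut_omega n v / om v.
  by move=> v0; rewrite /lam powR_inv1// (om_ge0 om_ge1).
have om_gt0 v : 0 < v -> 0 < om v by move=> v0; rewrite (lt_le_trans ltr01)// om_ge1.
have lam01 n v : 0 < v -> 0 <= lam n v <= 1.
  move=> v0; rewrite lamE// divr_ge0 ?cut_omega_ge0 ?(om_ge0 om_ge1)//=.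
  by rewrite ler_pdivrMr ?om_gt0// mul1r cut_omega_le.
have mcut n (f : R * R -> R) : measurable_fun setT f -> (forall p, quadrant p -> 0 < f p) ->
    measurable_fun (quadrant : set (R * R)) (fun p => cut_omega n (f p)).
  move=> mf f0; apply: (measurable_comp mD _ (C11_measurable (cut_omega_C11 n))).
    by move=> _ [p /f0 p0 <-]; exact: gt0D.
  exact: (measurable_funS measurableT).
have mc1 n : measurable_fun (quadrant : set (R * R)) (fun p => cut_omega n p.1).
  by apply: (mcut n fst) => // p [].
have mc2 n : measurable_fun (quadrant : set (R * R)) (fun p => cut_omega n p.2).
  by apply: (mcut n snd) => // p [].
have mG n : measurable_fun setT (G n).
  apply/(measurable_restrictT _ measurable_quadrant); apply: measurable_funB => //.
  apply: measurable_funM; apply: measurable_funM => //.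
    exact: (measurableT_comp (@measurable_powR R (-1)) om1_DD_meas).
  exact: (measurableT_comp (@measurable_powR R (-1)) om2_DD_meas).
have G01 n p : 0 <= G n p <= 1.
  rewrite /G patchE; case: ifPn => [/set_mem[p1 p2]|_]; last by rewrite lexx ler01.
  have /andP[a0 a1] := lam01 (n + N0)%N _ p1; have /andP[a2 a3] := lam01 (n + N0)%N _ p2.
  by rewrite subr_ge0 mulr_ile1//= gerBl mulr_ge0.
have HG : wnorm mu weight2 (G n) @[n --> \oo] --> 0%E.
  apply: (@wnorm_dct _ _ _ mu weight2 weight2_meas weight2_ge0 weight2_int G mG).
    by move=> n p; have /andP[a0 a1] := G01 n p; rewrite ger0_norm.
  move=> p wp; have [[p1 p2]|np] := pselect (quadrant p); last first.
    by move: wp; rewrite /weight2 patchE memNset// eqxx.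
  have lc v : 0 < v -> lam (n + N0)%N v @[n --> \oo] --> (1 : R).
    move=> v0; have := om_gt0 _ v0 => ov.
    rewrite -(divff (lt0r_neq0 ov)).
    under eq_fun do rewrite lamE//.
    apply: cvgMl; have := cut_omega_cvg v0.
    by move=> /(cvg_comp (fun n => (n + N0)%N) (fun n => cut_omega n v)); apply; exact: cvg_addnr.
  rewrite (_ : G ^~ p = fun n => 1 - lam (n + N0)%N p.1 * lam (n + N0)%N p.2); last first.
    by apply/funext => n; rewrite /G patchE mem_set.
  rewrite -(subrr (1 : R)) -[X in _ - X](mulr1 (1 : R)); apply: cvgB; first exact: cvg_cst.
  by apply: cvgM; exact: lc.
have [n Hn] := cvge0_small HG e2.
pose q := (n + N0)%N.
pose Lc := 6 * (Leta q * (1 + 8 * 1 ^+ 2)).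
have Hc : C11 Lc (cut_omega q) (d_cut_omega q) by exact: cut_omega_C11.
have Lc0 := C11_ge0 Hc.
pose Kt : R * R -> R := (fun p => 2 * k * cut_omega q p.1 * (cut_omega q p.2 * kt p)) \_ quadrant.
pose dK2 v1 v2 := 2 * k * cut_omega q v1 * (d_cut_omega q v2 * kt (v1, v2) + cut_omega q v2 * d2 v1 v2).
pose kap := 2 * k * Lc * (6 * (Lc * L)).
have L0 : 0 <= L by exact: C11_ge0 (H2 1 ltr01).
have kc v : 0 < v -> `|2 * k * cut_omega q v| * (6 * (Lc * L)) <= kap.
  move=> v0; have cq : `|2 * k * cut_omega q v| <= 2 * k * Lc.
    by rewrite normrM (ger0_norm k20) ler_wpM2l//; exact: C11_bnd Hc v0.
  have LL : 0 <= 6 * (Lc * L) by rewrite mulr_ge0// mulr_ge0.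
  exact: ler_wpM2r LL _ _ cq.
have KtE v1 v2 : 0 < v1 -> 0 < v2 -> Kt (v1, v2) = 2 * k * cut_omega q v1 * (cut_omega q v2 * kt (v1, v2)).
  by move=> *; rewrite /Kt quadrantE.
have Kt0 v1 v2 : 0 < v1 -> 0 < v2 -> 0 <= Kt (v1, v2).
  move=> v10 v20; rewrite KtE//; have /andP[a0 _] := kt01 (v1, v2).
  by apply: mulr_ge0; apply: mulr_ge0 => //; exact: cut_omega_ge0.
have Ktle v1 v2 : 0 < v1 -> 0 < v2 -> Kt (v1, v2) <= 2 * k * (om v1 * om v2).
  move=> v10 v20; rewrite KtE// -mulrA ler_wpM2l//; have /andP[a0 a1] := kt01 (v1, v2).
  apply: ler_pM; [exact: cut_omega_ge0|by apply: mulr_ge0 => //; exact: cut_omega_ge0|exact: cut_omega_le|].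
  by rewrite (le_trans _ (cut_omega_le q v20))// ler_piMr// cut_omega_ge0.
have mKt : measurable_fun setT Kt.
  apply/(measurable_restrictT _ measurable_quadrant); apply: measurable_funM; first exact: measurable_funM.
  by apply: measurable_funM => //; exact: (measurable_funS measurableT).
exists Kt, dK2, kap, q.+1%:R; split; last 2 first.
- move=> v1 v2 v10 v20 bv; have [c0 dc0] := cut_omega_supp bv.
  by rewrite KtE// /dK2 c0 dc0 !mul0r addr0 mulr0.
- have mE : measurable_fun setT (kernel_gap om K Kt) by exact: kernel_gap_meas.
  have E0 p : 0 <= kernel_gap om K Kt p.
    rewrite /kernel_gap patchE; case: ifPn => // /set_mem[p1 p2].
    by rewrite mulr_ge0// mulr_ge0// (om_ge0 om_ge1).
  have Ez p : ~ quadrant p -> kernel_gap om K Kt p = 0 by move=> np; rewrite /kernel_gap patchE memNset.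
  have EC : forall v1 v2, 0 < v1 -> 0 < v2 -> `|kernel_gap om K Kt (v1, v2)| <= 2 * k * om v1 ^+ 2 * om v2 ^+ 2.
    by move=> v1 v2 v10 v20; exact: (kernel_gap_le om_ge1 K_ge0 K_le Kt0 Ktle).
  have HE := integral_spacetime_J mE E0 Ez k20 EC.
  rewrite -lee_fin; rewrite /gap_term -HE.
  have -> : e%:E = ((e / 2)%:E + (e / 2)%:E)%E by rewrite -EFinD -splitr.
  apply: le_trans (leeD Hkt Hn).
  have mdif : measurable_fun setT (fun p => ratioK p - kt p).
    by apply: measurable_funB => //; exact: ratioK_meas.
  have mw (f : R * R -> R) : measurable_fun setT f ->
      measurable_fun setT (fun p => (`|f p| * weight2 p)%:E).
    move=> mf; apply/measurable_EFinP; apply: measurable_funM; last exact: weight2_meas.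
    exact: measurableT_comp.
  rewrite /wnorm -ge0_integralD//; try exact: mw;
    try by move=> p _; rewrite lee_fin mulr_ge0// weight2_ge0.
  apply: ge0_le_integral => //.
  + by move=> p _; rewrite lee_fin.
  + exact/measurable_EFinP.
  + by apply: emeasurable_funD; exact: mw.
  + move=> p _; rewrite -EFinD lee_fin.
    have [[p1 p2]|np] := pselect (quadrant p); last first.
      by rewrite Ez// addr_ge0// mulr_ge0// weight2_ge0.
    case: p p1 p2 => v1 v2 /= v10 v20.
    have o1 := om_gt0 _ v10; have o2 := om_gt0 _ v20.
    have := ratioKE v10 v20 => rE.
    have KE : K (v1, v2) = 2 * k * (om v1 * om v2) * ratioK (v1, v2).
      by rewrite rE mulrC divfK// gt_eqF// oo_gt0.
    rewrite /kernel_gap quadrantE//= /weight2 quadrantE//= /G quadrantE//= KE KtE// -/q.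
    have c1E : cut_omega q v1 = lam q v1 * om v1 by rewrite lamE// divfK// gt_eqF.
    have c2E : cut_omega q v2 = lam q v2 * om v2 by rewrite lamE// divfK// gt_eqF.
    rewrite c1E c2E.
    have /andP[a0 a1] := lam01 q _ v10; have /andP[a2 a3] := lam01 q _ v20.
    have /andP[a4 a5] := kt01 (v1, v2).
    rewrite (_ : _ - _ = 2 * k * (om v1 * om v2) *
      ((ratioK (v1, v2) - kt (v1, v2)) + (1 - lam q v1 * lam q v2) * kt (v1, v2))); last by ring.
    rewrite normrM (ger0_norm (ltW (oo_gt0 v10 v20))) -mulrDl.
    set x := ratioK _ - _; set y := 1 - _.
    have xy : `|x + y * kt (v1, v2)| <= `|x| + `|y|.
      by rewrite (le_trans (ler_normD _ _))// lerD2l normrM ler_piMr// ger0_norm.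
    rewrite [leLHS](_ : _ = 2 * k * (om v1 * om v2) * (om v1 * om v2) * `|x + y * kt (v1, v2)|); last by ring.
    rewrite [leRHS](_ : _ = 2 * k * (om v1 * om v2) * (om v1 * om v2) * (`|x| + `|y|)); last by ring.
    apply: ler_wpM2l xy; apply: mulr_ge0; first exact: ltW (oo_gt0 v10 v20).
    by rewrite mulr_ge0// ltW.
- split; [by rewrite ltr0n| |exact: mKt].
  have [b00|b00] := leP 0 b0; last by rewrite (le_trans (ltW b00)).
  have /truncn_itv/andP[_ /ltW/le_trans] := b00; apply.
  by rewrite ler_nat /q /N0 leqW// leq_addl.
- by split.
- split.
  + move=> v1 v10; apply: (C11_le (kc v1 v10)).
    apply: (@C11_ext _ _ (fun v2 => 2 * k * cut_omega q v1 * (cut_omega q v2 * kt (v1, v2))) _ (dK2 v1) _) => //.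
      by move=> v2 v20; rewrite KtE.
    by apply: C11Z; apply: C11M => //; exact: H2.
  + move=> v2 v20; apply: measurable_funM.
      by apply: measurable_funM => //; exact: C11_measurable Hc.
    apply: measurable_funD; apply: measurable_funM => //.
      exact: C11_measurable (H1 v2 v20).
    exact: md2.
  + move=> v2 v20; eexists; apply: (C11_le (kc v2 v20)).
    apply: (@C11_ext _ _ (fun v1 => 2 * k * cut_omega q v2 * (cut_omega q v1 * kt (v1, v2))) _ _ _) => //.
      by move=> v1 v10; rewrite KtE//; ring.
    by apply: C11Z; apply: C11M; [exact: Hc|exact: H1].
Qed.

End kernel_approximation.

(** * The weighted norm by duality *)

Lemma ge0_finite_integrable d (X : measurableType d) (R : realType)
    (mu : {measure set X -> \bar R}) (A : set X) (G : X -> R) : measurable_fun A G ->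
  (forall x, A x -> 0 <= G x) -> (\int[mu]_(x in A) (G x)%:E < +oo)%E ->
  mu.-integrable A (EFin \o G).
Proof.
move=> mG G0 iG; apply/integrableP; split; first exact/measurable_EFinP.
by under eq_integral => x /set_mem xA do rewrite /= ger0_norm ?G0//.
Qed.

Section duality.
Context {R : realType}.
Notation D := (`]0%R, +oo[%classic : set R).
Notation leb := (leb R).

Variable om : R -> R.
Hypothesis om_meas : measurable_fun D om.
Hypothesis om_ge1 : forall v, 0 < v -> 1 <= om v.
Variables (eta deta : nat -> R -> R) (Leta : nat -> R).
Hypothesis eta_C11 : forall n, C11 (Leta n) (eta n) (deta n).
Hypothesis eta_ge0 : forall n v, 0 < v -> 0 <= eta n v.
Hypothesis eta_le : forall n v, 0 < v -> eta n v <= om v.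
Hypothesis eta_cvg : forall v, 0 < v -> eta n v @[n --> \oo] --> om v.

(** The supremum is nearly attained at [phi = om_n (2 f - 1)], where [f] is a smooth
    approximation of the indicator of [F > 0] and [om_n] a smooth approximation of
    [om] from below, with bounded support. *)
Lemma dual_norm (F : R -> R) (C : R) : measurable_fun D F ->
  (\int[leb]_(v in D) (om v * `|F v|)%:E < +oo)%E ->
  (forall L b phi dphi, C11 L phi dphi -> (forall v, 0 < v -> `|phi v| <= om v) ->
     (forall v, 0 < v -> b <= v -> phi v = 0 /\ dphi v = 0) ->
     \int[leb]_(v in D) (phi v * F v) <= C) ->
  (\int[leb]_(v in D) (om v * `|F v|)%:E <= C%:E)%E.
Proof.
move=> mF iF HC.
have om_gt0 v : 0 < v -> 0 < om v by move=> v0; rewrite (lt_le_trans ltr01)// om_ge1.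
pose theta : R -> R := (fun v => om v * `|F v|) \_ D.
have mth : measurable_fun setT theta.
  apply/(measurable_restrictT _ mD); apply: measurable_funM => //.
  exact: measurableT_comp.
have th0 v : 0 <= theta v.
  by rewrite /theta patchE; case: ifPn => // /set_mem/Dgt0 v0; rewrite mulr_ge0// ltW// om_gt0.
have thE : (\int[leb]_(v in D) (om v * `|F v|)%:E = \int[leb]_v (theta v)%:E)%E.
  by rewrite integral_mkcond; apply: eq_integral => v _; rewrite /theta !patchE; case: ifP.
have ith : (\int[leb]_v (theta v)%:E < +oo)%E by rewrite -thE.
pose S : set R := [set v | 0 < (F \_ D) v].
have mFD : measurable_fun setT (F \_ D) by apply/(measurable_restrictT _ mD).
have mS0 : measurable (S : set (measurableTypeR R)).
  have -> : S = [set: R] `&` (F \_ D) @^-1` `]0, +oo[.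
    by apply/seteqP; split => v /=; rewrite in_itv/= andbT => // -[].
  exact: mFD measurableT _ (measurable_itv _).
pose kappa : R -> R := \1_S.
have mka : measurable_fun setT kappa by exact: measurable_indic.
have ka01 v : 0 <= kappa v <= 1 by rewrite /kappa indicE; case: (_ \in _); rewrite /= ?lexx ?ler01.
apply/lee_addgt0Pr => e0 e0_gt0; set e := e0 / 4.
have e_gt0 : 0 < e by rewrite divr_gt0.
have [f [mf f01 [L1 [df Hf]]] Hw] := approx_smooth1 mth th0 ith mka ka01 e_gt0.
pose lam n v : R := cut_omega eta n v * om v `^ (-1).
have lamE n v : 0 < v -> lam n v = cut_omega eta n v / om v.
  by move=> v0; rewrite /lam powR_inv1// ltW// om_gt0.
pose G n : R -> R := (fun v => 1 - lam n v) \_ D.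
have mG n : measurable_fun setT (G n).
  apply/(measurable_restrictT _ mD); apply: measurable_funB => //; apply: measurable_funM.
    exact: (C11_measurable (cut_omega_C11 eta_C11 n)).
  exact: (measurableT_comp (@measurable_powR R (-1)) om_meas).
have lam01 n v : 0 < v -> 0 <= lam n v <= 1.
  move=> v0; rewrite lamE// divr_ge0 ?(ltW (om_gt0 _ v0))//=; last first.
    exact: (cut_omega_ge0 eta_ge0).
  by rewrite ler_pdivrMr ?om_gt0// mul1r; exact: (cut_omega_le eta_ge0 eta_le).
have G01 n v : `|G n v| <= 1.
  rewrite /G patchE; case: ifPn => [/set_mem/Dgt0 v0|_]; last by rewrite normr0.
  by have /andP[a b] := lam01 n v v0; rewrite ger0_norm; lra.
have HG : wnorm leb theta (G n) @[n --> \oo] --> 0%E.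
  apply: (@wnorm_dct _ _ _ leb theta mth th0 ith G mG G01) => v tv.
  have [vD|vD] := pselect (D v); last by move: tv; rewrite /theta patchE memNset// eqxx.
  have v0 := Dgt0 vD; have ov := om_gt0 _ v0.
  have -> : G ^~ v = fun n => 1 - cut_omega eta n v / om v.
    by apply/funext => n; rewrite /G patchE mem_set// lamE.
  rewrite -(subrr (1 : R)); apply: cvgB; first exact: cvg_cst.
  rewrite -[X in _ --> X](divff (lt0r_neq0 ov)); apply: cvgMl.
  exact: (cut_omega_cvg eta_cvg).
have [n Hn] := cvge0_small HG e_gt0.
pose sg v : R := 2 * f v - 1.
have sg1 v : `|sg v| <= 1 by have /andP[a b] := f01 v; rewrite ler_norml /sg; apply/andP; split; lra.
have Hsg : C11 (`|2| * L1 + 1) sg (fun v => 2 * df v - cst 0 v).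
  apply: C11B; first exact: C11Z.
  by apply: C11_cst; rewrite normr1.
have Hphi := C11M (cut_omega_C11 eta_C11 n) Hsg.
set phi := (fun v => _ v * _ v) in Hphi; set dphi := (X in C11 _ _ X) in Hphi.
have phile v : 0 < v -> `|phi v| <= om v.
  move=> v0; rewrite normrM ger0_norm; last exact: (cut_omega_ge0 eta_ge0).
  rewrite (le_trans _ (cut_omega_le eta_ge0 eta_le n v0))// ler_piMr//.
  exact: (cut_omega_ge0 eta_ge0).
have mphi : measurable_fun D phi by exact: C11_measurable Hphi.
have phisupp v : 0 < v -> n.+1%:R <= v -> phi v = 0 /\ dphi v = 0.
  move=> v0 nv; have [c0 dc0] := cut_omega_supp eta deta nv.
  by rewrite /phi /dphi c0 dc0 !mul0r addr0.
have mphiF : measurable_fun D (fun v => phi v * F v) by exact: measurable_funM.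
have iomF : leb.-integrable D (EFin \o (fun v => om v * `|F v|)).
  apply: ge0_finite_integrable => //.
    by apply: measurable_funM => //; exact: measurableT_comp.
  by move=> v /Dgt0 v0; rewrite mulr_ge0// ltW// om_gt0.
have iphi : leb.-integrable D (fun v => (phi v * F v)%:E).
  apply: (@le_integrable _ _ _ leb D mD _ (EFin \o (fun v => om v * `|F v|))).
  - exact/measurable_EFinP.
  - move=> v /Dgt0 v0 /=; rewrite lee_fin [leRHS]ger0_norm; last first.
      by rewrite mulr_ge0// ltW// om_gt0.
    by rewrite normrM ler_wpM2r// phile.
  - exact: iomF.
pose W v : \bar R := ((`|kappa v - f v| * theta v)%:E + (`|kappa v - f v| * theta v)%:E + (`|G n v| * theta v)%:E)%E.
have mw (h : R -> R) : measurable_fun setT h ->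
    measurable_fun setT (fun p => (`|h p| * theta p)%:E).
  by move=> mh; apply/measurable_EFinP; apply: measurable_funM => //; exact: measurableT_comp.
have mkf : measurable_fun setT (fun v => kappa v - f v) by exact: measurable_funB.
have w0 (h : R -> R) v : (0 <= (`|h v| * theta v)%:E)%E by rewrite lee_fin mulr_ge0.
have W0 v : (0 <= W v)%E by rewrite /W -!EFinD lee_fin !addr_ge0// mulr_ge0.
have mW : measurable_fun setT W.
  by apply: emeasurable_funD; [apply: emeasurable_funD|]; apply: mw.
have iW : (\int[leb]_v W v <= (e + e + e)%:E)%E.
  rewrite /W ge0_integralD//; last 3 first.
  - by move=> v _; rewrite -EFinD lee_fin addr_ge0// mulr_ge0.
  - by apply: emeasurable_funD; exact: mw.
  - exact: mw.
  rewrite ge0_integralD//; try exact: mw; try by move=> v _; rewrite lee_fin mulr_ge0.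
  by rewrite !EFinD; apply: leeD Hn; apply: leeD.
have iWD : leb.-integrable D W.
  apply: (@integrableS _ _ _ leb setT) => //; apply/integrableP; split => //.
  under eq_integral do rewrite gee0_abs//.
  by apply: le_lt_trans iW _; rewrite ltry.
have key : (\int[leb]_(v in D) (om v * `|F v|)%:E <= \int[leb]_(v in D) ((phi v * F v)%:E + W v))%E.
  apply: le_integral => //.
  - exact: integrableD.
  - move=> v /set_mem vD; have v0 := Dgt0 vD; have ov := om_gt0 _ v0.
    rewrite /W -!EFinD lee_fin.
    have thv : theta v = om v * `|F v| by rewrite /theta patchE mem_set.
    have Gv : G n v = 1 - lam n v by rewrite /G patchE mem_set.
    have cE : cut_omega eta n v = lam n v * om v by rewrite lamE// divfK// gt_eqF.
    have kE : `|F v| = (2 * kappa v - 1) * F v.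
      rewrite /kappa indicE; have FE : (F \_ D) v = F v by rewrite patchE mem_set.
      have [F0|F0] := ltP 0 (F v).
        by rewrite mem_set /S/= ?FE// gtr0_norm//; ring.
      by rewrite memNset /S/= ?FE; [rewrite ler0_norm//; ring|apply/negP; rewrite -leNgt].
    rewrite thv Gv /phi /= cE.
    have h1 := ler_norm (2 * (kappa v - f v) * F v).
    have h2 := ler_norm ((1 - lam n v) * sg v * F v).
    have h3 : `|(1 - lam n v) * sg v * F v| <= `|1 - lam n v| * `|F v|.
      by rewrite !normrM ler_wpM2r// ler_piMr.
    have h4 : `|2 * (kappa v - f v) * F v| = 2 * (`|kappa v - f v| * `|F v|).
      by rewrite !normrM mulrA ger0_norm.
    rewrite h4 in h1; have {}h2 := le_trans h2 h3.
    have := ler_wpM2l (ltW ov) (lerD h1 h2); rewrite -subr_ge0 => h5.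
    rewrite {1}kE -subr_ge0; apply: le_trans h5 _; rewrite /sg.
    by rewrite le_eqVlt; apply/orP; left; apply/eqP; ring.
apply: (le_trans key); rewrite integralD//.
apply: leeD.
  have := HC _ n.+1%:R phi dphi Hphi phile phisupp.
  rewrite -lee_fin /Rintegral fineK//; exact: integrable_fin_num.
apply: le_trans (le_trans iW _); last first.
  by rewrite lee_fin /e; have := e0_gt0; lra.
by apply: ge0_subset_integral => // v _.
Qed.

End duality.

(** * The dual bound *)

Section stability.
Context {R : realType}.
Notation D := (`]0%R, +oo[%classic : set R).
Notation leb := (leb R).

Variable om : R -> R.
Hypothesis om_meas : measurable_fun D om.
Hypothesis om_ge1 : forall v, 0 < v -> 1 <= om v.
Hypothesis om_id : forall v, 0 < v -> v <= om v.
Hypothesis om_add : forall v x, 0 < v -> 0 <= x -> om (v + x) <= om v + x.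
Variables (eta deta : nat -> R -> R) (Leta : nat -> R).
Hypothesis eta_C11 : forall n, C11 (Leta n) (eta n) (deta n).
Hypothesis eta_ge0 : forall n v, 0 < v -> 0 <= eta n v.
Hypothesis eta_le : forall n v, 0 < v -> eta n v <= om v.
Hypothesis eta_cvg : forall v, 0 < v -> eta n v @[n --> \oo] --> om v.

Variables (T k A B M : R).
Hypotheses (T0 : 0 < T) (k0 : 0 < k) (A0 : 0 < A) (B0 : 0 < B).
Variable K : R * R -> R.
Hypothesis K_meas : measurable_fun setT K.
Hypothesis K_ge0 : forall v1 v2, 0 < v1 -> 0 < v2 -> 0 <= K (v1, v2).
Hypothesis K_sym : forall v1 v2, 0 < v1 -> 0 < v2 -> K (v1, v2) = K (v2, v1).
Hypothesis K_le : forall v1 v2, 0 < v1 -> 0 < v2 -> K (v1, v2) <= 2 * k * (om v1 * om v2).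
Variables g dg : R -> R -> R.
Hypothesis g_meas : measurable_fun setT (fun p : R * R => g p.1 p.2).
Hypothesis g_ge0 : forall t v, 0 <= t <= T -> 0 < v -> 0 <= g t v.
Hypothesis g_le : forall t v, 0 <= t <= T -> 0 < v -> g t v <= A * v.
Hypothesis dg_le : forall t v, 0 <= t <= T -> 0 < v -> `|dg t v| <= A.
Hypothesis g_lip : forall t u v, 0 <= t <= T -> 0 < u -> 0 < v ->
  `|g t u - g t v| <= A * `|u - v|.
Hypothesis g_taylor : forall t u v, 0 <= t <= T -> 0 < u -> 0 < v ->
  `|g t u - g t v - dg t v * (u - v)| <= B * (u - v) ^+ 2.
Hypothesis g_unif : forall b rho : R, 0 < rho -> exists2 eta : R, 0 < eta &
  forall s t v, 0 <= s <= T -> 0 <= t <= T -> 0 < v <= b -> `|s - t| <= eta ->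
    `|g s v - g t v| <= rho.

Variables m1 m2 : R.-fker (measurableTypeR R) ~> (measurableTypeR R).
Hypothesis bS : forall s, moment2_le om (msum m1 m2 s) M.
Variables I1 I2 : (R -> R) -> R.
Hypothesis s1 : kernel_solution T K g m1 I1.
Hypothesis s2 : kernel_solution T K g m2 I2.
Variable n0 : R.
Hypothesis n0_ge0 : 0 <= n0.
Hypothesis E0_le : forall P L psi dpsi, 0 <= P -> C11 L psi dpsi ->
  (forall v, 0 < v -> `|psi v| <= P * om v) -> diffJ m1 m2 0 psi <= P * n0.

(** The kernel [Kt] is chosen after [phi] and the tolerance, with a support that
    contains the one of [phi]; the rate [gronwall_rate] does not depend on it. *)
Lemma dual_bound t L b0 phi dphi : 0 <= t <= T -> C11 L phi dphi ->
  (forall v, 0 < v -> `|phi v| <= om v) ->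
  (forall v, 0 < v -> b0 <= v -> phi v = 0 /\ dphi v = 0) ->
  diffJ m1 m2 t phi <= expR (gronwall_rate k A M * t) * n0.
Proof.
move=> /andP[t0 tT] H Hle Hs.
have Hle1 v : 0 < v -> `|phi v| <= 1 * om v by move=> v0; rewrite mul1r Hle.
move: t0; rewrite le_eqVlt => /orP[/eqP <-|t0].
  by rewrite mulr0 expR0; exact: E0_le H Hle1.
apply/ler_addgt0Pr => e e0.
pose d := e / (2 * expR (gronwall_rate k A M * t)).
have X0 := expR_gt0 (gronwall_rate k A M * t).
have d0 : 0 < d by rewrite divr_gt0// mulr_gt0.
have [Kt [dK2 [kap [b [[b1 bb mKt] [Kt0 Ktle] [Hr md Hl] Hsupp Hint]]]]] :=
  kernel_approx om_meas om_ge1 T k0 K_meas K_ge0 K_le bS eta_C11 eta_ge0 eta_le eta_cvg b0 d0.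
have HD : dual_class om b 1 L phi dphi.
  by split => // v v0 bv; apply: Hs => //; exact: le_trans bv.
have tT' : 0 < t <= T by rewrite t0.
have := smooth_bound om_meas om_ge1 om_id om_add k0 A0 B0 K_meas K_ge0 K_sym K_le
  g_meas g_ge0 g_le dg_le g_lip g_taylor g_unif bS s1 s2 b1 mKt Kt0 Ktle Hr md Hl Hsupp
  n0_ge0 E0_le tT' HD.
move=> /le_trans; apply; rewrite lerD2l.
have ei : leb.-integrable `[0, T] (EFin \o gap_term om K m1 m2 Kt).
  apply: (@bounded_integrable _ _ _ (2 * k * M * M)).
    exact: (@gap_term_meas R om om_meas K K_meas m1 m2 Kt mKt).
  move=> s _; apply: (@double_bnd _ _ om_meas _ _ s M M (2 * k) (kernel_gap om K Kt)) => //.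
  - by rewrite mulr_ge0// ltW.
  - exact: (@kernel_gap_meas R om om_meas K K_meas Kt mKt).
  - by move=> v1 v2 v10 v20; exact: (kernel_gap_le om_ge1 K_ge0 K_le Kt0 Ktle).
have h : \int[leb]_(s in `[0, t]) gap_term om K m1 m2 Kt s <= d.
  apply: le_trans Hint; rewrite (Rint_split (ltW t0) tT ei) lerDl.
  by apply: Rintegral_ge0 => s _; exact: gap_term_ge0.
have := ler_wpM2l (ltW (mulr_gt0 (ltr0n R 2) X0)) h.
by move=> /le_trans; apply; rewrite /d mulrC divfK// gt_eqF// mulr_gt0.
Qed.

End stability.

(** * Mean value estimates on the half-line *)

Section mvt_halfline.
Context {R : realType}.
Implicit Types u v x : R.

Lemma mvt_pos (f df : R -> R) : (forall x, 0 < x -> is_derive x 1 f (df x)) ->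
  forall u v, 0 < u -> 0 < v ->
  exists c, [/\ Num.min u v <= c, `|c - v| <= `|u - v| & f u - f v = df c * (u - v)].
Proof.
move=> fdf.
have H u v : 0 < u -> u <= v -> exists2 c, u <= c <= v & f v - f u = df c * (v - u).
  move=> u0 uv.
  have fc x : x \in `]u, v[ -> is_derive x 1 f (df x).
    by rewrite in_itv/= => /andP[ux _]; apply: fdf; exact: lt_trans ux.
  have cf : {within `[u, v], continuous f}.
    apply: derivable_within_continuous => x; rewrite in_itv/= => /andP[ux _].
    by have /fdf[] : 0 < x by exact: lt_le_trans ux.
  by have [c + ->] := MVT_segment uv fc cf; rewrite in_itv/= => uc; exists c.
move=> u v u0 v0; have [uv|vu] := leP u v.
  have [c /andP[uc cv] E] := H u v u0 uv; exists c; split; first exact: uc.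
    by rewrite (ler0_norm (_ : c - v <= 0)) ?(ler0_norm (_ : u - v <= 0)) ?subr_le0//; lra.
  by rewrite -opprB E; ring.
have [c /andP[vc cu] E] := H v u v0 (ltW vu); exists c; split; [exact: vc| |exact: E].
by rewrite (ger0_norm (_ : 0 <= c - v)) ?(ger0_norm (_ : 0 <= u - v)) ?subr_ge0//; lra.
Qed.

Lemma mvt_lip (f df : R -> R) A : (forall x, 0 < x -> is_derive x 1 f (df x)) ->
  (forall x, 0 < x -> `|df x| <= A) ->
  forall u v, 0 < u -> 0 < v -> `|f u - f v| <= A * `|u - v|.
Proof.
move=> fdf dfA u v u0 v0; have [c [uvc _ ->]] := mvt_pos fdf u0 v0.
by rewrite normrM ler_wpM2r// dfA// (lt_le_trans _ uvc)// lt_min u0.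
Qed.

Lemma mvt_taylor (f df d2f : R -> R) B : (forall x, 0 < x -> is_derive x 1 f (df x)) ->
  (forall x, 0 < x -> is_derive x 1 df (d2f x)) -> (forall x, 0 < x -> `|d2f x| <= B) ->
  forall u v, 0 < u -> 0 < v -> `|f u - f v - df v * (u - v)| <= B * (u - v) ^+ 2.
Proof.
move=> fdf dfd dB u v u0 v0; have [c [uvc cv ->]] := mvt_pos fdf u0 v0.
have c0 : 0 < c by rewrite (lt_le_trans _ uvc)// lt_min u0.
have B0 : 0 <= B by apply: le_trans (dB _ v0).
rewrite -mulrBl normrM -[X in _ <= _ * X]real_normK ?num_real// expr2 mulrA ler_wpM2r//.
by rewrite (le_trans (mvt_lip dfd dB c0 v0))// ler_wpM2l.
Qed.

End mvt_halfline.

(** * The weight and its bounded approximations *)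

Section weight.
Context {R : realType}.
Notation D := (`]0%R, +oo[%classic : set R).

Lemma is_derive_shift_powR (a e x : R) : 0 < x + e ->
  is_derive x 1 (fun v => (v + e) `^ a) (a * (x + e) `^ (a - 1)).
Proof.
move=> xe; rewrite -[a * _]mulr1.
have h1 : is_derive (x + e) 1 (fun v => v `^ a) (a * (x + e) `^ (a - 1)).
  exact: is_derive1_powR.
have h2 : is_derive x 1 (fun v => v + e) (1 : R).
  by rewrite -[X in is_derive _ _ _ X]addr0; exact: is_deriveD.
by have := @is_derive1_comp _ (fun v => v `^ a) (fun v => v + e) x _ _ h1 h2.
Qed.

Lemma powR_le_neg (a u v : R) : a <= 0 -> 0 < u -> u <= v -> v `^ a <= u `^ a.
Proof.
move=> a0 u0 uv; have v0 := lt_le_trans u0 uv.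
rewrite -[a]opprK powRN [leRHS]powRN lef_pV2 ?posrE ?powR_gt0//.
by rewrite ge0_ler_powR ?nnegrE ?oppr_ge0// ltW.
Qed.

Lemma C11_shift_powR (a e : R) : a <= 0 -> 0 < e -> exists L,
  C11 L (fun v => (v + e) `^ a) (fun v => a * (v + e) `^ (a - 1)).
Proof.
move=> a0 e0.
pose B1 := e `^ a; pose B2 := `|a| * e `^ (a - 1).
pose B3 := `|a| * (`|a - 1| * e `^ (a - 1 - 1)).
exists (B1 + B2 + B3) => u v u0 v0.
have b1 : 0 <= B1 by exact: powR_ge0.
have b2 : 0 <= B2 by rewrite mulr_ge0// powR_ge0.
have b3 : 0 <= B3 by rewrite mulr_ge0// mulr_ge0// powR_ge0.
have le_e b x : b <= 0 -> 0 < x -> `|(x + e) `^ b| <= e `^ b.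
  by move=> b0 x0; rewrite ger0_norm ?powR_ge0// powR_le_neg// lerDr ltW.
have sh (x : R) : 0 < x -> 0 < x + e by move=> x0; rewrite addr_gt0.
split.
- by have := le_e a v a0 v0; rewrite -/B1; lra.
- have : a - 1 <= 0 by lra.
  move=> /le_e/(_ v0) h; have := ler_wpM2l (normr_ge0 a) h.
  by rewrite -normrM -/B2; lra.
- have fd (x : R) : 0 < x -> is_derive x 1 (fun v => (v + e) `^ a) (a * (x + e) `^ (a - 1)).
    by move=> x0; apply: is_derive_shift_powR; exact: sh.
  have fd2 (x : R) : 0 < x -> is_derive x 1 (fun v => a * (v + e) `^ (a - 1))
      (a * ((a - 1) * (x + e) `^ (a - 1 - 1))).
    move=> x0; have := @is_derive_shift_powR (a - 1) e x (sh x x0) => h.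
    exact: (is_deriveZ a h).
  have db x : 0 < x -> `|a * ((a - 1) * (x + e) `^ (a - 1 - 1))| <= B3.
    move=> x0; rewrite !normrM; do 2 rewrite ler_wpM2l//.
    by apply: le_e => //; lra.
  rewrite (le_trans (mvt_taylor fd fd2 db u0 v0))// ler_wpM2r ?sqr_ge0//; lra.
Qed.

Variable beta : R.
Hypothesis beta_gt0 : 0 < beta.

Definition omega (v : R) := v `^ (- beta) + v `^ 1.

Let nbeta : - beta <= 0. Proof. by rewrite oppr_le0 ltW. Qed.

Lemma omegaE v : 0 < v -> omega v = v `^ (- beta) + v.
Proof. by move=> v0; rewrite /omega powRr1// ltW. Qed.

Lemma omega_meas : measurable_fun D omega.
Proof.
apply: measurable_funD; apply: measurable_funTS; exact: measurable_powR.
Qed.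

Lemma omega_ge1 v : 0 < v -> 1 <= omega v.
Proof.
move=> v0; rewrite omegaE//; have [v1|v1] := leP 1 v.
  by rewrite (le_trans v1)// lerDr powR_ge0.
have := powR_le_neg nbeta v0 (ltW v1); rewrite powR1; lra.
Qed.

Lemma omega_id v : 0 < v -> v <= omega v.
Proof. by move=> v0; rewrite omegaE// lerDr powR_ge0. Qed.

Lemma omega_add v x : 0 < v -> 0 <= x -> omega (v + x) <= omega v + x.
Proof.
move=> v0 x0; rewrite !omegaE// ?ltr_wpDr// addrA !lerD2r.
by rewrite powR_le_neg// lerDl.
Qed.

Lemma omega_sqr v : 0 < v -> omega v ^+ 2 <= 2 * (v `^ (- (2 * beta)) + v `^ 2).
Proof.
move=> v0; rewrite omegaE//.
rewrite (_ : - (2 * beta) = (- beta) * 2%:R); last by ring.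
rewrite powRrM !powR_mulrn ?powR_ge0 ?(ltW v0)//.
have := sqr_ge0 (v `^ (- beta) - v); rewrite sqrrB sqrrD; lra.
Qed.

(** With [N = n + 1], this is [(v + 1/N)^(-beta) + N v / (v + N)]: both summands are
    bounded with bounded derivatives on the half-line and lie below those of
    [omega]. The second one is written as [N - N^2 / (v + N)], so that only shifted
    powers occur. *)
Definition bdd_omega (n : nat) (v : R) : R :=
  (v + n.+1%:R^-1) `^ (- beta) + (n.+1%:R - n.+1%:R ^+ 2 * (v + n.+1%:R) `^ (-1)).

Let bddE (n : nat) (v : R) : 0 < v ->
  n.+1%:R - n.+1%:R ^+ 2 * (v + n.+1%:R) `^ (-1) = n.+1%:R * v / (v + n.+1%:R).
Proof.
move=> v0; have n0 : 0 < v + n.+1%:R by rewrite addr_gt0.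
rewrite powR_inv1 ?(ltW n0)//; move: (n.+1%:R : R) n0 => N n0.
by field; rewrite gt_eqF.
Qed.

Lemma bdd_omega_ge0 n v : 0 < v -> 0 <= bdd_omega n v.
Proof.
move=> v0; rewrite /bdd_omega bddE// addr_ge0 ?powR_ge0//.
by rewrite divr_ge0 ?mulr_ge0 ?addr_ge0// ltW.
Qed.

Lemma bdd_omega_le n v : 0 < v -> bdd_omega n v <= omega v.
Proof.
move=> v0; rewrite /bdd_omega bddE// omegaE// lerD//.
  by rewrite powR_le_neg// lerDl.
by rewrite ler_pdivrMr ?addr_gt0// mulrDr [_ * v]mulrC lerDr mulr_ge0// ltW.
Qed.

Lemma bdd_omega_cvg v : 0 < v -> bdd_omega n v @[n --> \oo] --> omega v.
Proof.
move=> v0; rewrite omegaE//; apply: cvgD.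
  have h : (fun n : nat => v + n.+1%:R^-1) @ \oo --> v.
    by rewrite -[X in _ --> X]addr0; apply: cvgD; [exact: cvg_cst|exact: cvg_harmonic].
  have c : {for v, continuous (fun x : R => x `^ (- beta))}.
    apply: differentiable_continuous; apply/derivable1_diffP.
    by have [] := is_derive1_powR (- beta) v0.
  exact: (cvg_comp _ _ h c).
have -> : (fun n : nat => n.+1%:R - n.+1%:R ^+ 2 * (v + n.+1%:R) `^ (-1)) =
    (fun n : nat => n.+1%:R * v / (v + n.+1%:R)).
  by apply/funext => n; rewrite bddE.
apply: (@squeeze_cvgr _ _ _ _ (fun n : nat => v - v ^+ 2 * harmonic n) (cst v)).
- near=> n; have n0 : 0 < n.+1%:R :> R by [].
  have vn : 0 < v + n.+1%:R by rewrite addr_gt0.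
  apply/andP; split; last first.
    by rewrite ler_pdivrMr// mulrDr [_ * v]mulrC lerDr mulr_ge0// ltW.
  rewrite ler_pdivlMr// /harmonic.
  rewrite -subr_ge0 (_ : _ - _ = v ^+ 3 / n.+1%:R); last first.
    by rewrite /=; move: (n.+1%:R : R) n0 => N n0; field; rewrite gt_eqF.
  by rewrite divr_ge0 ?exprn_ge0// ltW.
- rewrite -[X in _ --> X]subr0 -[X in _ - X](mulr0 (v ^+ 2)).
  apply: cvgB; first exact: cvg_cst.
  by apply: cvgM; [exact: cvg_cst|exact: cvg_harmonic].
- exact: cvg_cst.
Unshelve. all: by end_near. Qed.

Lemma bdd_omega_C11 : exists (deta : nat -> R -> R) (Leta : nat -> R),
  forall n, C11 (Leta n) (bdd_omega n) (deta n).
Proof.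
have H n : exists p : R * (R -> R), C11 p.1 (bdd_omega n) p.2.
  have n0 : 0 < n.+1%:R^-1 :> R by rewrite invr_gt0.
  have [L1 H1] := C11_shift_powR nbeta n0.
  have [L2 H2] := C11_shift_powR (lerN10 R) (ltr0Sn R n).
  have H3 := C11B (@C11_cst R _ n.+1%:R (lexx _)) (C11Z (n.+1%:R ^+ 2) H2).
  by eexists (_, _); exact: C11D H1 H3.
have [p Hp] := choice H.
by exists (fun n => (p n).2), (fun n => (p n).1) => n; exact: Hp.
Qed.

End weight.

(** * The growth rate *)

Section growth.
Context {R : realType}.
Implicit Types t s u v x r : R.

Lemma is_derive_within_interior (f : R -> R) x d : 0 < x ->
  is_derive_within `[0, +oo[ f x d -> is_derive x 1 f d.
Proof.
move=> x0 H.
suff h : h^-1 *: (f (h *: 1 + x) - f x) @[h --> 0^'] --> d.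
  by apply: DeriveDef; [apply/cvg_ex; exists d|exact: cvg_lim h].
apply/cvgrPdist_le => e e0.
move/cvgrPdist_le : H => /(_ e e0) /= [r r0 Hr]; exists (Num.min r x).
  by rewrite /= lt_min r0.
move=> h /=; rewrite sub0r normrN lt_min => /andP[hr hx] hn0.
have hE : h *: (1 : R) + x = x + h by rewrite /GRing.scale/= mulr1 addrC.
rewrite hE /GRing.scale/= [h^-1 * _]mulrC.
have := Hr (x + h); rewrite /= opprD addrA subrr sub0r normrN => /(_ hr).
rewrite (_ : x + h - x = h); last by rewrite addrAC subrr add0r.
apply.
- by rewrite -subr_eq0 addrAC subrr add0r.
- rewrite in_itv/= andbT; have := ler_norm (- h); rewrite normrN; lra.
Qed.

(** Serves for the grid approximations of a continuous function of two variables,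
    which depend on the point through integer parts only. *)
Lemma measurable_nat_comp d (X : measurableType d) (u w : X -> nat) (G : nat -> nat -> R) :
  (forall i, measurable (u @^-1` [set i])) -> (forall i, measurable (w @^-1` [set i])) ->
  measurable_fun setT (fun y => G (u y) (w y)).
Proof.
move=> mu mw _ B mB; rewrite setTI.
rewrite (_ : _ @^-1` B = \bigcup_i \bigcup_j
  (if G i j \in B then u @^-1` [set i] `&` w @^-1` [set j] else set0)).
  apply: bigcup_measurable => i _; apply: bigcup_measurable => j _.
  by case: ifP => // _; exact: measurableI.
apply/seteqP; split => [x Bx|x [i _ [j _]]].
  by exists (u x) => //; exists (w x) => //; rewrite mem_set.
by case: ifPn => // /set_mem Gij [/= ui wj]; rewrite ui wj.
Qed.

Variables (T A B : R) (g dg d2g : R -> R -> R).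
Hypothesis g_ge0 : forall t v : R, 0 <= t -> 0 <= v -> 0 <= g t v.
Hypothesis g_cont : {within (`[0, +oo[ : set R) `*` (`[0, +oo[ : set R),
  continuous (fun p : R * R => g p.1 p.2)}.
Hypothesis g_0 : forall t : R, 0 <= t -> g t 0 = 0.
Hypothesis g_diff : forall t v : R, 0 <= t -> 0 <= v ->
        [/\ is_derive_within `[0, +oo[ (g t) v (dg t v),
            is_derive_within `[0, +oo[ (dg t) v (d2g t v),
            `|dg t v| < A & `|d2g t v| < B].

Lemma growth_lip t u v : 0 <= t -> 0 < u -> 0 < v -> `|g t u - g t v| <= A * `|u - v|.
Proof.
move=> t0; apply: (@mvt_lip _ _ (dg t)) => x x0; have [h _ h' _] := g_diff t0 (ltW x0).
  exact: is_derive_within_interior.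
exact: ltW.
Qed.

Lemma growth_taylor t u v : 0 <= t -> 0 < u -> 0 < v ->
  `|g t u - g t v - dg t v * (u - v)| <= B * (u - v) ^+ 2.
Proof.
move=> t0 u0 v0.
have h1 x : 0 < x -> is_derive x 1 (g t) (dg t x).
  by move=> x0; have [h _ _ _] := g_diff t0 (ltW x0); exact: is_derive_within_interior.
have h2 x : 0 < x -> is_derive x 1 (dg t) (d2g t x).
  by move=> x0; have [_ h _ _] := g_diff t0 (ltW x0); exact: is_derive_within_interior.
have h3 x : 0 < x -> `|d2g t x| <= B.
  by move=> x0; have [_ _ _ /ltW] := g_diff t0 (ltW x0).
exact: (mvt_taylor h1 h2 h3 u0 v0).
Qed.

Lemma growth_near t v e : 0 <= t -> 0 <= v -> 0 < e -> exists2 r, 0 < r &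
  forall s w, 0 <= s -> 0 <= w -> `|t - s| < r -> `|v - w| < r -> `|g t v - g s w| <= e.
Proof.
move=> t0 v0 e0.
have Q0 : ((`[0, +oo[ : set R) `*` (`[0, +oo[ : set R)) (t, v).
  by split; rewrite /= in_itv/= andbT.
have := (subspace_continuousP _ _).1 g_cont (t, v) Q0 => /cvgrPdist_le/(_ e e0).
rewrite /= nearE => /nbhs_ballP[r /= r0 Hr]; exists r => // s w s0 w0 ts vw.
by apply: (Hr (s, w)); split; rewrite /= ?in_itv/= ?andbT.
Qed.

(** The Lipschitz bound is available on [(0, oo)] only; letting the second point tend
    to 0, where [g] is continuous and vanishes, gives the linear bound. *)
Lemma growth_le t v : 0 <= t -> 0 < v -> g t v <= A * v.
Proof.
move=> t0 v0; apply/ler_addgt0Pr => e e0.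
have [r r0 Hr] := growth_near t0 (lexx 0) (divr_gt0 e0 (ltr0n R 2)).
have A0 : 0 < A by have [_ _ + _] := g_diff t0 (ltW v0); exact: le_lt_trans.
pose u := Num.min v (r / 2).
have u0 : 0 < u by rewrite lt_min v0 divr_gt0.
have uv : u <= v by rewrite ge_min lexx.
have ur : u <= r / 2 by rewrite ge_min lexx orbT.
have := Hr t u t0 (ltW u0); rewrite subrr normr0 sub0r normrN gtr0_norm// => /(_ r0).
have -> : u < r by lra.
move=> /(_ isT); rewrite g_0// sub0r normrN => h1.
have := growth_lip t0 v0 u0; rewrite (ger0_norm (_ : 0 <= v - u)) ?subr_ge0//.
move=> h2; have h3 := ler_norm (g t v - g t u); have h4 := ler_norm (g t u).
have : 0 <= A * u by rewrite mulr_ge0// ltW.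
move: h1 h2 h3 h4; rewrite mulrBr; lra.
Qed.

(** Compactness of the rectangle [0, T] x [0, b] makes the continuity uniform. *)
Lemma growth_unif b rho : 0 < rho -> exists2 h : R, 0 < h &
  forall s t v, 0 <= s <= T -> 0 <= t <= T -> 0 < v <= b -> `|s - t| <= h ->
    `|g s v - g t v| <= rho.
Proof.
move=> rho0.
have := compact_setX (@segment_compact R 0 T) (@segment_compact R 0 b).
move=> /compact_near_coveringP/(_ R (nbhs (0 : R))).
move=> /(_ (fun h p => forall s, 0 <= s -> 0 <= p.1 -> 0 <= p.2 -> `|s - p.1| <= h -> `|g s p.2 - g p.1 p.2| <= rho)).
case.
- move=> [t v] [/=]; rewrite !in_itv/= => /andP[t0 _] /andP[v0 _].
  have [r r0 Hr] := growth_near t0 v0 (divr_gt0 rho0 (ltr0n R 2)).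
  have r2 : 0 < r / 2 by rewrite divr_gt0.
  exists (ball (t, v) (r / 2), ball (0 : R) (r / 2)).
    by split; exact: nbhsx_ballx.
  move=> [[t' v'] h] [/= [tt vv] hr] s s0 t'0 v'0 st.
  move: tt vv hr; rewrite /ball/= sub0r normrN => tt vv hr.
  have hh := ler_norm h.
  have ts : `|t - s| < r.
    rewrite (_ : t - s = (t - t') - (s - t')); last by ring.
    rewrite (le_lt_trans (ler_normB _ _))//; lra.
  have h1 : `|g t v - g s v'| <= rho / 2 by apply: Hr => //; lra.
  have h2 : `|g t v - g t' v'| <= rho / 2 by apply: Hr => //; lra.
  rewrite (_ : _ - _ = (g t v - g t' v') - (g t v - g s v')); last by ring.
  rewrite (le_trans (ler_normB _ _))//; lra.
- move=> e /= e0 He; exists (e / 2); first by rewrite divr_gt0.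
  move=> s t v /andP[s0 sT] tT /andP[v0 vb] st.
  apply: (He (e / 2) _ (t, v)) => //=.
    by rewrite sub0r normrN gtr0_norm ?divr_gt0//; lra.
  - by split; rewrite /= in_itv/= ?tT// (ltW v0).
  - by case/andP: tT.
  - exact: ltW.
Qed.

Lemma growth_measurable : measurable_fun setT
  (fun p : R * R => ((fun q : R * R => g q.1 q.2) \_ (`[0, +oo[ `*` `[0, +oo[)) p).
Proof.
pose fl (n : nat) (x : R) : R := (Num.truncn (`|x| * n.+1%:R))%:R / n.+1%:R.
have flE n x : 0 <= x -> 0 <= fl n x /\ `|x - fl n x| <= n.+1%:R^-1.
  move=> x0; split; first by rewrite divr_ge0.
  have n0 : 0 < n.+1%:R :> R by [].
  rewrite -(ler_pM2r n0) mulVf ?gt_eqF// -[X in _ * X](gtr0_norm n0) -normrM mulrBl.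
  rewrite divfK ?gt_eqF// (ger0_norm x0).
  have /truncn_itv/andP[h1 h2] : 0 <= x * n.+1%:R by rewrite mulr_ge0.
  by rewrite ger0_norm ?subr_ge0//; move: h2; rewrite -natr1; lra.
have mQ : measurable ((`[0, +oo[ : set R) `*` (`[0, +oo[ : set R)) by exact: measurableX.
apply/(measurable_restrictT _ mQ).
apply: (@measurable_fun_cvg _ _ _ _ (fun n p => g (fl n p.1) (fl n p.2))).
- move=> n; apply: (measurable_funS measurableT) => //.
  have fib (f : R * R -> R) i : measurable_fun setT f ->
      measurable ((fun p => Num.truncn (`|f p| * n.+1%:R)) @^-1` [set i]).
    move=> mf.
    have mh : measurable_fun setT (fun p => `|f p| * n.+1%:R).
      by apply: measurable_funM => //; exact: measurableT_comp.
    rewrite (_ : _ @^-1` _ = setT `&` (fun p => `|f p| * n.+1%:R) @^-1` `[i%:R, i.+1%:R[).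
      exact: mh measurableT _ (measurable_itv _).
    rewrite setTI; apply/seteqP; split => p /=; rewrite in_itv/=.
      by move=> <-; apply: truncn_itv; exact: mulr_ge0.
    by move=> h; exact: truncn_def.
  have m1 i := fib fst i (@measurable_fst _ _ _ _).
  have m2 i := fib snd i (@measurable_snd _ _ _ _).
  exact: (measurable_nat_comp (fun i j => g (i%:R / n.+1%:R) (j%:R / n.+1%:R)) m1 m2).
- move=> [t v] [/=]; rewrite !in_itv/= !andbT => t0 v0.
  apply/cvgrPdist_le => e e0; have [r r0 Hr] := growth_near t0 v0 e0.
  have /cvgrPdist_lt/(_ r r0) := @cvg_harmonic R.
  apply: filterS => n; rewrite sub0r normrN ger0_norm ?harmonic_ge0// => nr.
  have [f1 f2] := flE n t t0; have [f3 f4] := flE n v v0.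
  by apply: Hr => //; [exact: le_lt_trans nr|exact: le_lt_trans nr].
Qed.

End growth.

(** * The coagulation kernel *)

Section kernel_bound.
Context {R : realType}.
Variables (beta k : R) (K : R -> R -> R).
Hypotheses (beta_gt0 : 0 < beta) (k_gt0 : 0 < k).
Hypothesis HK : coagulation_kernel beta k K.
Notation om := (omega beta).

(** The bounds on [K] are assumed away from the lines [v1 = 1] and [v2 = 1]. Setting
    the kernel to 0 there changes no integral against densities and makes the bound
    by [om om] valid everywhere. *)
Definition off_lines : set (R * R) := [set p | [/\ 0 < p.1, 0 < p.2, p.1 != 1 & p.2 != 1]].

Lemma off_lines_meas : measurable off_lines.
Proof.
have m1 : measurable ((`]0, +oo[ : set R) `\` [set 1]) by exact: measurableD.
rewrite (_ : off_lines = ((`]0, +oo[ : set R) `\` [set 1]) `*` (`]0, +oo[ `\` [set 1])).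
  exact: measurableX.
apply/seteqP; split => -[u v] /=; rewrite !in_itv/= !andbT.
  by move=> [u0 v0 /eqP u1 /eqP v1].
by move=> [[u0 /eqP u1] [v0 /eqP v1]].
Qed.

Definition regular_kernel : R * R -> R := (fun p => K p.1 p.2) \_ off_lines.

Lemma regular_kernelE u v : 0 < u -> 0 < v -> u != 1 -> v != 1 -> regular_kernel (u, v) = K u v.
Proof. by move=> *; rewrite /regular_kernel patchE mem_set. Qed.

Lemma regular_kernel_meas : measurable_fun setT regular_kernel.
Proof.
apply/(measurable_restrictT _ off_lines_meas); apply: measurable_funS HK.1.
  exact: measurableX.
by move=> [u v] [/= u0 v0 _ _]; split; rewrite /= in_itv/= andbT.
Qed.

Lemma regular_kernel_ge0 u v : 0 < u -> 0 < v -> 0 <= regular_kernel (u, v).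
Proof.
move=> u0 v0; rewrite /regular_kernel patchE; case: ifP => // _.
by have [] := HK.2 u v u0 v0.
Qed.

Lemma regular_kernel_sym u v : 0 < u -> 0 < v -> regular_kernel (u, v) = regular_kernel (v, u).
Proof.
move=> u0 v0; rewrite /regular_kernel !patchE.
have -> : ((u, v) \in off_lines) = ((v, u) \in off_lines).
  by apply/idP/idP => /set_mem[/= ? ? ? ?]; apply/mem_set.
by case: ifP => // _; have [] := HK.2 u v u0 v0.
Qed.

(** The factor 2 is due to the case of two large sizes, where
    [v1 + v2 <= 2 v1 v2]. *)
Lemma regular_kernel_le u v : 0 < u -> 0 < v ->
  regular_kernel (u, v) <= 2 * k * (om u * om v).
Proof.
have pow_om x : 0 < x -> x `^ (- beta) <= om x by move=> x0; rewrite omegaE// lerDl ltW.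
have om0 x : 0 < x -> 0 <= om x.
  by move=> x0; apply: le_trans (omega_ge1 beta_gt0 x0).
have dbl x : 0 <= x -> k * x <= 2 * k * x.
  by move=> x0; have : 0 <= k * x by [rewrite mulr_ge0// ltW]; lra.
have mixed x y : 0 < x -> 0 < y -> x < 1 -> 1 < y -> K x y <= 2 * k * (om x * om y).
  move=> x0 y0 x1 y1; have [_ _ _ h _] := HK.2 x y x0 y0.
  rewrite (le_trans (h x1 y1))// (le_trans _ (dbl _ _)) ?mulr_ge0 ?om0//.
  rewrite -mulrA ler_wpM2l ?(ltW k_gt0)// [leLHS]mulrC.
  by rewrite ler_pM ?powR_ge0 ?(ltW y0) ?pow_om ?omega_id.
move=> u0 v0; have [] := pselect (off_lines (u, v)); last first.
  move=> h; rewrite /regular_kernel patchE memNset// !mulr_ge0 ?om0// ltW//.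
move=> [_ _ /= u1 v1]; rewrite regular_kernelE//.
have [_ sym h1 _ h4] := HK.2 u v u0 v0.
move: u1 v1; rewrite !neq_lt => /orP[u1|u1] /orP[v1|v1].
- rewrite (le_trans (h1 u1 v1))// (le_trans _ (dbl _ _)) ?mulr_ge0 ?om0//.
  rewrite ler_wpM2l ?(ltW k_gt0)// powRM ?(ltW u0) ?(ltW v0)//.
  by rewrite ler_pM ?powR_ge0 ?pow_om.
- exact: mixed.
- by rewrite sym [om u * om v]mulrC; exact: mixed.
- rewrite (le_trans (h4 u1 v1))// (_ : 2 * k * _ = k * (2 * (om u * om v))); last by ring.
  rewrite ler_wpM2l ?(ltW k_gt0)//.
  have h : u * v <= om u * om v by rewrite ler_pM ?(ltW u0) ?(ltW v0) ?omega_id.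
  have : 0 <= (u - 1) * (v - 1) by rewrite mulr_ge0// subr_ge0 ltW.
  have : 0 <= u * (v - 1) by rewrite mulr_ge0 ?subr_ge0 ?(ltW u0) ?(ltW v1).
  have : 0 <= v * (u - 1) by rewrite mulr_ge0 ?subr_ge0 ?(ltW v0) ?(ltW u1).
  move: h; rewrite !mulrBr !mulr1 [v * u]mulrC; lra.
Qed.

End kernel_bound.

(** * From almost every time to every time *)

Section ae_interval.
Context {R : realType}.
Notation leb := (leb R).

Lemma ae_interval_ex (P : R -> Prop) (T a b : R) : {ae leb, forall t : R, 0 < t < T -> P t} ->
  0 <= a -> a < b -> b <= T -> exists2 t, a < t < b & P t.
Proof.
move=> [Z [mZ Z0 HZ]] a0 ab bT; apply: contrapT => H.
have sub : (`]a, b[ : set R) `<=` Z.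
  move=> t; rewrite /= in_itv/= => /andP[at_ tb]; apply: HZ => /= HP.
  apply: H; exists t; first by rewrite at_.
  by apply: HP; rewrite (le_lt_trans a0)// (lt_le_trans tb).
have : (leb `]a, b[%classic <= leb Z)%E by rewrite le_measure ?inE//; exact: measurable_itv.
by rewrite Z0 /= lebesgue_measure_itv/= lte_fin ab -EFinB lee_fin leNgt subr_gt0 ab.
Qed.

Lemma ae_cont_le (F : R -> R) (T N : R) : 0 < T -> {within `[0, T], continuous F} ->
  {ae leb, forall t : R, 0 < t < T -> F t <= N} -> forall t, 0 <= t <= T -> F t <= N.
Proof.
move=> T0 /subspace_continuousP cF aeF t tT; rewrite leNgt; apply/negP => Nt.
have d0 : 0 < F t - N by rewrite subr_gt0.
have := cF t; rewrite /= in_itv/= => /(_ tT) /cvgrPdist_lt/(_ _ d0).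
rewrite nearE => /nbhs_ballP[r /= r0 Hr].
have /andP[t0 tT'] := tT.
have [|||s /andP[sa sb] Fs] := @ae_interval_ex _ T (Num.max 0 (t - r)) (Num.min T (t + r)) aeF.
- by rewrite le_max lexx.
- by rewrite gt_max !lt_min T0/=; apply/and3P; split; lra.
- by rewrite ge_min lexx.
move: sa sb; rewrite gt_max lt_min => /andP[s0 sr] /andP[sT sr'].
have := Hr s; rewrite /ball/= in_itv/= (ltW s0) (ltW sT) => H.
have : `|t - s| < r by rewrite ltr_norml; apply/andP; split; lra.
move=> /H/(_ isT); rewrite ltr_norml => /andP[_ h].
have : F t - F s < F t - N by [].
lra.
Qed.

Lemma Linfty_ae (T m r : R) (c : R -> R -> R) : 0 < T ->
  (Linfty_weightedL1_norm T m r c < +oo)%E ->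
  0 <= fine (Linfty_weightedL1_norm T m r c) /\
  {ae leb, forall t : R, 0 < t < T ->
    (weightedL1_norm m r (c t) <= (fine (Linfty_weightedL1_norm T m r c))%:E)%E}.
Proof.
move=> T0 foo.
have H : {ae leb, forall t : R, 0 < t < T ->
    (weightedL1_norm m r (c t) <= Linfty_weightedL1_norm T m r c)%E}.
  have := ess_sup_ge leb ((fun t : R => weightedL1_norm m r (c t)) \_ `]0, T[).
  apply: (@filterS _ _ (ae_filter_ringOfSetsType leb)) => t + tT.
  by rewrite patchE mem_set//= in_itv.
have w0 f : (0 <= weightedL1_norm m r f)%E.
  by apply: integral_ge0 => v _; rewrite lee_fin mulr_ge0// addr_ge0// powR_ge0.
have [t _ Ht] := ae_interval_ex H (lexx 0) T0 (lexx T).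
have N0 := le_trans (w0 _) Ht.
have fN : Linfty_weightedL1_norm T m r c \is a fin_num.
  by rewrite fin_numElt foo (lt_le_trans _ N0)// ltNyr.
split; first exact: fine_ge0.
by apply: (@filterS _ _ (ae_filter_ringOfSetsType leb)) H => s Hs sT; rewrite fineK//; exact: Hs.
Qed.

End ae_interval.

Section weighted_pairing.
Context {R : realType}.
Notation D := (`]0%R, +oo[%classic : set R).
Notation leb := (leb R).
Variable beta : R.
Hypothesis beta_gt0 : 0 < beta.
Notation om := (omega beta).
Let om_ge0 v : 0 < v -> 0 <= om v.
Proof. by move=> v0; apply: le_trans (omega_ge1 beta_gt0 v0). Qed.

Lemma pairing_integrable (h f : R -> R) C : measurable_fun D h ->
  (forall v, 0 < v -> `|h v| <= C * om v) -> weightedL1 (- beta) 1 f ->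
  leb.-integrable D (EFin \o (fun v => h v * f v)).
Proof.
move=> mh hC [mf fN].
have mof : measurable_fun D (fun v => om v * `|f v|).
  by apply: measurable_funM; [exact: omega_meas|exact: measurableT_comp].
have iof : leb.-integrable D (EFin \o (fun v => om v * `|f v|)).
  by apply: ge0_finite_integrable => // v /Dgt0 v0; rewrite mulr_ge0// om_ge0.
apply: (@le_integrable _ _ _ leb D mD _ (EFin \o (fun v => C * (om v * `|f v|)))).
- by apply/measurable_EFinP; exact: measurable_funM.
- move=> v /Dgt0 v0 /=; rewrite lee_fin normrM (le_trans _ (ler_norm _))//.
  by rewrite mulrA ler_wpM2r// hC.
- exact: (@integrableZl _ _ _ leb D mD C _ iof).
Qed.

Lemma pairing_le (h f : R -> R) C : measurable_fun D h ->
  (forall v, 0 < v -> `|h v| <= C * om v) -> weightedL1 (- beta) 1 f ->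
  (`|\int[leb]_(v in D) (h v * f v)|%:E <= C%:E * weightedL1_norm (- beta) 1 f)%E.
Proof.
move=> mh hC w; have i := pairing_integrable mh hC w.
have [mf fN] := w.
have mof : measurable_fun D (fun v => om v * `|f v|).
  by apply: measurable_funM; [exact: omega_meas|exact: measurableT_comp].
have C0 : 0 <= C.
  have := le_trans (normr_ge0 _) (hC 1 ltr01); rewrite pmulr_lge0//.
  by rewrite (lt_le_trans ltr01)// omega_ge1.
apply: le_trans (_ : (\int[leb]_(v in D) `|h v * f v|%:E <= _)%E).
  rewrite -abse_EFin /Rintegral fineK; last exact: integrable_fin_num.
  by apply: le_abse_integral => //; apply/measurable_EFinP; exact: measurable_funM.
rewrite /weightedL1_norm -ge0_integralZl//.
- apply: ge0_le_integral => //.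
  + by apply/measurable_EFinP; apply: measurableT_comp => //; exact: measurable_funM.
  + by apply: emeasurable_funM => //; exact/measurable_EFinP.
  + move=> v /Dgt0 v0; rewrite -EFinM lee_fin normrM mulrA ler_wpM2r//; exact: hC.
- exact/measurable_EFinP.
- by move=> v /Dgt0 v0; rewrite lee_fin mulr_ge0// om_ge0.
Qed.

(** Supplies the functionals through which weak continuity is used: functions
    bounded by a multiple of [om]. *)
Lemma pairing_dual (h : R -> R) C : measurable_fun D h ->
  (forall v, 0 < v -> `|h v| <= C * om v) ->
  dual_weightedL1 (- beta) 1 (fun f => \int[leb]_(v in D) (h v * f v)).
Proof.
move=> mh hC; split.
- move=> a f1 f2 w1 w2.
  have i1 := pairing_integrable mh hC w1; have i2 := pairing_integrable mh hC w2.
  rewrite -RintegralZl// -RintegralD//; last exact: (@integrableZl _ _ _ leb D mD a _ i1).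
  by apply: eq_Rintegral => v _ /=; ring.
- by exists C => f w; exact: pairing_le.
Qed.

End weighted_pairing.

(** * A weak solution as a kernel of measures *)

Section one_weak_solution.
Context {R : realType}.
Notation D := (`]0%R, +oo[%classic : set R).
Notation leb := (leb R).

Lemma nonneg_ae_Rintegral (h f : R -> R) : measurable_fun D h -> measurable_fun D f ->
  nonneg_ae f -> \int[leb]_(v in D) (h v * `|f v|) = \int[leb]_(v in D) (h v * f v).
Proof.
move=> mh mf f0; rewrite /Rintegral; congr fine; apply: ae_eq_integral => //.
- apply/measurable_EFinP; apply: measurable_funM => //; exact: measurableT_comp.
- by apply/measurable_EFinP; exact: measurable_funM.
- apply: (@filterS _ _ (ae_filter_ringOfSetsType leb)) f0 => v fv /Dgt0 v0.
  by rewrite ger0_norm// fv.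
Qed.

Variables (beta T N : R) (c : R -> R -> R).
Hypotheses (beta_gt0 : 0 < beta) (T0 : 0 < T).
Notation om := (omega beta).
Notation w2 := (fun v : R => v `^ (- (2 * beta)) + v `^ 2).
Hypothesis c_nonneg : forall t : R, 0 <= t <= T -> nonneg_ae (c t).
Hypothesis c_wc : weakly_continuous T (- beta) 1 c.
Hypothesis N_ge0 : 0 <= N.
Hypothesis c_N : {ae leb, forall t : R, 0 < t < T ->
  (weightedL1_norm (- (2 * beta)) 2 (c t) <= N%:E)%E}.

Let om_ge1 v : 0 < v -> 1 <= om v. Proof. exact: omega_ge1. Qed.
Let om_ge0 v : 0 < v -> 0 <= om v. Proof. by move=> /om_ge1; exact: le_trans. Qed.
Let w2_ge0 v : 0 <= w2 v. Proof. by rewrite addr_ge0 ?powR_ge0. Qed.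
Let mw2 : measurable_fun setT w2.
Proof. by apply: measurable_funD; exact: measurable_powR. Qed.
Let mc t : 0 <= t <= T -> measurable_fun D (c t).
Proof. by move=> tT; have [] := c_wc.1 t tT. Qed.
Let mnc t : 0 <= t <= T -> measurable_fun D (fun v => `|c t v|).
Proof. by move=> tT; apply: measurableT_comp => //; exact: mc. Qed.

Lemma pairing_continuous (h : R -> R) C : measurable_fun D h ->
  (forall v, 0 < v -> `|h v| <= C * om v) ->
  {within `[0, T], continuous (fun t => \int[leb]_(v in D) (h v * c t v))}.
Proof. by move=> mh hC; exact: c_wc.2 _ (pairing_dual beta_gt0 mh hC). Qed.

(** The weight of [L^1_{-2 beta,2}] is not controlled by [om], but its truncation to
    [1/n, n] is. The truncated moments are thus continuous in time, inherit the
    bound at every time, and increase to the full moment. *)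
Lemma moment_bound t : 0 <= t <= T -> (weightedL1_norm (- (2 * beta)) 2 (c t) <= N%:E)%E.
Proof.
move=> tT.
pose chi (n : nat) : R -> R := w2 \_ `[n.+1%:R^-1, n.+1%:R].
have mchi n : measurable_fun setT (chi n).
  apply/(measurable_restrictT _ (measurable_itv _)); exact: measurable_funTS mw2.
have chi0 n v : 0 <= chi n v by rewrite /chi patchE; case: ifP => // _; exact: w2_ge0.
have chiw n v : chi n v <= w2 v by rewrite /chi patchE; case: ifP => // _; exact: w2_ge0.
have chiC n : exists C, forall v, 0 < v -> `|chi n v| <= C * om v.
  exists (n.+1%:R^-1 `^ (- (2 * beta)) + n.+1%:R `^ 2) => v v0.
  rewrite ger0_norm// (@le_trans _ _ (n.+1%:R^-1 `^ (- (2 * beta)) + n.+1%:R `^ 2))//.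
    rewrite /chi patchE; case: ifP => [|_]; last by rewrite addr_ge0 ?powR_ge0.
    rewrite inE/= in_itv/= => /andP[v1 v2]; rewrite lerD//.
      by apply: powR_le_neg => //; rewrite ?oppr_le0 ?invr_gt0// mulr_ge0// ltW.
    by rewrite ge0_ler_powR ?nnegrE// ltW.
  by rewrite ler_peMr ?om_ge1// addr_ge0 ?powR_ge0.
have wc s : 0 <= s <= T -> weightedL1 (- beta) 1 (c s) by exact: c_wc.1.
have H n : forall s, 0 <= s <= T -> \int[leb]_(v in D) (chi n v * c s v) <= N.
  have [C hC] := chiC n; have mD' : measurable_fun D (chi n) by exact: measurable_funTS.
  apply: (ae_cont_le T0 (pairing_continuous mD' hC)).
  apply: (@filterS _ _ (ae_filter_ringOfSetsType leb)) c_N => s Hs s0T.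
  have sT : 0 <= s <= T by case/andP: s0T => a b; rewrite !ltW.
  rewrite -lee_fin; apply: le_trans (Hs s0T).
  have i := pairing_integrable beta_gt0 mD' hC (wc s sT).
  rewrite /Rintegral fineK; last exact: integrable_fin_num.
  apply: le_trans (lee_abs _) _; apply: le_trans (le_abse_integral leb mD _) _.
    by apply/measurable_EFinP; apply: measurable_funM => //; exact: mc.
  apply: ge0_le_integral => //.
  - apply/measurable_EFinP; apply: measurableT_comp => //; apply: measurable_funM => //; exact: mc.
  - apply/measurable_EFinP; apply: measurable_funM; last exact: mnc.
    exact: measurable_funTS.
  - by move=> v _ /=; rewrite lee_fin normrM ler_wpM2r// ger0_norm.
have chi_cvg v : 0 < v -> \forall n \near \oo, chi n v = w2 v.
  move=> v0; exists (Num.truncn v + Num.truncn v^-1)%N => // n /= hn.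
  rewrite /chi patchE mem_set//= in_itv/=; apply/andP; split.
    rewrite invf_ple ?posrE//.
    have /truncn_itv/andP[_ /ltW/le_trans] : 0 <= v^-1 by rewrite invr_ge0 ltW.
    by apply; rewrite ler_nat ltnS (leq_trans _ hn)// leq_addl.
  have /truncn_itv/andP[_ /ltW/le_trans] : 0 <= v by exact: ltW.
  by apply; rewrite ler_nat ltnS (leq_trans _ hn)// leq_addr.
have E v : D v -> ((w2 v * `|c t v|)%:E = lim ((chi n v * `|c t v|)%:E @[n --> \oo]))%E.
  move=> /Dgt0 v0; apply/esym/cvg_lim => //.
  apply: (@cvg_trans _ ((w2 v * `|c t v|)%:E @[n --> \oo])); last exact: cvg_cst.
  by apply: near_eq_cvg; apply: filterS (chi_cvg v v0) => n ->.
have mchic n : measurable_fun D (fun v => (chi n v * `|c t v|)%:E).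
  apply/measurable_EFinP; apply: measurable_funM; last exact: mnc.
  exact: measurable_funTS.
have chind v : {homo chi^~ v : n m / (n <= m)%N >-> n <= m}.
  move=> n m nm; rewrite /chi !patchE; case: ifPn => [|_]; last by case: ifP.
  rewrite !inE/= !in_itv/= => /andP[v1 v2]; rewrite ifT// inE/= in_itv/=.
  apply/andP; split; last by rewrite (le_trans v2)// ler_nat.
  by rewrite (le_trans _ v1)// lef_pV2 ?posrE// ler_nat.
rewrite /weightedL1_norm; under eq_integral => v vD do rewrite (E v (set_mem vD)).
rewrite monotone_convergence//; last 2 first.
- by move=> n v _; rewrite lee_fin mulr_ge0.
- by move=> v _ n m nm; rewrite lee_fin ler_wpM2r//; exact: chind.
apply: lime_le.
  apply: ereal_nondecreasing_is_cvgn => n m nm; apply: ge0_le_integral => //.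
  - by move=> v _; rewrite lee_fin mulr_ge0.
  - exact: mchic.
  - exact: mchic.
  - by move=> v _; rewrite lee_fin ler_wpM2r//; exact: chind.
apply: nearW => n; have [C hC] := chiC n; have mD' : measurable_fun D (chi n) by exact: measurable_funTS.
have i : leb.-integrable D (EFin \o (fun v => chi n v * `|c t v|)).
  apply: (pairing_integrable beta_gt0 mD' hC); split; first exact: mnc.
  have [_] := wc t tT; apply: le_lt_trans; rewrite /weightedL1_norm.
  by under eq_integral do rewrite normr_id.
have := H n t tT; rewrite -nonneg_ae_Rintegral//; [|exact: mc|exact: c_nonneg].
by rewrite -lee_fin /Rintegral fineK//; exact: integrable_fin_num.
Qed.

Lemma moment_le (h : R -> R) t : 0 <= t <= T -> measurable_fun D h ->
  (forall v, 0 < v -> 0 <= h v <= 2 * w2 v) ->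
  (\int[leb]_(v in D) (h v * `|c t v|)%:E <= (2 * N)%:E)%E.
Proof.
move=> tT mh hw.
have mw : measurable_fun D (fun v => (w2 v * `|c t v|)%:E).
  apply/measurable_EFinP; apply: measurable_funM; last exact: mnc.
  exact: measurable_funTS.
apply: le_trans (_ : (2%:E * weightedL1_norm (- (2 * beta)) 2 (c t) <= _)%E); last first.
  by rewrite EFinM lee_pmul2l// moment_bound.
rewrite /weightedL1_norm -ge0_integralZl//; last first.
  by move=> v _; rewrite lee_fin mulr_ge0.
apply: ge0_le_integral => //.
- by move=> v /Dgt0 v0; have /andP[h0 _] := hw v v0; rewrite lee_fin mulr_ge0.
- by apply/measurable_EFinP; apply: measurable_funM => //; exact: mnc.
- exact: emeasurable_funM.
- move=> v /Dgt0 v0; have /andP[_ h1] := hw v v0.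
  by rewrite -EFinM lee_fin mulrA ler_wpM2r.
Qed.

(** The solution, which is non-negative almost everywhere only, made non-negative
    everywhere; it is extended by 0 outside [0, T] to obtain a kernel. *)
Definition solution_density (s v : R) : R := if 0 <= s <= T then ((fun v => `|c s v|) \_ D) v else 0.

Lemma solution_density_meas s : measurable_fun setT (solution_density s).
Proof.
rewrite /solution_density; have [sT|_] := boolP (0 <= s <= T); last exact: measurable_cst.
by apply/(measurable_restrictT _ mD); exact: mnc.
Qed.

Lemma solution_density_ge0 s v : 0 <= solution_density s v.
Proof. by rewrite /solution_density; case: ifP => // _; rewrite patchE; case: ifP. Qed.

Lemma solution_densityE s v : 0 <= s <= T -> 0 < v -> solution_density s v = `|c s v|.
Proof. by move=> sT v0; rewrite /solution_density sT patchE mem_set//; exact: gt0D. Qed.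

(** The mass of [A] at time [s] is the pairing with the indicator of [A], a
    continuous function of [s] by weak continuity. *)
Lemma solution_density_mass_meas (A : set (measurableTypeR R)) : measurable A ->
  measurable_fun setT (fun s => \int[leb]_(v in A) (solution_density s v)%:E)%E.
Proof.
move=> mA.
have mI : measurable_fun D (\1_A : R -> R) by apply: measurable_funTS; exact: measurable_indic.
have hC v : 0 < v -> `|(\1_A v : R)| <= 1 * om v.
  move=> v0; rewrite mul1r (le_trans _ (om_ge1 v0))// indicE.
  by case: (_ \in _); rewrite ?normr1 ?normr0.
have m0 : measurable_fun setT ((fun s => \int[leb]_(v in D) (\1_A v * c s v)) \_ `[0, T]).
  apply/(measurable_restrictT _ (measurable_itv _)).
  by apply: subspace_continuous_measurable_fun => //; exact: pairing_continuous mI hC.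
rewrite (_ : (fun _ => _) = EFin \o ((fun s => \int[leb]_(v in D) (\1_A v * c s v)) \_ `[0, T])).
  exact/measurable_EFinP.
apply/funext => s /=; rewrite patchE; have [sT|sT] := boolP (0 <= s <= T); last first.
  rewrite ifF; last by apply/negbTE; rewrite notin_setE /= in_itv/=; exact/negP.
  by apply: integral0_eq => v _; rewrite /solution_density (negbTE sT).
rewrite ifT; last by rewrite inE/= in_itv.
rewrite -nonneg_ae_Rintegral//; [|exact: mc|exact: c_nonneg].
have i : leb.-integrable D (EFin \o (fun v => \1_A v * `|c s v|)).
  apply: (pairing_integrable beta_gt0 mI hC); split; first exact: mnc.
  have [_] := c_wc.1 s sT; apply: le_lt_trans; rewrite /weightedL1_norm.
  by under eq_integral do rewrite normr_id.
rewrite /Rintegral fineK; last exact: integrable_fin_num.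
rewrite [LHS]integral_mkcond [RHS]integral_mkcond; apply: (@eq_integral _ _ _ leb) => v _.
rewrite !patchE /solution_density sT patchE indicE.
by case: (v \in A); case: (v \in D); rewrite /= ?mul1r ?mul0r.
Qed.

Lemma solution_density_moment (h : R -> R) s : measurable_fun D h ->
  (forall v, 0 < v -> 0 <= h v <= 2 * w2 v) ->
  (\int[leb]_(v in D) (h v * solution_density s v)%:E <= (2 * N)%:E)%E.
Proof.
move=> mh hw; have [sT|sT] := boolP (0 <= s <= T); last first.
  rewrite integral0_eq ?lee_fin ?mulr_ge0// => v _.
  by rewrite /solution_density (negbTE sT) mulr0.
under eq_integral => v vD do rewrite (solution_densityE sT (Dgt0 (set_mem vD))).
exact: moment_le.
Qed.

Let om2_w2 v : 0 < v -> 0 <= om v ^+ 2 <= 2 * w2 v.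
Proof. by move=> v0; rewrite sqr_ge0/=; exact: omega_sqr. Qed.

Lemma solution_density_ub : exists r, forall s, (\int[leb]_v (solution_density s v)%:E < r%:E)%E.
Proof.
exists (2 * N + 1) => s; apply: (@le_lt_trans _ _ (2 * N)%:E); last by rewrite lte_fin ltrDl.
have w1 v : 0 < v -> 0 <= (cst 1 v : R) <= 2 * w2 v.
  move=> v0; rewrite ler01/=; have /andP[_] := om2_w2 v0; apply: le_trans.
  by rewrite exprn_ege1 ?om_ge1.
have m1 : measurable_fun D (cst 1 : R -> R) by exact: measurable_cst.
have H := solution_density_moment s m1 w1; apply: (le_trans _ H).
rewrite [leRHS]integral_mkcond; apply: ge0_le_integral => //.
- by move=> v _; rewrite lee_fin solution_density_ge0.
- by apply/measurable_EFinP; exact: solution_density_meas.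
- apply/(measurable_restrictT _ mD); apply/measurable_EFinP; apply: measurable_funM => //.
  by apply: measurable_funTS; exact: solution_density_meas.
move=> v _; rewrite patchE mul1r; case: ifPn => // vD.
by rewrite /solution_density; case: ifP => // _; rewrite patchE (negbTE vD).
Qed.

Definition solution_kernel : R.-fker (measurableTypeR R) ~> (measurableTypeR R) :=
  @density_kernel _ (measurableTypeR R) R solution_density solution_density_meas solution_density_ge0 solution_density_mass_meas solution_density_ub.

Lemma J_solution_kernel s F : 0 <= s <= T -> measurable_fun D F ->
  J (solution_kernel s) F = \int[leb]_(v in D) (F v * c s v).
Proof.
move=> sT mF; rewrite /J /solution_kernel /density_kernel Rintegral_density//.
rewrite -(nonneg_ae_Rintegral mF (mc sT) (c_nonneg sT)).
by apply: eq_Rintegral => v /set_mem/Dgt0 v0; rewrite solution_densityE.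
Qed.

Lemma solution_kernel_moment2 s : moment2_le om (solution_kernel s) (2 * N).
Proof.
have mo2 : measurable_fun D (fun v => om v ^+ 2) by apply: measurable_funX; exact: omega_meas.
rewrite /moment2_le integral_mkcond /solution_kernel /density_kernel ge0_integral_density; last 2 first.
- apply: (measurable_restrictT _ mD).1; exact/measurable_EFinP.
- by move=> v; rewrite patchE; case: ifP => // _; rewrite lee_fin sqr_ge0.
apply: le_trans (solution_density_moment s mo2 om2_w2); rewrite [leRHS]integral_mkcond.
rewrite le_eqVlt; apply/orP; left; apply/eqP; apply: eq_integral => v _.
by rewrite !patchE; case: ifP => // _; rewrite mul0e.
Qed.

End one_weak_solution.

(** * Regular test functions in the weak formulation *)

Section test_functions.
Context {R : realType}.
Notation D := (`]0%R, +oo[%classic : set R).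
Notation leb := (leb R).

Lemma C11_is_derive L (f df : R -> R) (x : R) : C11 L f df -> 0 < x -> is_derive x 1 f (df x).
Proof.
move=> H x0; have L0 := C11_ge0 H.
suff h : h^-1 *: (f (h *: 1 + x) - f x) @[h --> 0^'] --> df x.
  by apply: DeriveDef; [apply/cvg_ex; exists (df x)|exact: cvg_lim h].
apply/cvgrPdist_le => e e0.
have r0 : 0 < Num.min (e / (L + 1)) x by rewrite lt_min x0 divr_gt0// ltr_wpDl.
exists (Num.min (e / (L + 1)) x) => // h /=.
rewrite sub0r normrN lt_min => /andP[he hx] hn0.
have hE : h *: (1 : R) + x = x + h by rewrite /GRing.scale/= mulr1 addrC.
rewrite hE /GRing.scale/=.
have xh : 0 < x + h by have := ler_norm (- h); rewrite normrN; lra.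
have [_ _] := H (x + h) x xh x0; rewrite (_ : x + h - x = h); last by rewrite addrAC subrr add0r.
move=> h1; have hp : 0 < `|h| by rewrite normr_gt0.
rewrite -(ler_pM2r hp) -normrM.
rewrite (_ : _ * h = - (f (x + h) - f x - df x * h)); last by field.
rewrite normrN (le_trans h1)// -[h ^+ 2]real_normK ?num_real// expr2 mulrA ler_wpM2r//.
rewrite (le_trans (ler_wpM2l L0 (ltW he)))// mulrA ler_pdivrMr ?ltr_wpDl//.
by rewrite mulrDr mulr1 [e * L]mulrC lerDl ltW.
Qed.

(** Integration by parts on a compact interval that contains the support of the test
    function in its interior. *)
Lemma C11_W1infty L (f df : R -> R) : C11 L f df -> W1infty f df.
Proof.
move=> H; split.
- split; first exact: C11_measurable H.
  by exists L; apply: aeW => v v0; exact: C11_bnd H v0.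
- split; first exact: C11_measurable_d H.
  by exists L; apply: aeW => v v0; exact: C11_dbnd H v0.
move=> z [zd [a [b [a0 zs]]]].
have z1 : forall x, derivable z x 1 by move=> x; exact: (zd 0%N x).
have cz : continuous z.
  by move=> x; apply: differentiable_continuous; exact/derivable1_diffP.
have cz1 : continuous (derive1 z).
  move=> x; apply: differentiable_continuous; apply/derivable1_diffP; exact: (zd 1%N x).
have zz v : ~~ (a <= v <= b) -> z v = 0 /\ derive1 z v = 0.
  move=> vab; split; first exact: zs.
  rewrite derive1E (@near_eq_derive _ _ _ z (cst 0)) ?derive_cst//.
  have ov : open (~` `[a, b]%classic : set R) by apply: closed_openC; exact: interval_closed.
  have : nbhs v (~` `[a, b]%classic : set R).
    by apply: open_nbhs_nbhs; split => //=; rewrite in_itv/=; exact/negP.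
  by apply: filterS => u /=; rewrite in_itv/= => /negP; exact: zs.
pose a' := a / 2; pose b' := Num.max a b + 1.
have a'0 : 0 < a' by rewrite divr_gt0.
have a'a : a' < a by rewrite /a'; lra.
have aM : a <= Num.max a b by rewrite le_max lexx.
have bM : b <= Num.max a b by rewrite le_max lexx orbT.
have ab' : a' < b' by rewrite /b'; lra.
have itvE (h : R -> R) : (forall v, ~~ (a <= v <= b) -> h v = 0) ->
    \int[leb]_(v in D) h v = \int[leb]_(v in `[a', b']) h v.
  move=> h0; rewrite Rintegral_mkcond [RHS]Rintegral_mkcond.
  apply: eq_Rintegral => v _; rewrite !patchE.
  have [vab|vab] := boolP (a <= v <= b); last first.
    by case: ifP => _; case: ifP => _; rewrite ?h0.
  have /andP[va vb] := vab; rewrite !ifT//; rewrite inE/= in_itv/=.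
    by apply/andP; split; rewrite /b'; lra.
  by rewrite andbT (lt_le_trans a0).
rewrite (itvE (fun v => f v * _)); last by move=> v /zz[_ ->]; rewrite mulr0.
rewrite (itvE (fun v => df v * _)); last by move=> v /zz[-> _]; rewrite mulr0.
have cf : {in D, continuous f} by apply: (@lip_continuous _ (2 * L)) => u v; exact: C11_lip H.
have cdf : {in D, continuous df} by apply: (@lip_continuous _ (2 * L)) => u v; exact: C11_dlip H.
have Dp (v : R) : 0 < v -> v \in D by move=> v0; rewrite mem_set//; exact: gt0D.
have b'0 : 0 < b' by exact: lt_trans ab'.
have wdf : {within `[a', b'], continuous df}.
  apply: continuous_in_subspaceT => v; rewrite inE/= in_itv/= => /andP[va _].
  by apply: cdf; apply: Dp; exact: lt_le_trans va.
have wdz : {within `[a', b'], continuous (derive1 z)} by exact: continuous_subspaceT.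
have Lf : derivable_oo_LRcontinuous f a' b'.
  split.
  - move=> x; rewrite in_itv/= => /andP[ax _].
    by have [] := C11_is_derive H (lt_trans a'0 ax).
  - by apply: cvg_at_right_filter; apply: cf; exact: Dp.
  - by apply: cvg_at_left_filter; apply: cf; exact: Dp.
have Lz : derivable_oo_LRcontinuous z a' b'.
  split; [by move=> x _; exact: z1| |].
  - by apply: cvg_at_right_filter; exact: cz.
  - by apply: cvg_at_left_filter; exact: cz.
have df1 : {in `]a', b'[, derive1 f =1 df}.
  move=> x; rewrite in_itv/= => /andP[ax _].
  by rewrite derive1E; have [_ ->] := C11_is_derive H (lt_trans a'0 ax).
rewrite (Rintegration_by_parts ab' wdf Lf df1 wdz Lz) => [|x _]//.
have [-> _] : z b' = 0 /\ derive1 z b' = 0 by apply: zz; rewrite negb_and -!ltNge /b' orbC; apply/orP; left; lra.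
have [-> _] : z a' = 0 /\ derive1 z a' = 0 by apply: zz; rewrite negb_and -!ltNge a'a.
by rewrite !mulr0 subrr sub0r.
Qed.

End test_functions.

Section weak_solution_kernel.
Context {R : realType}.
Notation D := (`]0%R, +oo[%classic : set R).
Notation leb := (leb R).

Lemma eq_Rintegral_off1 (f h : R -> R) : measurable_fun D f ->
  (forall v, 0 < v -> v != 1 -> f v = h v) ->
  \int[leb]_(v in D) f v = \int[leb]_(v in D) h v.
Proof.
move=> mf fh.
have D1 : D = (D `\` [set 1]) `|` [set 1].
  by rewrite setDKU// => v ->; exact: gt0D.
have mD1 : measurable (D `\` [set 1]) by exact: measurableD.
have mh : measurable_fun D h.
  rewrite D1; apply/measurable_funU => //; split; last exact: measurable_fun_set1.
  apply: (@eq_measurable_fun _ _ _ _ _ f).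
    by move=> v; rewrite inE/= => -[/Dgt0 v0 /eqP v1]; rewrite fh.
  by apply: measurable_funS mf => //; exact: subDsetl.
rewrite /Rintegral; congr fine; apply: ae_eq_integral => //; try exact/measurable_EFinP.
exists [set 1]; split => //; first exact: lebesgue_measure_set1.
move=> v /=; apply: contra_notP => v1 /Dgt0 v0; rewrite fh//; exact/eqP.
Qed.

Variables (beta T k A B N : R) (K g : R -> R -> R) (c0 : R -> R) (c : R -> R -> R).
Hypotheses (beta_gt0 : 0 < beta) (T0 : 0 < T) (k_gt0 : 0 < k).
Notation om := (omega beta).
Hypothesis HK : coagulation_kernel beta k K.
Notation Q := ((`[0, +oo[ : set R) `*` (`[0, +oo[ : set R)).
Definition regular_growth (t v : R) := ((fun q : R * R => g q.1 q.2) \_ Q) (t, v).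
Hypothesis g_meas : measurable_fun setT (fun p : R * R => regular_growth p.1 p.2).
Hypothesis N_ge0 : 0 <= N.
Hypothesis c_nonneg : forall t : R, 0 <= t <= T -> nonneg_ae (c t).
Hypothesis c_wc : weakly_continuous T (- beta) 1 c.
Hypothesis c_N : {ae leb, forall t : R, 0 < t < T ->
  (weightedL1_norm (- (2 * beta)) 2 (c t) <= N%:E)%E}.
Hypothesis c_weak : weak_solution beta T K g c0 c.

Notation m := (solution_kernel beta_gt0 T0 c_nonneg c_wc N_ge0 c_N).
Notation Kr := (regular_kernel K).

(** The two formulations differ by null sets: the sign of the solution and the values
    of the kernel on the two lines removed from it. *)
Lemma weak_solution_kernel_solution :
  kernel_solution T Kr regular_growth m (fun chi => \int[leb]_(v in D) (c0 v * chi v)).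
Proof.
have [_ _ cw] := c_weak.
move=> t chi dchi L tT H; have mchi := C11_measurable H; have mdchi := C11_measurable_d H.
have sT s : s \in (`[0, t]%classic : set R) -> 0 <= s <= T.
  rewrite inE/= in_itv/= => /andP[-> st]; rewrite (le_trans st)//.
  by case/andP: tT.
rewrite J_solution_kernel//; under eq_Rintegral do rewrite mulrC.
rewrite (cw t chi dchi tT (C11_W1infty H)); congr (_ + _ + _ * _).
- apply: eq_Rintegral => s /sT {}sT; rewrite /transport_term J_solution_kernel//.
    apply: eq_Rintegral => v /set_mem/Dgt0 v0; rewrite /regular_growth patchE mem_set//.
    by split; rewrite /= in_itv/= andbT; [case/andP: sT|exact: ltW].
  apply: measurable_funM => //; apply: measurable_funTS; exact: measurable_fun_pair2 g_meas.
apply: eq_Rintegral => s /sT {}sT; rewrite /coag_term.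
pose k2 := (fun p => tilde chi p.1 p.2 * Kr p) \_ quadrant.
have mk2 : measurable_fun setT k2 by apply: tildeK_measurable => //; exact: (regular_kernel_meas HK).
have k2C v1 v2 : 0 < v1 -> 0 < v2 -> `|k2 (v1, v2)| <= 3 * L * (2 * k) * om v2 * om v1.
  move=> v10 v20; rewrite /k2 quadrantE// normrM.
  rewrite (ger0_norm (regular_kernel_ge0 HK v10 v20)).
  rewrite [leRHS](_ : _ = 3 * L * (2 * k * (om v1 * om v2))); last by ring.
  apply: ler_pM => //; first exact: (regular_kernel_ge0 HK).
    by apply: tilde_le => // v v0; exact: C11_bnd H v0.
  exact: (regular_kernel_le beta_gt0 k_gt0 HK).
have mk2' v2 : measurable_fun D (fun v1 => k2 (v1, v2)).
  by apply: measurable_funTS; exact: measurable_fun_pair1 mk2.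
have inn v2 : 0 < v2 -> J (m s) (fun v1 => tilde chi v1 v2 * Kr (v1, v2)) =
    J (m s) (fun v1 => k2 (v1, v2)).
  by move=> v20; apply: eq_J => v1 v10; rewrite /k2 quadrantE.
rewrite (eq_J _ inn) J_solution_kernel//; last by apply: measurable_funTS; exact: measurable_inner.
apply/esym; apply: eq_Rintegral_off1.
  apply: measurable_funM; last by have [] := c_wc.1 s sT.
  by apply: measurable_funTS; exact: measurable_inner.
move=> v2 v20 v21; rewrite J_solution_kernel//.
have ik := pairing_integrable beta_gt0 (mk2' v2) (fun v1 v10 => k2C v1 v2 v10 v20) (c_wc.1 s sT).
rewrite -RintegralZr//; apply: eq_Rintegral_off1.
  apply: measurable_funM => //; apply: measurable_funM => //.
  by have [] := c_wc.1 s sT.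
move=> v1 v10 v11; rewrite /k2 quadrantE//= regular_kernelE// /tilde; ring.
Qed.

End weak_solution_kernel.

(** * Stability of weak solutions *)

Section difference.
Context {R : realType}.
Notation D := (`]0%R, +oo[%classic : set R).
Notation leb := (leb R).

Lemma weightedL1B (m r : R) (f h : R -> R) :
  weightedL1 m r f -> weightedL1 m r h -> weightedL1 m r (f \- h).
Proof.
move=> [mf fN] [mh hN]; split; first exact: measurable_funB.
have w0 (v : R) : 0 <= v `^ m + v `^ r by rewrite addr_ge0 ?powR_ge0.
have mw : measurable_fun D (fun v : R => v `^ m + v `^ r).
  by apply: measurable_funD; apply: measurable_funTS; exact: measurable_powR.
have mwf (p : R -> R) : measurable_fun D p ->
    measurable_fun D (fun v => ((v `^ m + v `^ r) * `|p v|)%:E).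
  move=> mp; apply/measurable_EFinP; apply: measurable_funM => //.
  exact: measurableT_comp.
have wf0 (p : R -> R) v : (0 <= ((v `^ m + v `^ r) * `|p v|)%:E)%E by rewrite lee_fin mulr_ge0.
apply: le_lt_trans (lte_add_pinfty fN hN); rewrite /weightedL1_norm -ge0_integralD//; last 2 first.
- exact: mwf.
- exact: mwf.
apply: ge0_le_integral => //.
- by apply: mwf; exact: measurable_funB.
- by apply: emeasurable_funD; exact: mwf.
- by move=> v _; rewrite -EFinD lee_fin -mulrDr ler_wpM2l// ler_normB.
Qed.

Lemma weightedL1_moment (beta : R) (f : R -> R) : 0 < beta ->
  weightedL1 (- (2 * beta)) 2 f -> weightedL1 (- beta) 1 f.
Proof.
move=> b0 [mf fN]; split => //.
have w0 (v : R) : 0 <= v `^ (- (2 * beta)) + v `^ 2 by rewrite addr_ge0 ?powR_ge0.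
have mw : measurable_fun D (fun v : R => (v `^ (- (2 * beta)) + v `^ 2) * `|f v|).
  apply: measurable_funM; last exact: measurableT_comp.
  by apply: measurable_funD; apply: measurable_funTS; exact: measurable_powR.
have om_le (v : R) : 0 < v -> v `^ (- beta) + v `^ 1 <= 2 * (v `^ (- (2 * beta)) + v `^ 2).
  move=> v0; have o1 := omega_ge1 b0 v0; apply: (le_trans _ (omega_sqr beta v0)).
  by rewrite -/(omega beta v) expr2 ler_peMr// (le_trans _ o1).
apply: (@le_lt_trans _ _ (2%:E * weightedL1_norm (- (2 * beta)) 2 f)%E); last first.
  by apply: lte_mul_pinfty => //; rewrite lee_fin.
rewrite /weightedL1_norm -ge0_integralZl//; last 2 first.
- exact/measurable_EFinP.
- by move=> v _; rewrite lee_fin mulr_ge0.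
apply: ge0_le_integral => //.
- by move=> v _; rewrite lee_fin mulr_ge0// addr_ge0 ?powR_ge0.
- apply/measurable_EFinP; apply: measurable_funM; last exact: measurableT_comp.
  by apply: measurable_funD; apply: measurable_funTS; exact: measurable_powR.
- by apply: emeasurable_funM => //; exact/measurable_EFinP.
- move=> v /Dgt0 v0; rewrite -EFinM lee_fin mulrA ler_wpM2r//.
  exact: om_le.
Qed.

End difference.

Theorem proposition5p1 (R : realType) (beta T : R) (hbeta : 0 < beta) (hT : 0 < T) :
  exists C : R -> R -> R -> R -> R,
    forall k A B : R, 0 < k -> 0 < A -> 0 < B ->
    forall K g : R -> R -> R,
      coagulation_kernel beta k K -> growth_rate A B g ->
    forall c10 c20 : R -> R,
      nonneg_ae c10 -> weightedL1 (- (2 * beta)) 2 c10 ->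
      nonneg_ae c20 -> weightedL1 (- (2 * beta)) 2 c20 ->
    forall c1 c2 : R -> R -> R,
      weak_solution beta T K g c10 c1 ->
      weak_solution beta T K g c20 c2 ->
      Linfty_weightedL1 T (- (2 * beta)) 2 c1 ->
      Linfty_weightedL1 T (- (2 * beta)) 2 c2 ->
    let CT := C k A (fine (Linfty_weightedL1_norm T (- (2 * beta)) 2 c1))
                    (fine (Linfty_weightedL1_norm T (- (2 * beta)) 2 c2)) in
    0 < CT /\
    forall t : R, 0 <= t <= T ->
      (weightedL1_norm (- beta)%R 1 (c1 t \- c2 t)%R
        <= CT%:E * weightedL1_norm (- beta)%R 1 (c10 \- c20)%R)%E.
Proof.
(* 2 (N1 + N2) bounds the second moment of c1 + c2, as omega^2 is at most twice the
   weight of the given norms *)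
exists (fun k A N1 N2 => expR (gronwall_rate k A (2 * (N1 + N2)) * T)) => k A B k0 A0 B0 K g HK HG.
move=> c10 c20 _ w10 _ w20 c1 c2 cw1 cw2 [_ L1] [_ L2].
have [N10 N1ae] := Linfty_ae hT L1; have [N20 N2ae] := Linfty_ae hT L2.
set N1 := fine _ in N10 N1ae *; set N2 := fine _ in N20 N2ae *.
move=> CT; split; first exact: expR_gt0.
have [c1n c1w _] := cw1; have [c2n c2w _] := cw2.
have [g0 gcont g00 [dg [d2g gd]]] := HG.
have gm := growth_measurable gcont.
have s1 := weak_solution_kernel_solution hbeta hT k0 HK gm N10 c1n c1w N1ae cw1.
have s2 := weak_solution_kernel_solution hbeta hT k0 HK gm N20 c2n c2w N2ae cw2.
set m1 := solution_kernel _ _ _ _ _ _ in s1; set m2 := solution_kernel _ _ _ _ _ _ in s2.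
have bS s : moment2_le (omega beta) (msum m1 m2 s) (2 * (N1 + N2)).
  rewrite /moment2_le integral_msum; last 2 first.
  - by apply/measurable_EFinP; apply: measurable_funX; exact: omega_meas.
  - by move=> v _; rewrite lee_fin sqr_ge0.
  by rewrite mulrDr EFinD; apply: leeD; exact: solution_kernel_moment2.
have [deta [Leta eta_C11]] := bdd_omega_C11 hbeta.
have t0T t : 0 <= t <= T -> 0 <= t by case/andP.
have gE t v : 0 <= t <= T -> 0 < v -> regular_growth g t v = g t v.
  move=> /t0T t0 v0; rewrite /regular_growth patchE mem_set//.
  by split; rewrite /= in_itv/= andbT// ltW.
have w1 := weightedL1_moment hbeta w10; have w2 := weightedL1_moment hbeta w20.
have [md dN] := weightedL1B w1 w2.
pose n0 := fine (weightedL1_norm (- beta) 1 (c10 \- c20)).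
have dN0 : (0 <= weightedL1_norm (- beta)%R 1 (c10 \- c20)%R)%E.
  by apply: integral_ge0 => v _; rewrite lee_fin mulr_ge0// addr_ge0 ?powR_ge0.
have n0_ge0 : 0 <= n0 by exact: fine_ge0.
have n0E : n0%:E = weightedL1_norm (- beta) 1 (c10 \- c20).
  by rewrite fineK// fin_numElt dN (lt_le_trans _ dN0)// ltNyr.
have E0_le P L psi dpsi : 0 <= P -> C11 L psi dpsi ->
    (forall v, 0 < v -> `|psi v| <= P * omega beta v) -> diffJ m1 m2 0 psi <= P * n0.
  move=> P0 H psile; have mpsi := C11_measurable H.
  have T00 : 0 <= (0 : R) <= T by rewrite lexx ltW.
  rewrite /diffJ (s1 0 psi dpsi L T00 H) (s2 0 psi dpsi L T00 H) !set_itv1 !Rintegral_set1.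
  rewrite !mulr0 !addr0.
  under eq_Rintegral do rewrite mulrC.
  under [X in _ - X]eq_Rintegral do rewrite mulrC.
  have i1 := pairing_integrable hbeta mpsi psile w1.
  have i2 := pairing_integrable hbeta mpsi psile w2.
  rewrite -RintegralB//.
  under eq_Rintegral do rewrite -mulrBr.
  rewrite -lee_fin EFinM n0E; apply: le_trans (pairing_le hbeta mpsi psile (weightedL1B w1 w2)).
  by rewrite lee_fin ler_norm.
move=> t tT; have tP := tT.
have wt := weightedL1B (c1w.1 t tT) (c2w.1 t tT).
rewrite -n0E -EFinM.
have X : expR (gronwall_rate k A (2 * (N1 + N2)) * t) * n0 <= CT * n0.
  rewrite ler_wpM2r// ler_expR ler_wpM2l//; last by case/andP: tT.
  by rewrite /gronwall_rate addr_ge0 ?mulr_ge0 ?addr_ge0 ?(ltW k0) ?(ltW A0).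
apply: (@dual_norm R (omega beta) (omega_meas beta) (fun v => @omega_ge1 R beta hbeta v)
  _ _ _ eta_C11 (@bdd_omega_ge0 R beta) (@bdd_omega_le R beta hbeta) (@bdd_omega_cvg R beta)
  (c1 t \- c2 t)); [exact: wt.1|exact: wt.2|].
move=> L b phi dphi H phile phis; apply: le_trans X.
have mphi := C11_measurable H.
have phile1 v : 0 < v -> `|phi v| <= 1 * omega beta v by move=> v0; rewrite mul1r phile.
have i1 := pairing_integrable hbeta mphi phile1 (c1w.1 t tT).
have i2 := pairing_integrable hbeta mphi phile1 (c2w.1 t tT).
have -> : \int[leb R]_(v in `]0, +oo[) (phi v * (c1 t \- c2 t) v) = diffJ m1 m2 t phi.
  rewrite /diffJ /m1 /m2 !J_solution_kernel// -RintegralB//.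
  by apply: eq_Rintegral => v _ /=; rewrite mulrBr.
apply: (@dual_bound R (omega beta) (omega_meas beta) (fun v => @omega_ge1 R beta hbeta v)
  (@omega_id R beta) (@omega_add R beta hbeta) _ _ _ eta_C11 (@bdd_omega_ge0 R beta)
  (@bdd_omega_le R beta hbeta) (@bdd_omega_cvg R beta) T k A B (2 * (N1 + N2)) k0 A0 B0
  (regular_kernel K) (regular_kernel_meas HK) (regular_kernel_ge0 HK) (regular_kernel_sym HK)
  (regular_kernel_le hbeta k0 HK) (regular_growth g) dg gm _ _ _ _ _ _ m1 m2 bS _ _ s1 s2
  n0 n0_ge0 E0_le t L b phi dphi tT H phile phis).
- by move=> s v sT v0; rewrite gE//; apply: g0; [exact: t0T sT|exact: ltW].
- by move=> s v sT v0; rewrite gE//; exact: (growth_le gcont g00 gd (t0T _ sT) v0).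
- by move=> s v sT v0; have [_ _ /ltW] := gd s v (t0T _ sT) (ltW v0).
- by move=> s u v sT u0 v0; rewrite !gE//; exact: (growth_lip gd (t0T _ sT)).
- by move=> s u v sT u0 v0; rewrite !gE//; exact: (growth_taylor gd (t0T _ sT)).
- move=> b' rho rho0; have [h h0 Hh] := @growth_unif R T g gcont b' rho rho0.
  exists h => // s t' v sT t'T v0b st.
  by have /andP[v0 _] := v0b; rewrite !gE//; exact: Hh.
Qed.
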